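(* Let $0<\Phi<2\pi$ and consider the electron (mass $m_e$) of a hydrogen atom, with Coulomb potential $V(r)=-\frac{e^2}{4\pi\epsilon_0 r}$, confined to the wedge given in spherical coordinates by $r\ge 0$, $0\le\theta\le\pi$, $0\le\phi\le\Phi$, with infinite potential barriers at $\phi=0$ and $\phi=\Phi$ (so $\psi=0$ there) and no radial confinement. Solve the stationary Schrödinger equation $-\frac{\hbar^2}{2m_e}\nabla^2\psi+V\psi=E\psi$ by separation of variables $\psi=\mathcal{R}(r)\,\Theta(\theta)\,F(\phi)$, where $\Theta$ is required to be square-integrable, $\int_0^\pi|\Theta(\theta)|^2\sin\theta\,d\theta<\infty$, and $\mathcal{R}$ is required to be regular at $r=0$ and normalisable as $r\to\infty$. Then the effective azimuthal quantum number is $\mu=n_\phi\pi/\Phi$ with $n_\phi\in\{1,2,3,\ldots\}$, the polar quantum number is $\nu=\mu+k$ with $k\in\{0,1,2,\ldots\}$, the principal quantum number is $n=n_r+\nu+1$, where $n_r\in\{0,1,2,\ldots\}$ is the number of radial nodes, and the bound-state energy levels are $$E=-\frac{13.6\text{ eV}}{(n_r+\nu+1)^2}=-\frac{13.6\text{ eV}}{\left(n_r+\frac{n_\phi\pi}{\Phi}+k+1\right)^2}.$$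
   Context: Here $m_e,e,\epsilon_0,\hbar>0$ are the physical constants, and $13.6$ eV denotes the value of $\frac{m_ee^4}{2\hbar^2(4\pi\epsilon_0)^2}$. The separated equations are $F''=-\mu^2F$ on $[0,\Phi]$ with $F(0)=F(\Phi)=0$; the polar (associated Legendre) equation $\frac{1}{\sin\theta}\frac{d}{d\theta}\left(\sin\theta\frac{d\Theta}{d\theta}\right)+\left[\nu(\nu+1)-\frac{\mu^2}{\sin^2\theta}\right]\Theta=0$ on $(0,\pi)$, where $\nu(\nu+1)$ is the separation constant; and the radial equation $\left[-\frac{\hbar^2}{2m_e}\frac{1}{r^2}\frac{d}{dr}\left(r^2\frac{d}{dr}\right)+\frac{\nu(\nu+1)\hbar^2}{2m_er^2}-\frac{e^2}{4\pi\epsilon_0r}\right]\mathcal{R}=E\mathcal{R}$ on $r>0$.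
   Formalization: For π<Φ<2π it is additionally required that ψ→0 on the polar axis (θ→0 and θ→π), the common edge of the barriers; without this, square-integrability of Θ alone does not force ν=μ+k when n_φ=1, since then μ<1. *)

(* Defs.v *)
From Stdlib Require Import Reals List.
From Coquelicot Require Import Coquelicot.

Open Scope R_scope.

(** Derivative of a complex-valued function of a real variable, componentwise.
    Like [Derive] it is total, so it is always used together with
    [twice_differentiable_on]. *)
Definition CDerive (f : R -> C) (x : R) : C :=
  (Derive (fun t => Re (f t)) x, Derive (fun t => Im (f t)) x).

Definition ex_CDerive (f : R -> C) (x : R) : Prop :=
  ex_derive (fun t => Re (f t)) x /\ ex_derive (fun t => Im (f t)) x.

Definition twice_differentiable_on (D : R -> Prop) (f : R -> C) : Prop :=
  forall x, D x -> ex_CDerive f x /\ ex_CDerive (CDerive f) x.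

Definition coulomb_potential (e eps0 r : R) : R :=
  - (e ^ 2 / (4 * PI * eps0 * r)).

(** The quantity written "13.6 eV". *)
Definition rydberg_energy (me e eps0 hbar : R) : R :=
  me * e ^ 4 / (2 * hbar ^ 2 * (4 * PI * eps0) ^ 2).

(** Wave functions are given in spherical coordinates [psi r theta phi]. *)
Definition spherical_laplacian (psi : R -> R -> R -> C) (r theta phi : R) : C :=
  (RtoC (/ r ^ 2)
     * CDerive (fun s => RtoC (s ^ 2) * CDerive (fun t => psi t theta phi) s) r
   + RtoC (/ (r ^ 2 * sin theta))
     * CDerive (fun s => RtoC (sin s) * CDerive (fun t => psi r t phi) s) theta
   + RtoC (/ (r ^ 2 * sin theta ^ 2))
     * CDerive (CDerive (fun t => psi r theta t)) phi)%C.

Definition in_wedge (Phi r theta phi : R) : Prop :=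
  0 < r /\ 0 < theta < PI /\ 0 < phi < Phi.

Definition schrodinger_equation (me e eps0 hbar Phi E : R)
    (psi : R -> R -> R -> C) : Prop :=
  forall r theta phi, in_wedge Phi r theta phi ->
    (RtoC (- (hbar ^ 2 / (2 * me))) * spherical_laplacian psi r theta phi
     + RtoC (coulomb_potential e eps0 r) * psi r theta phi
     = RtoC E * psi r theta phi)%C.

(** [psi] is continuous in [phi] up to the two half-planes [phi = 0] and
    [phi = Phi], and vanishes on them. *)
Definition vanishes_on_barriers (Phi : R) (psi : R -> R -> R -> C) : Prop :=
  forall r theta, 0 < r -> 0 < theta < PI ->
    continuous_on (fun phi => 0 <= phi <= Phi) (fun phi => psi r theta phi)
    /\ psi r theta 0 = RtoC 0 /\ psi r theta Phi = RtoC 0.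

(** The same boundary condition on the common edge of the two barriers, that is
    on the polar axis [theta = 0] or [theta = PI].  For [PI < Phi] the lowest
    azimuthal number lies in (1/2, 1), and then square-integrability alone does
    not exclude the polar solutions that blow up on this edge. *)
Definition vanishes_on_edge (Phi : R) (psi : R -> R -> R -> C) : Prop :=
  forall r phi, 0 < r -> 0 < phi < Phi ->
    filterlim (fun theta => psi r theta phi) (at_right 0) (locally (RtoC 0))
    /\ filterlim (fun theta => psi r theta phi) (at_left PI) (locally (RtoC 0)).

Definition polar_square_integrable (Th : R -> C) : Prop :=
  ex_RInt_gen (fun theta => Cmod (Th theta) ^ 2 * sin theta)
    (at_right 0) (at_left PI).

Definition regular_at_origin (Rad : R -> C) : Prop :=
  exists l : C, filterlim Rad (at_right 0) (locally l).

(** Only the behaviour at infinity is constrained, whence the arbitrary lower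
    limit of integration. *)
Definition normalisable_at_infinity (Rad : R -> C) : Prop :=
  exists a, 0 < a /\
    ex_RInt_gen (fun r => Cmod (Rad r) ^ 2 * r ^ 2)
      (at_point a) (Rbar_locally p_infty).

Definition separated (Rad Th F : R -> C) (r theta phi : R) : C :=
  (Rad r * Th theta * F phi)%C.

Record separated_bound_state (me e eps0 hbar Phi E : R) (Rad Th F : R -> C)
    : Prop := {
  bound_Rad_smooth : twice_differentiable_on (fun r => 0 < r) Rad;
  bound_Th_smooth : twice_differentiable_on (fun theta => 0 < theta < PI) Th;
  bound_F_smooth : twice_differentiable_on (fun phi => 0 < phi < Phi) F;
  bound_nonzero : exists r theta phi,
    in_wedge Phi r theta phi /\ separated Rad Th F r theta phi <> RtoC 0;
  bound_schrodinger :
    schrodinger_equation me e eps0 hbar Phi E (separated Rad Th F);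
  bound_barriers : vanishes_on_barriers Phi (separated Rad Th F);
  bound_polar : polar_square_integrable Th;
  bound_regular : regular_at_origin Rad;
  bound_normalisable : normalisable_at_infinity Rad
}.

Definition azimuthal_problem (Phi mu : R) (F : R -> C) : Prop :=
  (forall phi, 0 < phi < Phi ->
     CDerive (CDerive F) phi = (RtoC (- mu ^ 2) * F phi)%C)
  /\ F 0 = RtoC 0 /\ F Phi = RtoC 0.

Definition polar_equation (mu nu : R) (Th : R -> C) : Prop :=
  forall theta, 0 < theta < PI ->
    (RtoC (/ sin theta)
       * CDerive (fun t => RtoC (sin t) * CDerive Th t) theta
     + RtoC (nu * (nu + 1) - mu ^ 2 / sin theta ^ 2) * Th theta = RtoC 0)%C.

Definition radial_equation (me e eps0 hbar nu E : R) (Rad : R -> C) : Prop :=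
  forall r, 0 < r ->
    (RtoC (- (hbar ^ 2 / (2 * me))) * RtoC (/ r ^ 2)
       * CDerive (fun s => RtoC (s ^ 2) * CDerive Rad s) r
     + RtoC (nu * (nu + 1) * hbar ^ 2 / (2 * me * r ^ 2)) * Rad r
     + RtoC (coulomb_potential e eps0 r) * Rad r
     = RtoC E * Rad r)%C.

Definition number_of_radial_nodes (Rad : R -> C) (nr : nat) : Prop :=
  exists nodes : list R, NoDup nodes /\ length nodes = nr /\
    forall r, In r nodes <-> (0 < r /\ Rad r = RtoC 0).

Definition effective_azimuthal_number (Phi : R) (nphi : nat) : R :=
  INR nphi * PI / Phi.

Definition polar_number (Phi : R) (nphi k : nat) : R :=
  effective_azimuthal_number Phi nphi + INR k.

Definition principal_number (Phi : R) (nphi k nr : nat) : R :=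
  INR nr + polar_number Phi nphi k + 1.

Definition has_quantum_numbers (me e eps0 hbar Phi E : R) (Rad Th F : R -> C)
    (nphi k nr : nat) : Prop :=
  let mu := effective_azimuthal_number Phi nphi in
  let nu := polar_number Phi nphi k in
  let n := principal_number Phi nphi k nr in
  azimuthal_problem Phi mu F
  /\ polar_equation mu nu Th
  /\ radial_equation me e eps0 hbar nu E Rad
  /\ number_of_radial_nodes Rad nr
  /\ E = - (rydberg_energy me e eps0 hbar / n ^ 2)
  /\ E = - (rydberg_energy me e eps0 hbar
            / (INR nr + INR nphi * PI / Phi + INR k + 1) ^ 2).

(* Main.v *)
(** Each separated equation is treated through a factorisation.  In the form
    [y' = w + g y], [w' = - e y - g w] (up to a weight) the raised function [w]
    solves the same equation with the angular parameter ([mu], respectively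
    [nu]) increased by one, and [(y w)' = w^2 - e y^2].  When [y w] is small at
    both ends, [e <= 0] forces [w = 0] and [e = 0]; so the ladder must stop, and
    the step at which it stops gives the quantum number.  In the radial case
    Rolle's theorem shows that each lowering step adds exactly one node.  The
    smallness at the ends comes from integrability or from the boundary
    condition, which exclude the singular solution.  Non-negative energies are
    excluded because then [x (u'^2 + Q u^2)], where [u'' = - Q u], is
    nondecreasing and eventually positive, so that [u] and [u'] cannot both be
    square-integrable.  Wronskians show that the separation constants are real.
    Conversely, lowering from the explicit top states realises all quantum
    numbers. *)

Require Import Defs.
From Stdlib Require Import Reals Lra Lia List Classical Ranalysis5 ZArith.
From Coquelicot Require Import Coquelicot.

Open Scope R_scope.

(** The [g] of each factorisation is the logarithmic derivative of a top state: [sin^mu] in the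
    polar case, [x^(l+1) exp (- c x / (l+1))] in the radial one. With these as integrating factors,
    [v = y / weight] and [h = w * weight] satisfy [v' = p h] with a strongly singular [p], and the
    singular solution shows itself as a nonzero limit of [h]. The main obstacle is that the
    hypotheses speak of the function only, in the polar case mostly in mean square, while a ladder
    step needs [y w] at both ends and then the same regularity for [w]. Hence the quantitative
    estimates on [h], which give decay rates and not just limits. A second obstacle is that a
    complex separation constant couples real and imaginary part. The Wronskian that shows it to be
    real needs regularity at the ends first, so the polar and azimuthal end estimates admit a
    general forcing [f] instead of a multiple of [y]. The threshold for the edge condition is
    [mu = 1]: the singular [sin^(-mu)] is square-integrable against [sin] exactly when [mu < 1], and
    [PI / Phi] is the lowest [mu]. *)

(** * Comparison of derivatives, real powers *)

Lemma derive_le (f g f' g' : R -> R) (a b : R) :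
  a <= b ->
  (forall x, a <= x <= b -> is_derive f x (f' x)) ->
  (forall x, a <= x <= b -> is_derive g x (g' x)) ->
  (forall x, a <= x <= b -> f' x <= g' x) ->
  f b - f a <= g b - g a.
Proof.
  intros Hab Hf Hg Hle.
  destruct (MVT_gen (fun x => g x - f x) a b (fun x => g' x - f' x)) as [c [Hc Heq]].
  - intros x Hx. rewrite Rmin_left, Rmax_right in Hx by lra.
    apply (is_derive_minus g f); [apply Hg | apply Hf]; lra.
  - intros x Hx. rewrite Rmin_left, Rmax_right in Hx by lra.
    apply derivable_continuous_pt. exists (g' x - f' x). apply is_derive_Reals.
    apply (is_derive_minus g f); [apply Hg | apply Hf]; lra.
  - rewrite Rmin_left, Rmax_right in Hc by lra.
    specialize (Hle c Hc).
    assert (0 <= (g' c - f' c) * (b - a)) by (apply Rmult_le_pos; lra).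
    lra.
Qed.

Lemma is_derive_eq (f : R -> R) (x l l' : R) :
  is_derive f x l -> l = l' -> is_derive f x l'.
Proof. intros H <-; exact H. Qed.

Lemma is_derive_Rmult (f g : R -> R) (x df dg : R) :
  is_derive f x df -> is_derive g x dg ->
  is_derive (fun t => f t * g t) x (df * g x + f x * dg).
Proof. intros Hf Hg. apply (is_derive_mult f g); auto. intros; apply Rmult_comm. Qed.

Lemma is_derive_Rminus (f g : R -> R) (x df dg : R) :
  is_derive f x df -> is_derive g x dg -> is_derive (fun t => f t - g t) x (df - dg).
Proof. intros Hf Hg. apply (is_derive_minus f g); auto. Qed.

Lemma is_derive_Rplus (f g : R -> R) (x df dg : R) :
  is_derive f x df -> is_derive g x dg -> is_derive (fun t => f t + g t) x (df + dg).
Proof. intros Hf Hg. apply (is_derive_plus f g); auto. Qed.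

Lemma is_derive_Rscal (k : R) (f : R -> R) (x df : R) :
  is_derive f x df -> is_derive (fun t => k * f t) x (k * df).
Proof. intros Hf. apply (is_derive_scal f), Hf. Qed.

Lemma is_derive_Rconst (c x : R) : is_derive (fun _ : R => c) x 0.
Proof. apply (is_derive_const (V := R_NormedModule)). Qed.

Lemma is_derive_Ropp (f : R -> R) (x df : R) :
  is_derive f x df -> is_derive (fun t => - f t) x (- df).
Proof. intros Hf. apply (is_derive_opp f), Hf. Qed.

Lemma is_derive_reflect (c : R) (f : R -> R) (x df : R) :
  is_derive f (c - x) df -> is_derive (fun t => f (c - t)) x (- df).
Proof.
  intros Hf. eapply is_derive_eq.
  - apply (is_derive_comp f (fun t => c - t)); [exact Hf | auto_derive; [exact I | reflexivity]].
  - unfold scal; simpl; unfold mult; simpl. ring.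
Qed.

Lemma is_derive_Rpower (a x : R) :
  0 < x -> is_derive (fun t => Rpower t a) x (a * Rpower x (a - 1)).
Proof.
  intros Hx. unfold Rpower.
  auto_derive; [lra|].
  unfold Rminus. rewrite Rmult_plus_distr_r, exp_plus.
  replace (-(1) * ln x) with (- ln x) by ring.
  rewrite exp_Ropp, (exp_ln x Hx). field. lra.
Qed.

Lemma Rpower_pos (x a : R) : 0 < Rpower x a.
Proof. apply exp_pos. Qed.

Lemma Rpower_le_base (a x y : R) :
  0 <= a -> 0 < x -> x <= y -> Rpower x a <= Rpower y a.
Proof. intros Ha Hx Hxy. apply Rle_Rpower_l; lra. Qed.

Lemma Rpower_ge_0 (x a : R) : 0 <= Rpower x a.
Proof. left. apply Rpower_pos. Qed.

Lemma Rabs_Rpower (x a : R) : Rabs (Rpower x a) = Rpower x a.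
Proof. apply Rabs_pos_eq, Rpower_ge_0. Qed.

Lemma Rpower_small (C a eps : R) :
  0 < a -> 0 < eps ->
  exists d, 0 < d /\ forall x, 0 < x < d -> C * Rpower x a < eps.
Proof.
  intros Ha He. assert (HC := Rabs_pos C).
  set (q := eps / (Rabs C + 1)). assert (Hq : 0 < q) by (apply Rdiv_lt_0_compat; lra).
  exists (Rpower q (/ a)). split; [apply Rpower_pos|]. intros x Hx.
  assert (H : Rpower x a < q).
  { replace q with (Rpower (Rpower q (/ a)) a).
    - apply Rlt_Rpower_l; lra.
    - rewrite Rpower_mult, Rinv_l, Rpower_1; lra. }
  assert (Hp := Rpower_pos x a).
  apply Rle_lt_trans with ((Rabs C + 1) * Rpower x a).
  - apply Rmult_le_compat_r; [lra|]. assert (H0 := Rle_abs C). lra.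
  - replace eps with ((Rabs C + 1) * q) by (unfold q; field; lra).
    apply Rmult_lt_compat_l; lra.
Qed.

Lemma scale_small (C eps : R) :
  0 < eps -> exists d, 0 < d /\ forall x, 0 < x < d -> C * x < eps.
Proof.
  intros He. destruct (Rpower_small C 1 eps Rlt_0_1 He) as [d [Hd H]].
  exists d. split; [assumption|]. intros x Hx. rewrite <- (Rpower_1 x) by lra. now apply H.
Qed.

Lemma common_bound (d1 d2 : R) :
  0 < d1 -> 0 < d2 -> exists d, 0 < d /\ d <= d1 /\ d <= d2.
Proof.
  intros H1 H2. exists (Rmin d1 d2).
  split; [now apply Rmin_glb_lt | split; [apply Rmin_l | apply Rmin_r]].
Qed.

Lemma continuous_of_derive (f : R -> R) (x l : R) : is_derive f x l -> continuous f x.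
Proof. intros H. apply (ex_derive_continuous (V := R_NormedModule) f). now exists l. Qed.

Lemma continuous_ext_R (f g : R -> R) (x : R) :
  (forall t, f t = g t) -> continuous f x -> continuous g x.
Proof. apply continuous_ext. Qed.

(** * Functions that are small at the ends of an interval *)

Definition interval (D : R -> Prop) : Prop :=
  forall x y z, D x -> D z -> x <= y <= z -> D y.

(** Only frequent smallness is required: this is what integrability provides. *)
Definition small_left (D : R -> Prop) (f : R -> R) : Prop :=
  forall eps, 0 < eps -> forall x, D x -> exists y, D y /\ y < x /\ Rabs (f y) < eps.

Definition small_right (D : R -> Prop) (f : R -> R) : Prop :=
  forall eps, 0 < eps -> forall x, D x -> exists y, D y /\ x < y /\ Rabs (f y) < eps.

(** Singles out the domains whose left end is the origin, such as [(0, d)], [(0, PI)] and the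
    half-line, so that smallness at the left end can be read off from bounds near 0. *)
Definition initial (D : R -> Prop) : Prop :=
  forall x, D x -> 0 < x /\ forall t, 0 < t < x -> D t.

Lemma small_left_of_vanishing (D : R -> Prop) (f : R -> R) :
  initial D ->
  (forall eps, 0 < eps -> exists d, 0 < d /\ forall x, D x -> x < d -> Rabs (f x) < eps) ->
  small_left D f.
Proof.
  intros HD H eps He x Hx. destruct (H eps He) as [d [Hd Hs]]. destruct (HD x Hx) as [Hx0 Hin].
  destruct (common_bound x d Hx0 Hd) as [b [Hb [Hbx Hbd]]].
  assert (Hb2 : D (b / 2)) by (apply Hin; lra).
  exists (b / 2). split; [assumption|]. split; [lra|]. apply Hs; [assumption | lra].
Qed.

Lemma small_left_of_Rpower (D : R -> Prop) (f : R -> R) (C a d : R) :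
  initial D -> 0 < a -> 0 < d ->
  (forall x, D x -> x < d -> Rabs (f x) <= C * Rpower x a) -> small_left D f.
Proof.
  intros HD Ha Hd Hf. apply small_left_of_vanishing; [assumption|]. intros eps He.
  destruct (Rpower_small C a eps Ha He) as [d' [Hd' Hs]].
  destruct (common_bound d d' Hd Hd') as [b [Hb [Hbd Hbd']]].
  exists b. split; [assumption|]. intros x Hx Hxb. destruct (HD x Hx) as [Hx0 _].
  apply Rle_lt_trans with (1 := Hf x Hx ltac:(lra)). apply Hs. lra.
Qed.

Lemma initial_interval (d : R) : initial (fun x => 0 < x < d).
Proof. intros x Hx. split; [lra | intros; lra]. Qed.

Lemma small_opp_left (D : R -> Prop) (f : R -> R) :
  small_left D f -> small_left D (fun x => - f x).
Proof.
  intros H eps He x Hx. destruct (H eps He x Hx) as [z Hz]. exists z. now rewrite Rabs_Ropp.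
Qed.

Lemma small_opp_right (D : R -> Prop) (f : R -> R) :
  small_right D f -> small_right D (fun x => - f x).
Proof.
  intros H eps He x Hx. destruct (H eps He x Hx) as [z Hz]. exists z. now rewrite Rabs_Ropp.
Qed.

(** Monotonicity upgrades frequent smallness: a negative value would persist at all points to the
    left, a positive one at all points to the right, and either keeps [f] away from 0 near that
    end. *)
Lemma monotone_small_ends (D : R -> Prop) (f f' : R -> R) :
  interval D ->
  (forall x, D x -> is_derive f x (f' x)) ->
  (forall x, D x -> 0 <= f' x) ->
  small_left D f -> small_right D f ->
  forall x, D x -> f x = 0.
Proof.
  intros HD Hf Hf' Hl Hr x Hx.
  assert (Hmon : forall a b, D a -> D b -> a <= b -> f a <= f b).
  { intros a b Ha Hb Hab.
    assert (H := derive_le (fun _ => 0) f (fun _ => 0) f' a b Hab).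
    cut (0 - 0 <= f b - f a); [lra|]. apply H.
    - intros. apply is_derive_Rconst.
    - intros y Hy. apply Hf. now apply (HD a y b).
    - intros y Hy. apply Hf'. now apply (HD a y b). }
  destruct (Rtotal_order (f x) 0) as [H | [H | H]]; [exfalso | assumption | exfalso].
  - destruct (Hr (- f x) ltac:(lra) x Hx) as [y [Hy [Hxy Hs]]].
    assert (f y <= - f x) by (apply Rabs_lt_between in Hs; lra).
    destruct (Hl (- f x) ltac:(lra) x Hx) as [z [Hz [Hzx Hs']]].
    assert (f z <= f x) by (apply Hmon; auto; lra).
    apply Rabs_lt_between in Hs'; lra.
  - destruct (Hr (f x) ltac:(lra) x Hx) as [y [Hy [Hxy Hs]]].
    assert (f x <= f y) by (apply Hmon; auto; lra).
    apply Rabs_lt_between in Hs; lra.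
Qed.

Lemma derive_of_zero (D : R -> Prop) (f : R -> R) (x l : R) :
  open D -> (forall y, D y -> f y = 0) -> D x -> is_derive f x l -> l = 0.
Proof.
  intros HD Hf Hx Hl.
  assert (H : is_derive f x 0).
  { apply (is_derive_ext_loc (fun _ => 0)).
    - destruct (HD x Hx) as [d Hd]. exists d. intros y Hy. symmetry. now apply Hf, Hd.
    - apply is_derive_Rconst. }
  apply is_derive_unique in H. apply is_derive_unique in Hl. congruence.
Qed.

(** Whatever the sign of [q], one of [f] and [- f] is nondecreasing, so [f] vanishes identically and
    with it its derivative. Applied to Wronskians, with [q] the imaginary part of a separation
    constant. *)
Lemma constant_sign_small_ends (D : R -> Prop) (f g : R -> R) (q : R) :
  interval D -> open D ->
  (forall x, D x -> is_derive f x (- q * g x)) ->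
  (forall x, D x -> 0 <= g x) ->
  small_left D f -> small_right D f ->
  forall x, D x -> q = 0 \/ g x = 0.
Proof.
  intros HD Ho Hf Hg Hl Hr x Hx.
  assert (Hz : forall t, D t -> f t = 0).
  { destruct (Rle_or_lt q 0) as [Hq | Hq].
    - apply (monotone_small_ends D f _ HD Hf); auto.
      intros t Ht. apply Rmult_le_pos; [lra | auto].
    - intros t Ht. cut (- f t = 0); [lra|].
      apply (monotone_small_ends D (fun x => - f x) (fun x => q * g x) HD);
        auto using small_opp_left, small_opp_right.
      + intros z Hz. eapply is_derive_eq; [apply is_derive_Ropp, Hf, Hz|]. ring.
      + intros z Hz. apply Rmult_le_pos; [lra | auto]. }
  assert (H := derive_of_zero D f x _ Ho Hz Hx (Hf x Hx)).
  apply Rmult_integral in H. destruct H; [left; lra | now right].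
Qed.

(** The step of every factorisation argument: [f] is the weighted product [y w],
    [a = w^2] and [b = y^2]. *)
Lemma factorisation_step (D : R -> Prop) (f a b : R -> R) (e : R) :
  interval D -> open D -> e <= 0 ->
  (forall x, D x -> is_derive f x (a x - e * b x)) ->
  (forall x, D x -> 0 <= a x /\ 0 <= b x) ->
  small_left D f -> small_right D f ->
  forall x, D x -> a x = 0.
Proof.
  intros HD Ho He Hf Hab Hl Hr x Hx.
  assert (Hnn : forall t, D t -> 0 <= - e * b t).
  { intros t Ht. apply Rmult_le_pos; [lra | apply Hab, Ht]. }
  assert (Hz : forall t, D t -> f t = 0).
  { apply (monotone_small_ends D f _ HD Hf); auto.
    intros t Ht. specialize (Hnn t Ht). destruct (Hab t Ht). lra. }
  assert (H := derive_of_zero D f x _ Ho Hz Hx (Hf x Hx)).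
  specialize (Hnn x Hx). destruct (Hab x Hx). lra.
Qed.

(** If [h] had a nonzero limit at the left end, [v' = p h] would make [v] blow up
    like [x^(-beta)]. *)
Lemma singular_part_le (v h p h' H H' : R -> R) (d beta : R) :
  0 < beta ->
  (forall x, 0 < x < d -> is_derive v x (p x * h x)) ->
  (forall x, 0 < x < d -> is_derive h x (h' x)) ->
  (forall x, 0 < x < d -> is_derive H x (H' x)) ->
  (forall x, 0 < x < d -> Rabs (h' x) <= H' x) ->
  (forall x, 0 < x < d -> 0 <= H x) ->
  (forall x, 0 < x < d -> Rpower x (- 1 - beta) <= p x) ->
  small_left (fun x => 0 < x < d) (fun x => v x * Rpower x beta) ->
  forall x, 0 < x < d -> h x <= H x.
Proof.
  intros Hb Hv Hh HH Hle HHpos Hp Hs r Hr.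
  destruct (Rle_or_lt (h r) (H r)) as [|Hlt]; [assumption|exfalso].
  set (del := h r - H r). assert (Hdel : 0 < del) by (unfold del; lra).
  (* Going left from [r], [h] loses at most what [H] loses, and [H] stays nonnegative; so the excess
     [del] survives down to 0. *)
  assert (Hge : forall x, 0 < x <= r -> del <= h x).
  { intros x Hx.
    assert (h r - h x <= H r - H x).
    { apply (derive_le h H h' H'); [lra | | |]; intros y Hy.
      - apply Hh; lra.
      - apply HH; lra.
      - assert (Hy' := Hle y ltac:(lra)). apply Rabs_le_between in Hy'. lra. }
    specialize (HHpos x ltac:(lra)). unfold del. lra. }
  assert (Hvx : forall x, 0 < x <= r ->
    - (del / beta) * Rpower r (- beta) + del / beta * Rpower x (- beta) <= v r - v x).
  { intros x Hx.
    replace (- (del / beta) * Rpower r (- beta) + del / beta * Rpower x (- beta))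
      with (- (del / beta) * Rpower r (- beta) - (- (del / beta) * Rpower x (- beta))) by ring.
    apply (derive_le (fun t => - (del / beta) * Rpower t (- beta)) v
             (fun t => del * Rpower t (- 1 - beta)) (fun t => p t * h t)); [lra | | |]; intros y Hy.
    - eapply is_derive_eq.
      + apply is_derive_scal. apply is_derive_Rpower. lra.
      + replace (- beta - 1) with (-1 - beta) by ring. field. lra.
    - apply Hv; lra.
    - specialize (Hge y ltac:(lra)). specialize (Hp y ltac:(lra)).
      assert (0 < Rpower y (-1 - beta)) by apply Rpower_pos.
      rewrite Rmult_comm. apply Rmult_le_compat; lra. }
  (* Multiplied by [x^beta], the integrated bound reads [v x * x^beta <= A x^beta - del / beta].
     Near 0 the right side is below [- del / (2 beta)], against the smallness of the left side. *)
  set (A := v r + del / beta * Rpower r (- beta)).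
  assert (Hdb : 0 < del / beta) by (apply Rdiv_lt_0_compat; lra).
  destruct (Rpower_small A beta (del / beta / 2) Hb ltac:(lra)) as [d0 [Hd0 HxA]].
  destruct (common_bound r d0 ltac:(lra) Hd0) as [b [Hb0 [Hbr Hbd]]].
  destruct (Hs (del / beta / 2) ltac:(lra) b ltac:(lra)) as [x [Hx [Hxr Hsx]]].
  specialize (HxA x ltac:(lra)). specialize (Hvx x ltac:(lra)).
  assert (Hpx : 0 < Rpower x beta) by apply Rpower_pos.
  assert (Hinv : Rpower x (- beta) * Rpower x beta = 1).
  { rewrite <- Rpower_plus. replace (- beta + beta) with 0 by ring. apply Rpower_O. lra. }
  assert (Hv2 : v x <= A - del / beta * Rpower x (- beta)) by (unfold A; lra).
  assert (Hv3 : v x * Rpower x beta <= A * Rpower x beta - del / beta).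
  { apply (Rmult_le_compat_r (Rpower x beta)) in Hv2; [|lra].
    replace (del / beta) with (del / beta * (Rpower x (- beta) * Rpower x beta)).
    - lra.
    - rewrite Hinv. ring. }
  apply Rabs_lt_between in Hsx. lra.
Qed.

(** Both signs of [h] are treated alike. [H] may be any nonnegative majorant of the variation of
    [h], so a power of [x] in its place gives the rate at which [h] tends to 0 once the singular
    solution is excluded. *)
Lemma singular_part_vanishes (v h p h' H H' : R -> R) (d beta : R) :
  0 < beta ->
  (forall x, 0 < x < d -> is_derive v x (p x * h x)) ->
  (forall x, 0 < x < d -> is_derive h x (h' x)) ->
  (forall x, 0 < x < d -> is_derive H x (H' x)) ->
  (forall x, 0 < x < d -> Rabs (h' x) <= H' x) ->
  (forall x, 0 < x < d -> 0 <= H x) ->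
  (forall x, 0 < x < d -> Rpower x (- 1 - beta) <= p x) ->
  small_left (fun x => 0 < x < d) (fun x => v x * Rpower x beta) ->
  forall x, 0 < x < d -> Rabs (h x) <= H x.
Proof.
  intros Hb Hv Hh HH Hle HHpos Hp Hs x Hx.
  apply Rabs_le. split.
  - cut (- h x <= H x); [lra|].
    apply (singular_part_le (fun t => - v t) (fun t => - h t) p (fun t => - h' t) H H' d beta); auto.
    + intros y Hy. eapply is_derive_eq; [apply is_derive_Ropp, Hv, Hy|]. ring.
    + intros y Hy. apply is_derive_Ropp, Hh, Hy.
    + intros y Hy. rewrite Rabs_Ropp. auto.
    + intros eps He y Hy. destruct (Hs eps He y Hy) as [z Hz]. exists z.
      replace (- v z * Rpower z beta) with (- (v z * Rpower z beta)) by ring.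
      now rewrite Rabs_Ropp.
  - now apply (singular_part_le v h p h' H H' d beta).
Qed.

Lemma gronwall_right (N N' : R -> R) (K a b : R) :
  a <= b -> (forall x, a <= x <= b -> is_derive N x (N' x)) ->
  (forall x, a <= x <= b -> N' x <= K * N x) -> N a = 0 -> N b <= 0.
Proof.
  intros Hab HN HN' Ha.
  assert (H : N b * exp (- K * b) - N a * exp (- K * a) <= 0 - 0).
  { apply (derive_le (fun x => N x * exp (- K * x)) (fun _ => 0)
      (fun x => (N' x - K * N x) * exp (- K * x)) (fun _ => 0)); [assumption | | |]; intros x Hx.
    - eapply is_derive_eq.
      + apply (is_derive_mult N (fun x => exp (- K * x))); [apply HN, Hx | | intros; apply Rmult_comm].
        auto_derive; [exact I | reflexivity].
      + unfold plus, mult; simpl. ring.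
    - apply is_derive_Rconst.
    - assert (0 < exp (- K * x)) by apply exp_pos. specialize (HN' x Hx).
      assert (0 <= (K * N x - N' x) * exp (- K * x)) by (apply Rmult_le_pos; lra). lra. }
  rewrite Ha in H. assert (0 < exp (- K * b)) by apply exp_pos.
  destruct (Rle_or_lt (N b) 0); [assumption|].
  assert (0 < N b * exp (- K * b)) by (apply Rmult_lt_0_compat; assumption). lra.
Qed.

(** Bounding [N'] in absolute value makes the estimate work in both directions from [a]; the
    leftward case is the rightward one for [N (- x)]. *)
Lemma gronwall (N N' : R -> R) (K a b : R) :
  (forall x, Rmin a b <= x <= Rmax a b -> is_derive N x (N' x)) ->
  (forall x, Rmin a b <= x <= Rmax a b -> Rabs (N' x) <= K * N x) -> N a = 0 -> N b <= 0.
Proof.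
  intros HN HN' Ha. destruct (Rle_or_lt a b) as [Hab | Hab].
  - rewrite Rmin_left, Rmax_right in HN, HN' by lra.
    apply (gronwall_right N N' K a b); auto.
    intros x Hx. apply Rle_trans with (2 := HN' x Hx). apply Rle_abs.
  - rewrite Rmin_right, Rmax_left in HN, HN' by lra.
    rewrite <- (Ropp_involutive b).
    apply (gronwall_right (fun x => N (- x)) (fun x => - N' (- x)) K (- a) (- b)).
    + lra.
    + intros x Hx. eapply is_derive_eq.
      * apply (is_derive_comp N (fun x => - x)); [apply HN; lra | auto_derive; [exact I | reflexivity]].
      * unfold scal; simpl. unfold mult; simpl. ring.
    + intros x Hx. specialize (HN' (- x) ltac:(lra)). apply Rabs_le_between in HN'. lra.
    + now rewrite Ropp_involutive.
Qed.

(** * Solutions of the polar equation near a pole *)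

Lemma derive_abs_le (f g f' g' : R -> R) (a b : R) :
  a <= b ->
  (forall x, a <= x <= b -> is_derive f x (f' x)) ->
  (forall x, a <= x <= b -> is_derive g x (g' x)) ->
  (forall x, a <= x <= b -> Rabs (f' x) <= g' x) ->
  Rabs (f b - f a) <= g b - g a.
Proof.
  intros Hab Hf Hg Hle. apply Rabs_le. split.
  - cut ((- f b) - (- f a) <= g b - g a); [lra|].
    apply (derive_le (fun x => - f x) g (fun x => - f' x) g'); auto.
    + intros x Hx. apply is_derive_Ropp, Hf, Hx.
    + intros x Hx. specialize (Hle x Hx). apply Rabs_le_between in Hle. lra.
  - apply (derive_le f g f' g'); auto.
    intros x Hx. apply Rle_trans with (2 := Hle x Hx). apply Rle_abs.
Qed.

Lemma cos_ge_half (x : R) : 0 <= x <= 1 -> / 2 <= cos x.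
Proof.
  intros Hx. assert (HP := PI2_3_2).
  replace (/ 2) with (cos (PI / 3)) by (rewrite cos_PI3; lra). apply cos_decr_1; lra.
Qed.

Lemma sin_ge_half (x : R) : 0 < x < 1 -> x / 2 <= sin x.
Proof.
  intros Hx.
  assert (H : x / 2 - 0 / 2 <= sin x - sin 0).
  { apply (derive_le (fun x => x / 2) sin (fun _ => / 2) cos); [lra | | |]; intros y Hy.
    - auto_derive; [exact I | lra].
    - apply is_derive_Reals. apply derivable_pt_lim_sin.
    - apply cos_ge_half; lra. }
  rewrite sin_0 in H. lra.
Qed.

Lemma Rpower_le_exponent (x a b : R) : 0 < x <= 1 -> b <= a -> Rpower x a <= Rpower x b.
Proof.
  intros Hx Hab. unfold Rpower.
  assert (ln x <= 0) by (rewrite <- ln_1; apply ln_le; lra).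
  assert (H1 : a * ln x <= b * ln x) by nra.
  destruct H1 as [H1 | ->]; [left; now apply exp_increasing | right; reflexivity].
Qed.

Lemma Rpower_le_1 (x a : R) : 0 < x <= 1 -> 0 <= a -> Rpower x a <= 1.
Proof.
  intros Hx Ha. rewrite <- (Rpower_O x) by lra. now apply Rpower_le_exponent.
Qed.

Lemma Rpower_sub_1 (x a : R) : 0 < x -> Rpower x (a - 1) = Rpower x a / x.
Proof.
  intros Hx. unfold Rminus. rewrite Rpower_plus. unfold Rdiv. f_equal.
  rewrite Rpower_Ropp, Rpower_1; auto.
Qed.

Definition cot (x : R) : R := cos x / sin x.

Lemma cot_reflect (x : R) : cot (PI - x) = - cot x.
Proof.
  unfold cot. rewrite Rtrigo_facts.sin_pi_minus, Rtrigo_facts.cos_pi_minus.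
  unfold Rdiv. ring.
Qed.

Lemma is_derive_cot (x : R) : 0 < sin x -> is_derive cot x (- (1 + cot x ^ 2)).
Proof.
  intros Hs. unfold cot. auto_derive; [lra|].
  field. lra.
Qed.

Lemma is_derive_Rpower_sin (a x : R) :
  0 < sin x -> is_derive (fun t => Rpower (sin t) a) x (a * cot x * Rpower (sin x) a).
Proof.
  intros Hs. eapply is_derive_eq.
  - apply (is_derive_comp (fun t => Rpower t a) sin).
    + apply is_derive_Rpower, Hs.
    + apply is_derive_Reals, derivable_pt_lim_sin.
  - unfold scal; simpl; unfold mult; simpl. rewrite Rpower_sub_1 by assumption.
    unfold cot. field. lra.
Qed.

(** The polar equation as a first-order system: [w] is the raised function
    [y' - mu cot y], and [f = (lambda - mu (mu + 1)) y]. *)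
Definition polar_system (mu : R) (y w f : R -> R) : Prop :=
  forall x, 0 < x < PI ->
    is_derive y x (w x + mu * cot x * y x) /\
    is_derive w x (- f x - (mu + 1) * cot x * w x).

(** Carries every estimate at the pole 0 over to the pole [PI]. Both terms of [w = y' - mu cot y]
    change sign under the reflection, whence the minus. *)
Lemma polar_reflect (mu : R) (y w f : R -> R) :
  polar_system mu y w f ->
  polar_system mu (fun x => y (PI - x)) (fun x => - w (PI - x)) (fun x => f (PI - x)).
Proof.
  intros H x Hx. destruct (H (PI - x) ltac:(lra)) as [Hy Hw].
  rewrite cot_reflect in Hy, Hw.
  split.
  - eapply is_derive_eq; [apply is_derive_reflect; exact Hy | ring].
  - eapply is_derive_eq; [apply is_derive_Ropp, is_derive_reflect; exact Hw | ring].
Qed.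

(** Dividing by [sin^mu], a solution of [y' = mu cot y], leaves only the contribution of [w].
    Written as [sin^(-1-2 mu)] times [h = w sin^(mu+1)], it shows that a nonzero limit of [h] at the
    pole makes [y] grow like [sin^(-mu)]. *)
Lemma polar_regular_part (mu : R) (y w f : R -> R) (x : R) :
  polar_system mu y w f -> 0 < x < PI ->
  is_derive (fun t => y t * Rpower (sin t) (- mu)) x
    (Rpower (sin x) (- 1 - 2 * mu) * (w x * Rpower (sin x) (mu + 1))).
Proof.
  intros H Hx. destruct (H x Hx) as [Hy _]. assert (Hs := sin_gt_0 x ltac:(lra) ltac:(lra)).
  eapply is_derive_eq.
  - apply is_derive_Rmult; [apply Hy | apply is_derive_Rpower_sin, Hs].
  - cbv beta. replace (Rpower (sin x) (- mu)) with (Rpower (sin x) (-1 - 2 * mu) * Rpower (sin x) (mu + 1)).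
    + ring.
    + rewrite <- Rpower_plus. f_equal. ring.
Qed.

Lemma polar_singular_part (mu : R) (y w f : R -> R) (x : R) :
  polar_system mu y w f -> 0 < x < PI ->
  is_derive (fun t => w t * Rpower (sin t) (mu + 1)) x (- f x * Rpower (sin x) (mu + 1)).
Proof.
  intros H Hx. destruct (H x Hx) as [_ Hw]. assert (Hs := sin_gt_0 x ltac:(lra) ltac:(lra)).
  eapply is_derive_eq.
  - apply is_derive_Rmult; [apply Hw | apply is_derive_Rpower_sin, Hs].
  - cbv beta. ring.
Qed.

(** Here [beta = 2 mu]: since [v = y / sin^mu] is of order [y x^(-mu)], smallness of [v x^(2 mu)] is
    smallness of [y x^mu], that is, [y] falls short of the singular solution along a sequence. *)
Lemma polar_singular_part_le (mu d : R) (y w f H H' : R -> R) :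
  0 < mu -> 0 < d <= 1 -> polar_system mu y w f ->
  small_left (fun x => 0 < x < d) (fun x => y x * Rpower x mu) ->
  (forall x, 0 < x < d -> is_derive H x (H' x)) ->
  (forall x, 0 < x < d -> Rabs (f x) * Rpower (sin x) (mu + 1) <= H' x) ->
  (forall x, 0 < x < d -> 0 <= H x) ->
  forall x, 0 < x < d -> Rabs (w x * Rpower (sin x) (mu + 1)) <= H x.
Proof.
  intros Hmu Hd Hsys Hsm HH Hle HH0. assert (HP := PI2_3_2).
  apply (singular_part_vanishes (fun t => y t * Rpower (sin t) (- mu))
     (fun t => w t * Rpower (sin t) (mu + 1)) (fun t => Rpower (sin t) (- 1 - 2 * mu))
     (fun t => - f t * Rpower (sin t) (mu + 1)) H H' d (2 * mu)); auto.
  - lra.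
  - intros x Hx. apply (polar_regular_part mu y w f); auto; lra.
  - intros x Hx. apply (polar_singular_part mu y w f); auto; lra.
  - intros x Hx. rewrite Rabs_mult, Rabs_Ropp, (Rabs_pos_eq (Rpower _ _)); auto.
    apply Rpower_ge_0.
  - intros x Hx.
    assert (Hs := sin_gt_0 x ltac:(lra) ltac:(lra)).
    replace (-1 - 2 * mu) with (- (1 + 2 * mu)) by ring. rewrite !Rpower_Ropp.
    apply Rinv_le_contravar; [apply Rpower_pos|].
    apply Rpower_le_base; [lra | assumption | left; apply sin_lt_x; lra].
  - intros eps He x Hx.
    (* The factor [2^mu] pays for replacing [sin] by [x], through [x / 2 <= sin x]. *)
    destruct (Hsm (eps / Rpower 2 mu)) with (x := x) as [z [Hz [Hzx Hze]]]; auto.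
    { apply Rdiv_lt_0_compat; [assumption | apply Rpower_pos]. }
    exists z. split; [assumption|]. split; [assumption|].
    assert (Hs := sin_gt_0 z ltac:(lra) ltac:(lra)).
    assert (Hs2 := sin_ge_half z ltac:(lra)).
    assert (H1 : Rpower (sin z) (- mu) * Rpower z mu <= Rpower 2 mu).
    { rewrite Rpower_Ropp. apply Rmult_le_reg_l with (Rpower (sin z) mu); [apply Rpower_pos|].
      rewrite <- Rmult_assoc, Rinv_r, Rmult_1_l by (apply Rgt_not_eq, Rpower_pos).
      rewrite Rpower_mult_distr by lra. apply Rpower_le_base; lra. }
    replace (y z * Rpower (sin z) (- mu) * Rpower z (2 * mu))
      with (y z * Rpower z mu * (Rpower (sin z) (- mu) * Rpower z mu)).
    + rewrite Rabs_mult.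
      assert (H2 : 0 < Rpower (sin z) (- mu) * Rpower z mu) by (apply Rmult_lt_0_compat; apply Rpower_pos).
      rewrite (Rabs_pos_eq (Rpower (sin z) (- mu) * Rpower z mu)) by lra.
      apply Rle_lt_trans with (Rabs (y z * Rpower z mu) * Rpower 2 mu).
      * apply Rmult_le_compat_l; [apply Rabs_pos | assumption].
      * replace eps with (eps / Rpower 2 mu * Rpower 2 mu) by (field; apply Rgt_not_eq, Rpower_pos).
        apply Rmult_lt_compat_r; [apply Rpower_pos | assumption].
    + replace (2 * mu) with (mu + mu) by ring. rewrite Rpower_plus. ring.
Qed.

(** The cutoff 1 ensures that on the whole neighbourhood [x / 2 <= sin x], [1 / 2 <= cos x], and
    powers of [x] decrease with the exponent. *)
Definition bounded_at_0 (y : R -> R) : Prop :=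
  exists C d, 0 < d <= 1 /\ forall x, 0 < x < d -> Rabs (y x) <= C.

Definition linear_at_0 (y : R -> R) : Prop :=
  exists C d, 0 < d <= 1 /\ forall x, 0 < x < d -> Rabs (y x) <= C * x.

Lemma bounded_at_0_common (y z : R -> R) :
  bounded_at_0 y -> bounded_at_0 z ->
  exists C d, 0 < d <= 1 /\ 0 <= C /\
    forall x, 0 < x < d -> Rabs (y x) <= C /\ Rabs (z x) <= C.
Proof.
  intros [C1 [d1 [Hd1 H1]]] [C2 [d2 [Hd2 H2]]].
  destruct (common_bound d1 d2 ltac:(lra) ltac:(lra)) as [d [Hd [A1 A2]]].
  assert (B1 := Rmax_l C1 C2). assert (B2 := Rmax_r C1 C2).
  exists (Rmax C1 C2), d. split; [lra|]. split.
  - specialize (H1 (d / 2) ltac:(lra)). assert (H3 := Rabs_pos (y (d / 2))). lra.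
  - intros x Hx. specialize (H1 x ltac:(lra)). specialize (H2 x ltac:(lra)). lra.
Qed.

Lemma bounded_at_0_lin (y z : R -> R) (p q : R) :
  bounded_at_0 y -> bounded_at_0 z -> bounded_at_0 (fun x => p * y x + q * z x).
Proof.
  intros Hy Hz. destruct (bounded_at_0_common y z Hy Hz) as [C [d [Hd [HC H]]]].
  exists (Rabs p * C + Rabs q * C), d. split; [assumption|].
  intros x Hx. destruct (H x Hx). apply Rle_trans with (1 := Rabs_triang _ _). rewrite !Rabs_mult.
  apply Rplus_le_compat; apply Rmult_le_compat_l; auto using Rabs_pos.
Qed.

Lemma bounded_of_linear_at_0 (y : R -> R) : linear_at_0 y -> bounded_at_0 y.
Proof.
  intros [C [d [Hd H]]]. exists (Rabs C), d. split; [assumption|].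
  intros x Hx. apply Rle_trans with (1 := H x Hx).
  assert (H1 := Rle_abs C). assert (H2 := Rabs_pos C). nra.
Qed.

Lemma linear_at_0_mult (y w : R -> R) :
  bounded_at_0 y -> linear_at_0 w -> linear_at_0 (fun x => y x * w x).
Proof.
  intros [C [d [Hd H]]] [C' [d' [Hd' H']]].
  destruct (common_bound d d' ltac:(lra) ltac:(lra)) as [b [Hb [A1 A2]]].
  exists (C * C'), b. split; [lra|].
  intros x Hx. rewrite Rabs_mult, Rmult_assoc.
  apply Rmult_le_compat; auto using Rabs_pos; [apply H | apply H']; lra.
Qed.

Lemma linear_at_0_minus (y w : R -> R) :
  linear_at_0 y -> linear_at_0 w -> linear_at_0 (fun x => y x - w x).
Proof.
  intros [C [d [Hd H]]] [C' [d' [Hd' H']]].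
  destruct (common_bound d d' ltac:(lra) ltac:(lra)) as [b [Hb [A1 A2]]].
  exists (C + C'), b. split; [lra|].
  intros x Hx. specialize (H x ltac:(lra)). specialize (H' x ltac:(lra)).
  unfold Rminus. apply Rle_trans with (1 := Rabs_triang _ _). rewrite Rabs_Ropp. lra.
Qed.

Lemma linear_at_0_small (D : R -> Prop) (y : R -> R) :
  initial D -> linear_at_0 y -> small_left D y.
Proof.
  intros HD [C [d [Hd H]]]. apply (small_left_of_Rpower D y C 1 d); auto; try lra.
  intros x Hx Hxd. destruct (HD x Hx) as [Hx0 _]. rewrite Rpower_1 by assumption. apply H. lra.
Qed.

(** [h' = - f sin^(mu+1)] is of order [x^(mu+1)], so [h = w sin^(mu+1)], whose limit must be 0, is
    of order [x^(mu+2)]; dividing by the weight leaves one power. Linear decay makes products with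
    [w] vanish at the pole and keeps [w] bounded for the next step of the ladder. *)
Lemma polar_bounded_end (mu : R) (y w f : R -> R) :
  0 < mu -> polar_system mu y w f -> bounded_at_0 y -> bounded_at_0 f -> linear_at_0 w.
Proof.
  intros Hmu Hsys By Bf. assert (HP := PI2_3_2).
  destruct (bounded_at_0_common y f By Bf) as [C [d [Hd [HC Hyf]]]].
  exists (C * Rpower 2 (mu + 1)), d. split; [assumption|]. intros x Hx.
  assert (Hh : Rabs (w x * Rpower (sin x) (mu + 1)) <= C * Rpower x (mu + 2)).
  { apply (polar_singular_part_le mu d y w f (fun x => C * Rpower x (mu + 2))
       (fun x => C * ((mu + 2) * Rpower x (mu + 2 - 1)))); auto.
    - apply (small_left_of_Rpower _ _ C mu d); auto using initial_interval; [lra|].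
      intros z Hz _. rewrite Rabs_mult, Rabs_Rpower.
      apply Rmult_le_compat_r; [apply Rpower_ge_0 | now apply Hyf].
    - intros z Hz. apply is_derive_Rscal. apply is_derive_Rpower; lra.
    - intros z Hz. assert (Hs := sin_gt_0 z ltac:(lra) ltac:(lra)).
      replace (mu + 2 - 1) with (mu + 1) by ring.
      assert (H1 : Rpower (sin z) (mu + 1) <= Rpower z (mu + 1)).
      { apply Rpower_le_base; [lra | assumption | left; apply sin_lt_x; lra]. }
      assert (H0 := Rpower_pos (sin z) (mu + 1)). destruct (Hyf z Hz) as [_ Hf].
      apply Rle_trans with (C * Rpower z (mu + 1)).
      + apply Rmult_le_compat; try lra. apply Rabs_pos.
      + assert (0 <= C * Rpower z (mu + 1)) by (apply Rmult_le_pos; lra). nra.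
    - intros z Hz. apply Rmult_le_pos; [lra | apply Rpower_ge_0]. }
  assert (Hs := sin_gt_0 x ltac:(lra) ltac:(lra)). assert (Hs2 := sin_ge_half x ltac:(lra)).
  rewrite Rabs_mult, (Rabs_pos_eq (Rpower _ _)) in Hh by (apply Rpower_ge_0).
  apply Rmult_le_reg_r with (Rpower (sin x) (mu + 1)); [apply Rpower_pos|].
  apply Rle_trans with (1 := Hh).
  replace (mu + 2) with (mu + 1 + 1) by ring. rewrite Rpower_plus, (Rpower_1 x) by lra.
  assert (H1 : Rpower x (mu + 1) <= Rpower 2 (mu + 1) * Rpower (sin x) (mu + 1)).
  { rewrite Rpower_mult_distr by lra. apply Rpower_le_base; lra. }
  apply Rle_trans with (C * (Rpower 2 (mu + 1) * Rpower (sin x) (mu + 1)) * x); [|right; ring].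
  rewrite <- Rmult_assoc. apply Rmult_le_compat_r; [lra|]. apply Rmult_le_compat_l; lra.
Qed.

(** Passes from mean-square to pointwise control. A bounded [S] says that [sin Y] is integrable,
    where [Y] dominates [f^2]; in the application [Y] is the squared modulus of the complex
    solution. Cauchy-Schwarz on [h' = - f sin^(mu+1)] bounds [w], and a bounded [w] in turn bounds
    [y]. *)
Lemma polar_square_integrable_end (mu d C M : R) (y w f Y S : R -> R) :
  0 < mu -> 0 < d <= 1 -> polar_system mu y w f ->
  small_left (fun x => 0 < x < d) (fun x => y x * Rpower x mu) ->
  (forall x, 0 < x < d -> is_derive S x (sin x * Y x)) ->
  (forall x, 0 < x < d -> Rabs (S x) <= M) ->
  (forall x, 0 < x < d -> f x ^ 2 <= C * Y x) ->
  (forall x, 0 < x < d -> 0 <= Y x) ->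
  0 <= C ->
  bounded_at_0 y.
Proof.
  intros Hmu Hd Hsys Hsm HS HSM Hf HY HC. assert (HP := PI2_3_2).
  assert (HM : 0 <= M) by (apply Rle_trans with (2 := HSM (d / 2) ltac:(lra)); apply Rabs_pos).
  set (K1 := (1 + C) * (1 + 2 * M)).
  assert (HK1 : 0 <= K1) by (unfold K1; apply Rmult_le_pos; lra).
  (* The parameter [eta] is tuned to the point [r]: with [eta = r^(mu+1)] the two terms of
     [x^(2 mu + 2) / eta + eta (S x + M)] are both of order [r^(mu+1)] at [x = r]. Adding [M] keeps
     the majorant nonnegative. *)
  assert (Hh : forall r, 0 < r < d ->
      Rabs (w r * Rpower (sin r) (mu + 1)) <= K1 * Rpower r (mu + 1)).
  { intros r Hr. set (eta := Rpower r (mu + 1)). assert (Heta : 0 < eta) by apply Rpower_pos.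
    assert (H1 : Rabs (w r * Rpower (sin r) (mu + 1))
        <= (1 + C) * (/ eta * Rpower r (2 * mu + 2) + eta * (S r + M))).
    { apply (polar_singular_part_le mu d y w f
        (fun x => (1 + C) * (/ eta * Rpower x (2 * mu + 2) + eta * (S x + M)))
        (fun x => (1 + C) * (/ eta * ((2 * mu + 2) * Rpower x (2 * mu + 2 - 1)) + eta * (sin x * Y x))));
        auto; try lra.
      - intros x Hx. apply is_derive_scal.
        apply is_derive_Rplus.
        + apply is_derive_Rscal. apply is_derive_Rpower. lra.
        + apply is_derive_Rscal. eapply is_derive_eq.
          * apply is_derive_Rplus; [apply HS, Hx | apply is_derive_Rconst].
          * ring.
      - intros x Hx. assert (Hs := sin_gt_0 x ltac:(lra) ltac:(lra)).
        assert (Hsx : sin x <= x) by (left; apply sin_lt_x; lra).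
        (* The weight is split as [a b] with [b^2 = sin x], so that [b^2 f^2] is controlled by the
           integrable [sin x * Y x]. *)
        set (a := Rpower (sin x) (mu + / 2)). set (b := Rpower (sin x) (/ 2)).
        replace (Rpower (sin x) (mu + 1)) with (a * b)
          by (unfold a, b; rewrite <- Rpower_plus; f_equal; lra).
        assert (Ha : 0 < a) by apply Rpower_pos. assert (Hb : 0 < b) by apply Rpower_pos.
        assert (Hb2 : b * b = sin x).
        { unfold b. rewrite <- Rpower_plus. replace (/ 2 + / 2) with 1 by lra. now apply Rpower_1. }
        assert (Ha2 : a * a <= Rpower x (2 * mu + 2 - 1)).
        { unfold a. rewrite <- Rpower_plus. replace (mu + / 2 + (mu + / 2)) with (2 * mu + 2 - 1) by lra.
          apply Rpower_le_base; lra. }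
        assert (Hfx : Rabs (f x) * Rabs (f x) <= C * Y x).
        { rewrite <- Rabs_mult, Rabs_pos_eq by nra. specialize (Hf x Hx). lra. }
        assert (HA := Rabs_pos (f x)). specialize (HY x Hx).
        (* AM-GM: [2 (a |f| b) <= a^2 / eta + eta b^2 f^2] *)
        assert (Hag : 2 * (Rabs (f x) * (a * b)) <= / eta * (a * a) + eta * (sin x * (C * Y x))).
        { apply Rle_trans with (/ eta * (a * a) + eta * (b * b * (Rabs (f x) * Rabs (f x)))).
          - assert (Hq : 0 <= / eta * ((a - eta * b * Rabs (f x)) * (a - eta * b * Rabs (f x)))).
            { apply Rmult_le_pos; [left; now apply Rinv_0_lt_compat | apply Rle_0_sqr]. }
            replace (/ eta * ((a - eta * b * Rabs (f x)) * (a - eta * b * Rabs (f x))))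
              with (/ eta * (a * a) + eta * (b * b * (Rabs (f x) * Rabs (f x)))
                    - 2 * (Rabs (f x) * (a * b))) in Hq by (field; lra).
            lra.
          - rewrite Hb2. apply Rplus_le_compat_l. apply Rmult_le_compat_l; [lra|].
            apply Rmult_le_compat_l; lra. }
        assert (Hie : 0 < / eta) by now apply Rinv_0_lt_compat.
        assert (H2 : / eta * (a * a) <= / eta * Rpower x (2 * mu + 2 - 1)) by (apply Rmult_le_compat_l; lra).
        assert (Hp := Rpower_pos x (2 * mu + 2 - 1)).
        set (T := / eta * Rpower x (2 * mu + 2 - 1)) in *.
        assert (HT : 0 <= T) by (unfold T; apply Rmult_le_pos; lra).

        assert (HU : 0 <= eta * (sin x * Y x)) by (apply Rmult_le_pos; [lra | apply Rmult_le_pos; lra]).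
        replace (/ eta * ((2 * mu + 2) * Rpower x (2 * mu + 2 - 1))) with ((2 * mu + 2) * T) by (unfold T; ring).
        replace (eta * (sin x * (C * Y x))) with (C * (eta * (sin x * Y x))) in Hag by ring.
        set (U := eta * (sin x * Y x)) in *.
        assert (0 <= C * U) by (apply Rmult_le_pos; lra).
        assert (0 <= C * T) by (apply Rmult_le_pos; lra).
        assert (0 <= mu * T) by (apply Rmult_le_pos; lra).
        assert (0 <= C * (mu * T)) by (apply Rmult_le_pos; lra).
        nra.
      - intros x Hx. apply Rmult_le_pos; [lra|]. apply Rplus_le_le_0_compat.
        + apply Rmult_le_pos; [left; now apply Rinv_0_lt_compat | apply Rpower_ge_0].
        + apply Rmult_le_pos; [lra|]. specialize (HSM x Hx). apply Rabs_le_between in HSM. lra. }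
    apply Rle_trans with (1 := H1).
    assert (H2 : / eta * Rpower r (2 * mu + 2) = eta).
    { replace (2 * mu + 2) with ((mu + 1) + (mu + 1)) by ring. rewrite Rpower_plus. fold eta. field. lra. }
    rewrite H2. unfold K1. rewrite Rmult_assoc. apply Rmult_le_compat_l; [lra|].
    specialize (HSM r Hr). apply Rabs_le_between in HSM. nra. }
  set (K := K1 * Rpower 2 (mu + 1)).
  assert (Hw : forall x, 0 < x < d -> Rabs (w x) <= K).
  { intros x Hx. specialize (Hh x Hx). rewrite Rabs_mult, Rabs_Rpower in Hh.
    assert (Hs := sin_gt_0 x ltac:(lra) ltac:(lra)). assert (Hs2 := sin_ge_half x ltac:(lra)).
    apply Rmult_le_reg_r with (Rpower (sin x) (mu + 1)); [apply Rpower_pos|].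
    apply Rle_trans with (1 := Hh). unfold K. rewrite Rmult_assoc.
    apply Rmult_le_compat_l; [assumption|].
    rewrite Rpower_mult_distr by lra. apply Rpower_le_base; lra. }
  (* [(y^2)' = 2 y w + 2 mu cot y^2 >= - w^2 / mu], because [cot >= 1/2] on [(0, 1)] *)
  set (A := y (d / 2) * y (d / 2) + K ^ 2 / mu).
  (* A square that is at most [A] has a root of modulus at most [A + 1]; this avoids taking
     roots. *)
  exists (A + 1), (d / 2). split; [lra|]. intros x Hx.
  assert (Hy2 : - (K ^ 2 / mu) * (d / 2) - - (K ^ 2 / mu) * x <= y (d / 2) * y (d / 2) - y x * y x).
  { apply (derive_le (fun x => - (K ^ 2 / mu) * x) (fun x => y x * y x) (fun _ => - (K ^ 2 / mu))
      (fun x => 2 * (y x * (w x + mu * cot x * y x)))); [lra | | |]; intros z Hz.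
    - auto_derive; [exact I | field; lra].
    - destruct (Hsys z ltac:(lra)) as [H1 _].
      eapply is_derive_eq; [apply is_derive_Rmult; exact H1 | cbv beta; ring].
    - assert (Hs := sin_gt_0 z ltac:(lra) ltac:(lra)). assert (Hs1 := SIN_bound z).
      assert (Hcos := cos_ge_half z ltac:(lra)).
      assert (Hcot : / 2 <= cot z).
      { unfold cot. apply Rmult_le_reg_r with (sin z); [assumption|].
        replace (cos z / sin z * sin z) with (cos z) by (field; lra). lra. }
      assert (Hwz : w z ^ 2 <= K ^ 2).
      { rewrite <- pow2_abs. apply pow_incr. split; [apply Rabs_pos | apply Hw; lra]. }
      assert (Hq : 0 <= / mu * ((w z + mu * y z) * (w z + mu * y z))).
      { apply Rmult_le_pos; [left; now apply Rinv_0_lt_compat | apply Rle_0_sqr]. }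
      replace (/ mu * ((w z + mu * y z) * (w z + mu * y z)))
        with (w z ^ 2 / mu + 2 * (y z * w z) + mu * (y z * y z)) in Hq by (field; lra).
      assert (w z ^ 2 / mu <= K ^ 2 / mu).
      { apply Rmult_le_compat_r; [left; now apply Rinv_0_lt_compat | assumption]. }
      assert (0 <= mu * (y z * y z)) by (apply Rmult_le_pos; [lra | apply Rle_0_sqr]).
      assert (/ 2 * (mu * (y z * y z)) <= cot z * (mu * (y z * y z))) by (apply Rmult_le_compat_r; lra).
      lra. }
  assert (HK : 0 <= K ^ 2 / mu).
  { apply Rmult_le_pos; [apply pow2_ge_0 | left; now apply Rinv_0_lt_compat]. }
  assert (Hyx : Rabs (y x) * Rabs (y x) <= A).
  { rewrite <- Rabs_mult, Rabs_pos_eq by apply Rle_0_sqr. unfold A. nra. }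
  assert (H0 := Rabs_pos (y x)). nra.
Qed.

(** * The polar ladder *)

Definition on_sphere (x : R) : Prop := 0 < x < PI.

Lemma interval_sphere : interval on_sphere.
Proof. intros x y z; unfold on_sphere; lra. Qed.

Lemma open_sphere : open on_sphere.
Proof. apply (open_and (fun x => 0 < x) (fun x => x < PI)); [apply open_gt | apply open_lt]. Qed.

Lemma initial_sphere : initial on_sphere.
Proof. apply initial_interval. Qed.

(** The pole [PI] is treated as the pole 0 of the reflected function, so that each estimate is
    needed at one end only. *)
Definition both_ends (P : (R -> R) -> Prop) (y : R -> R) : Prop :=
  P y /\ P (fun x => y (PI - x)).

Lemma bounded_ends_lin (y z : R -> R) (p q : R) :
  both_ends bounded_at_0 y -> both_ends bounded_at_0 z ->
  both_ends bounded_at_0 (fun x => p * y x + q * z x).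
Proof. intros [H1 H2] [H3 H4]. split; now apply bounded_at_0_lin. Qed.

Lemma bounded_of_linear_ends (y : R -> R) : both_ends linear_at_0 y -> both_ends bounded_at_0 y.
Proof. intros [H1 H2]. split; now apply bounded_of_linear_at_0. Qed.

Lemma linear_ends_minus (y z : R -> R) :
  both_ends linear_at_0 y -> both_ends linear_at_0 z -> both_ends linear_at_0 (fun x => y x - z x).
Proof. intros [H1 H2] [H3 H4]. split; now apply linear_at_0_minus. Qed.

Lemma linear_ends_mult (y z : R -> R) :
  both_ends bounded_at_0 y -> both_ends linear_at_0 z ->
  both_ends linear_at_0 (fun x => sin x * y x * z x).
Proof.
  assert (G : forall s u, (forall x, Rabs (s x) <= 1) -> bounded_at_0 u -> bounded_at_0 (fun x => s x * u x)).
  { intros s u Hs [C [d [Hd H]]]. exists C, d. split; [assumption|]. intros x Hx.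
    rewrite Rabs_mult, <- (Rmult_1_l C). apply Rmult_le_compat; auto using Rabs_pos. }
  assert (Hsin : forall x, Rabs (sin x) <= 1) by (intros x; apply Rabs_le, SIN_bound).
  intros [H1 H2] [H3 H4]. split; apply linear_at_0_mult; auto; apply G; auto.
Qed.

Lemma linear_ends_small (y : R -> R) :
  both_ends linear_at_0 y -> small_left on_sphere y /\ small_right on_sphere y.
Proof.
  intros [H1 H2]. split; [now apply linear_at_0_small, H1; apply initial_sphere|].
  intros eps He x Hx.
  destruct (linear_at_0_small on_sphere _ initial_sphere H2 eps He (PI - x)) as [z [Hz [Hzx Hs]]];
    unfold on_sphere in *; [lra|].
  exists (PI - z). repeat split; auto; lra.
Qed.

Lemma polar_linear_ends (mu : R) (y w f : R -> R) :
  0 < mu -> polar_system mu y w f -> both_ends bounded_at_0 y -> both_ends bounded_at_0 f ->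
  both_ends linear_at_0 w.
Proof.
  intros Hmu Hsys [Hy1 Hy2] [Hf1 Hf2]. split; [now apply (polar_bounded_end mu y w f)|].
  destruct (polar_bounded_end mu _ _ _ Hmu (polar_reflect mu y w f Hsys) Hy2 Hf2) as [C [d [Hd H]]].
  exists C, d. split; [assumption|]. intros x Hx. rewrite <- Rabs_Ropp. now apply H.
Qed.

Lemma polar_system_ext (mu : R) (y w f g : R -> R) :
  (forall x, f x = g x) -> polar_system mu y w f -> polar_system mu y w g.
Proof. intros He H x Hx. rewrite <- He. apply H, Hx. Qed.

Lemma cos_cot (x : R) : on_sphere x -> cos x = cot x * sin x.
Proof.
  intros [H0 H1]. assert (H := sin_gt_0 x H0 H1). unfold cot. field. lra.
Qed.

Lemma is_derive_sin (x : R) : is_derive sin x (cos x).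
Proof. apply is_derive_Reals, derivable_pt_lim_sin. Qed.

(** The Wronskian of real and imaginary part is monotone and vanishes at both
    poles unless the separation constant is real. *)
Lemma polar_real (mu e q : R) (a wa b wb : R -> R) :
  0 < mu ->
  polar_system mu a wa (fun x => e * a x + - q * b x) ->
  polar_system mu b wb (fun x => e * b x + q * a x) ->
  both_ends bounded_at_0 a -> both_ends bounded_at_0 b ->
  (exists x, on_sphere x /\ (a x <> 0 \/ b x <> 0)) -> q = 0.
Proof.
  intros Hmu Ha Hb Ba Bb [x0 [Hx0 Hne]].
  assert (La := polar_linear_ends mu a wa _ Hmu Ha Ba (bounded_ends_lin a b e (- q) Ba Bb)).
  assert (Lb := polar_linear_ends mu b wb _ Hmu Hb Bb (bounded_ends_lin b a e q Bb Ba)).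
  (* This is the Wronskian [sin x (a b' - b a')]: in passing from derivatives to raised functions
     the terms [mu cot a b] cancel. *)
  set (W := fun x => sin x * a x * wb x - sin x * b x * wa x).
  destruct (linear_ends_small W) as [Wl Wr].
  { apply linear_ends_minus; now apply linear_ends_mult. }
  destruct (constant_sign_small_ends on_sphere W (fun x => sin x * (a x * a x + b x * b x)) q
    interval_sphere open_sphere) with (x := x0) as [|H]; auto.
  - intros x Hx. destruct (Ha x Hx) as [H1 H2], (Hb x Hx) as [H3 H4]. unfold W.
    eapply is_derive_eq.
    + apply is_derive_Rminus.
      * apply (is_derive_Rmult (fun x => sin x * a x) wb); [|exact H4].
        apply (is_derive_Rmult sin a); [apply is_derive_sin | exact H1].
      * apply (is_derive_Rmult (fun x => sin x * b x) wa); [|exact H2].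
        apply (is_derive_Rmult sin b); [apply is_derive_sin | exact H3].
    + cbv beta. rewrite (cos_cot x Hx). ring.
  - intros x [Hx1 Hx2]. assert (Hs := sin_gt_0 x Hx1 Hx2). apply Rmult_le_pos; [lra | nra].
  - assert (Hs := sin_gt_0 x0 (proj1 Hx0) (proj2 Hx0)).
    apply Rmult_integral in H. exfalso. destruct H; [lra|]. destruct Hne; nra.
Qed.

(** The new second function is dictated by solving [w' = w2 + (mu + 1) cot w] for [w2]. The identity
    [cot' = - (1 + cot^2)] then shifts the factorisation constant to [lam - (mu + 1) (mu + 2)]. *)
Lemma polar_raise (mu lam : R) (y w : R -> R) :
  polar_system mu y w (fun x => (lam - mu * (mu + 1)) * y x) ->
  polar_system (mu + 1) w
    (fun x => - ((lam - mu * (mu + 1)) * y x) - (2 * mu + 2) * (cot x * w x))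
    (fun x => (lam - (mu + 1) * (mu + 1 + 1)) * w x).
Proof.
  intros H x Hx. destruct (H x Hx) as [Hy Hw]. split.
  - eapply is_derive_eq; [exact Hw|]. ring.
  - eapply is_derive_eq.
    + apply is_derive_Rminus.
      * apply is_derive_Ropp.
        apply is_derive_Rscal, Hy.
      * apply is_derive_Rscal. apply (is_derive_Rmult cot w); [|exact Hw].
        apply is_derive_cot. apply sin_gt_0; apply Hx.
    + cbv beta. ring.
Qed.

(** For [e <= 0] the derivative [sin (w^2 - e y^2)] of [sin y w] is nonnegative while the product
    vanishes at both poles, so [w = 0], and the second equation is left with [e y = 0]. The ladder
    thus continues only with [e > 0] and a nonzero [w], again regular. *)
Lemma polar_step (mu e : R) (y w : R -> R) :
  0 < mu ->
  polar_system mu y w (fun x => e * y x) ->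
  both_ends bounded_at_0 y ->
  (exists x, on_sphere x /\ y x <> 0) ->
  both_ends linear_at_0 w /\ (e = 0 \/ (0 < e /\ exists x, on_sphere x /\ w x <> 0)).
Proof.
  intros Hmu Hsys Hy [x0 [Hx0 Hne]].
  assert (Lw : both_ends linear_at_0 w).
  { apply (polar_linear_ends mu y w (fun x => e * y x + 0 * y x)); auto using bounded_ends_lin.
    eapply polar_system_ext; [|exact Hsys]. intros x. cbv beta. ring. }
  split; [exact Lw|].
  assert (Hzero : (forall x, on_sphere x -> w x = 0) -> e = 0).
  { intros Hw0. destruct (Hsys x0 Hx0) as [_ Hdw].
    apply (derive_of_zero on_sphere w x0 _ open_sphere Hw0 Hx0) in Hdw.
    rewrite (Hw0 x0 Hx0) in Hdw.
    assert (Hm : e * y x0 = 0) by lra. apply Rmult_integral in Hm. tauto. }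
  destruct (classic (exists x, on_sphere x /\ w x <> 0)) as [Hex | Hnex].
  2: { left. apply Hzero. intros x Hx. apply NNPP. intros Hn. apply Hnex. now exists x. }
  destruct (Rlt_or_le 0 e) as [He | He]; [right; auto | left].
  apply Hzero. intros x Hx.
  destruct (linear_ends_small _ (linear_ends_mult y w Hy Lw)) as [Gl Gr].
  assert (H : sin x * (w x * w x) = 0).
  { apply (factorisation_step on_sphere (fun x => sin x * y x * w x) (fun x => sin x * (w x * w x))
      (fun x => sin x * (y x * y x)) e interval_sphere open_sphere He); auto.
    - intros z Hz. destruct (Hsys z Hz) as [H1 H2]. eapply is_derive_eq.
      + apply (is_derive_Rmult (fun x => sin x * y x) w); [|exact H2].
        apply (is_derive_Rmult sin y); [apply is_derive_sin | exact H1].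
      + cbv beta. rewrite (cos_cot z Hz). ring.
    - intros z [Hz1 Hz2]. assert (Hs := sin_gt_0 z Hz1 Hz2).
      split; apply Rmult_le_pos; try lra; apply Rle_0_sqr. }
  assert (Hs := sin_gt_0 x (proj1 Hx) (proj2 Hx)).
  apply Rmult_integral in H. destruct H as [H | H]; [lra | nra].
Qed.

(** [n] bounds the number of steps: each raise adds one to [mu] and consumes one unit, and at
    [n = 0] the bound on [lam] makes the factorisation constant nonpositive, so the ladder stops
    there at the latest. The number of raises performed is [k]. *)
Lemma polar_ladder (lam : R) (n : nat) : forall (mu : R) (y w : R -> R),
  0 < mu ->
  polar_system mu y w (fun x => (lam - mu * (mu + 1)) * y x) ->
  both_ends bounded_at_0 y ->
  (exists x, on_sphere x /\ y x <> 0) ->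
  lam <= (mu + INR n) * (mu + INR n + 1) ->
  exists k : nat, lam = (mu + INR k) * (mu + INR k + 1).
Proof.
  induction n as [|n IH]; intros mu y w Hmu Hsys Hy Hne Hlam;
    destruct (polar_step mu _ y w Hmu Hsys Hy Hne) as [Lw [He | [He Hw]]];
    try (exists 0%nat; simpl; rewrite Rplus_0_r; lra).
  - exfalso. simpl in Hlam. rewrite Rplus_0_r in Hlam. lra.
  - destruct (IH (mu + 1) w _ ltac:(lra) (polar_raise mu lam y w Hsys)
      (bounded_of_linear_ends w Lw) Hw) as [k Hk].
    + rewrite S_INR in Hlam. replace (mu + 1 + INR n) with (mu + (INR n + 1)) by ring. assumption.
    + exists (S k). rewrite S_INR. replace (mu + (INR k + 1)) with (mu + 1 + INR k) by ring. assumption.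
Qed.

(** * The radial system *)

Definition positive (x : R) : Prop := 0 < x.

Lemma interval_positive : interval positive.
Proof. intros x y z; unfold positive; lra. Qed.

Lemma open_positive : open positive.
Proof. apply open_gt. Qed.

Lemma initial_positive : initial positive.
Proof. intros x Hx. unfold positive in *. split; [assumption | intros; lra]. Qed.

Lemma zero_between (f : R -> R) (x y : R) :
  x < y -> (forall t, x <= t <= y -> continuous f t) -> f x * f y < 0 ->
  exists t, x <= t <= y /\ f t = 0.
Proof.
  intros Hxy Hc Hs.
  assert (Hc' : forall t, x <= t <= y -> continuity_pt f t).
  { intros t Ht. apply continuity_pt_filterlim, Hc, Ht. }
  destruct (Rlt_or_le (f x) 0) as [H | H].
  - destruct (IVT_interv f x y Hc' Hxy H) as [t [Ht Hft]]; [nra | eauto].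
  - assert (Hfx : 0 < f x) by (destruct H as [H | H]; [assumption | rewrite <- H in Hs; lra]).
    assert (Hfy : f y < 0) by nra.
    destruct (IVT_interv (fun t => - f t) x y) as [t [Ht Hft]]; [ | lra | lra | lra | ].
    + intros t Ht. apply continuity_pt_opp, Hc', Ht.
    + exists t. split; [assumption | lra].
Qed.

Lemma constant_sign (D : R -> Prop) (f : R -> R) :
  interval D -> (forall x, D x -> continuous f x) -> (forall x, D x -> f x <> 0) ->
  (forall x, D x -> 0 < f x) \/ (forall x, D x -> f x < 0).
Proof.
  intros HD Hc Hne.
  assert (Hsame : forall x y, D x -> D y -> x < y -> ~ f x * f y < 0).
  { intros x y Hx Hy Hxy Hs.
    destruct (zero_between f x y Hxy) as [t [Ht Hft]]; auto.
    - intros t Ht. apply Hc. now apply (HD x t y).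
    - apply (Hne t); [now apply (HD x t y) | assumption]. }
  destruct (classic (exists x, D x /\ f x < 0)) as [[x [Hx Hfx]] | H1].
  - right. intros y Hy. destruct (Rtotal_order (f y) 0) as [|[H|H]]; [assumption | exfalso | exfalso].
    { now apply (Hne y). }
    destruct (Rtotal_order x y) as [Hxy | [-> | Hxy]]; [|lra|].
    + apply (Hsame x y); auto. nra.
    + apply (Hsame y x); auto. nra.
  - left. intros y Hy. destruct (Rtotal_order (f y) 0) as [H|[H|H]]; [exfalso | exfalso | assumption].
    + apply H1. now exists y.
    + now apply (Hne y).
Qed.

(** The logarithmic derivative of the nodeless state [x^(l+1) exp (- c x / (l+1))]; the name is that
    of supersymmetric quantum mechanics. *)
Definition superpotential (l c x : R) : R := (l + 1) / x - c / (l + 1).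

(** The equation [y'' = (l (l + 1) / x^2 - 2 c / x + kappa) y] as a first-order
    system, where [w = y' - superpotential * y] is the raised function. *)
Definition radial_system (l c kappa : R) (y w : R -> R) : Prop :=
  forall x, 0 < x ->
    is_derive y x (w x + superpotential l c x * y x) /\
    is_derive w x (- ((c / (l + 1)) ^ 2 - kappa) * y x - superpotential l c x * w x).

(** A bounded antiderivative of [y^2] is what the monotonicity arguments consume, and for the raised
    function such an antiderivative has an explicit formula. *)
Definition square_integrable_tail (y : R -> R) : Prop :=
  exists (U : R -> R) (a M : R), 0 < a /\
    forall x, a <= x -> is_derive U x (y x ^ 2) /\ Rabs (U x) <= M.

(** The solution of [y' = superpotential * y]: the state with [w = 0] at which the ladder stops, and
    the integrating factor of the system. *)
Definition regular_weight (l c x : R) : R := Rpower x (l + 1) * exp (- (c / (l + 1)) * x).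

Lemma regular_weight_pos (l c x : R) : 0 < regular_weight l c x.
Proof. apply Rmult_lt_0_compat; [apply Rpower_pos | apply exp_pos]. Qed.

Lemma is_derive_regular_weight (l c x : R) :
  0 < x ->
  is_derive (regular_weight l c) x (superpotential l c x * regular_weight l c x).
Proof.
  intros Hx. unfold regular_weight. eapply is_derive_eq.
  - apply (is_derive_Rmult (fun x => Rpower x (l + 1)) (fun x => exp (- (c / (l + 1)) * x))).
    + now apply is_derive_Rpower.
    + auto_derive; [exact I | reflexivity].
  - unfold superpotential. rewrite Rpower_sub_1 by assumption. unfold Rdiv. ring.
Qed.

Lemma regular_weight_le_Rpower (l c x : R) :
  0 < l -> 0 < c -> 0 < x -> regular_weight l c x <= Rpower x (l + 1).
Proof.
  intros Hl Hc Hx. unfold regular_weight. rewrite <- (Rmult_1_r (Rpower x (l + 1))) at 2.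
  apply Rmult_le_compat_l; [apply Rpower_ge_0|].
  assert (Hcl : 0 < c / (l + 1)) by (apply Rdiv_lt_0_compat; lra).
  apply Rle_trans with (exp 0); [left; apply exp_increasing | rewrite exp_0; lra].
  assert (0 < c / (l + 1) * x) by (apply Rmult_lt_0_compat; lra). lra.
Qed.

Lemma radial_regular_part (l c kappa : R) (y w : R -> R) (x : R) :
  radial_system l c kappa y w -> 0 < x ->
  is_derive (fun x => y x / regular_weight l c x) x
    (/ regular_weight l c x ^ 2 * (w x * regular_weight l c x)).
Proof.
  intros H Hx. destruct (H x Hx) as [Hy _]. assert (Hm := regular_weight_pos l c x).
  eapply is_derive_eq.
  - apply (is_derive_div y (regular_weight l c));
      [exact Hy | now apply is_derive_regular_weight | lra].
  - simpl. field. lra.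
Qed.

Lemma radial_singular_part (l c kappa : R) (y w : R -> R) (x : R) :
  radial_system l c kappa y w -> 0 < x ->
  is_derive (fun x => w x * regular_weight l c x) x
    (- ((c / (l + 1)) ^ 2 - kappa) * y x * regular_weight l c x).
Proof.
  intros H Hx. destruct (H x Hx) as [_ Hw].
  eapply is_derive_eq.
  - apply is_derive_Rmult; [exact Hw | now apply is_derive_regular_weight].
  - ring.
Qed.

(** As at a pole, but the exponents at the origin are [l + 1] and [- l], whence [beta = 2 l + 1]. A
    [y] of order [x] is far below the singular [x^(-l)], and [h' = O(x^(l+2))] then gives
    [h = O(x^(l+3))], which is more than enough after division by the weight. *)
Lemma radial_linear_at_0 (l c kappa : R) (y w : R -> R) :
  0 < l -> 0 < c -> radial_system l c kappa y w -> linear_at_0 y -> linear_at_0 w.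
Proof.
  intros Hl Hc Hsys [C [d [Hd Hy]]].
  set (e := (c / (l + 1)) ^ 2 - kappa).
  assert (Hcl : 0 < c / (l + 1)) by (apply Rdiv_lt_0_compat; lra).
  assert (HC : 0 <= C).
  { specialize (Hy (d / 2) ltac:(lra)). assert (H := Rabs_pos (y (d / 2))). nra. }
  assert (Hwt := fun x => regular_weight_le_Rpower l c x Hl Hc).
  (* On [(0, 1)] the exponential factor of the weight is at least [1 / E], so the weight is
     comparable to [x^(l+1)] there. *)
  set (E := exp (c / (l + 1))).
  assert (Hwt' : forall x, 0 < x < d -> Rpower x (l + 1) <= E * regular_weight l c x).
  { intros x Hx. unfold regular_weight, E.
    replace (exp (c / (l + 1)) * (Rpower x (l + 1) * exp (- (c / (l + 1)) * x)))
      with (Rpower x (l + 1) * exp (c / (l + 1) + - (c / (l + 1)) * x)) by (rewrite exp_plus; ring).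
    rewrite <- (Rmult_1_r (Rpower x (l + 1))) at 1.
    apply Rmult_le_compat_l; [apply Rpower_ge_0|].
    apply Rle_trans with (exp 0); [rewrite exp_0; lra | left; apply exp_increasing]. assert (c / (l + 1) * x < c / (l + 1) * 1) by (apply Rmult_lt_compat_l; lra). lra. }
  assert (HE : 0 < E) by apply exp_pos.
  set (K := Rabs e * C). assert (HK : 0 <= K) by (apply Rmult_le_pos; [apply Rabs_pos | assumption]).
  assert (Hh : forall x, 0 < x < d -> Rabs (w x * regular_weight l c x) <= K * Rpower x (l + 3)).
  { apply (singular_part_vanishes (fun x => y x / regular_weight l c x)
     (fun x => w x * regular_weight l c x) (fun x => / regular_weight l c x ^ 2)
     (fun x => - e * y x * regular_weight l c x)
     (fun x => K * Rpower x (l + 3)) (fun x => K * ((l + 3) * Rpower x (l + 3 - 1))) d (2 * l + 1)).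
    - lra.
    - intros x Hx. apply (radial_regular_part l c kappa); auto; lra.
    - intros x Hx. apply (radial_singular_part l c kappa); auto; lra.
    - intros x Hx. apply is_derive_Rscal, is_derive_Rpower; lra.
    - intros x Hx. specialize (Hy x Hx). assert (Hm := regular_weight_pos l c x).
      specialize (Hwt x ltac:(lra)). assert (Hp := Rpower_pos x (l + 1)).
      rewrite !Rabs_mult, Rabs_Ropp, (Rabs_pos_eq (regular_weight l c x)) by lra.
      replace (l + 3 - 1) with (l + 1 + 1) by ring. rewrite Rpower_plus, Rpower_1 by lra.
      assert (He := Rabs_pos e).
      apply Rle_trans with (Rabs e * (C * x) * Rpower x (l + 1)).
      + apply Rmult_le_compat; try lra.
        * apply Rmult_le_pos; [assumption | apply Rabs_pos].
        * apply Rmult_le_compat_l; assumption.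
      + unfold K. assert (0 <= Rabs e * C * (x * Rpower x (l + 1))).
        { apply Rmult_le_pos; [exact HK|]. apply Rmult_le_pos; lra. }
        nra.
    - intros x Hx. apply Rmult_le_pos; [assumption | apply Rpower_ge_0].
    - intros x Hx. specialize (Hwt x ltac:(lra)). assert (Hm := regular_weight_pos l c x).
      replace (-1 - (2 * l + 1)) with (- ((l + 1) + (l + 1))) by ring.
      rewrite Rpower_Ropp, Rpower_plus. apply Rinv_le_contravar; [nra|].
      simpl. rewrite Rmult_1_r. apply Rmult_le_compat; lra.
    - apply (small_left_of_Rpower _ _ (C * E) (l + 1) d); auto using initial_interval; try lra.
      intros z Hz _. specialize (Hy z Hz). specialize (Hwt' z Hz).
      assert (Hm := regular_weight_pos l c z).
      assert (Hp := Rpower_pos z (2 * l + 1)). assert (Hp' := Rpower_pos z (l + 1)).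
      unfold Rdiv. rewrite !Rabs_mult, Rabs_Rpower, Rabs_inv, (Rabs_pos_eq (regular_weight l c z)) by lra.
      apply Rle_trans with (C * z * (E / Rpower z (l + 1)) * Rpower z (2 * l + 1)).
      + apply Rmult_le_compat_r; [lra|]. apply Rmult_le_compat; auto using Rabs_pos.
        * left; now apply Rinv_0_lt_compat.
        * apply Rmult_le_reg_l with (regular_weight l c z); [assumption|]. rewrite Rinv_r by lra.
          apply Rmult_le_reg_r with (Rpower z (l + 1)); [assumption|].
          replace (regular_weight l c z * (E / Rpower z (l + 1)) * Rpower z (l + 1))
            with (E * regular_weight l c z) by (field; lra).
          lra.
      + right. replace (2 * l + 1) with ((l + 1) + (l + 1) + - (1)) by ring.
        rewrite (Rpower_plus _ (- (1))), (Rpower_plus (l + 1) (l + 1)), (Rpower_Ropp z 1), Rpower_1 by lra.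
        field. lra. }
  exists (K * E), d. split; [assumption|]. intros x Hx.
  specialize (Hh x Hx). specialize (Hwt' x Hx). assert (Hm := regular_weight_pos l c x).
  rewrite Rabs_mult, (Rabs_pos_eq (regular_weight l c x)) in Hh by lra.
  apply Rmult_le_reg_r with (regular_weight l c x); [assumption|].
  apply Rle_trans with (1 := Hh).
  replace (l + 3) with ((l + 1) + 1 + 1) by ring.
  rewrite (Rpower_plus _ 1), (Rpower_plus (l + 1) 1), Rpower_1 by lra.
  assert (Hp := Rpower_pos x (l + 1)).
  apply Rle_trans with (K * ((E * regular_weight l c x) * x * 1)).
  - apply Rmult_le_compat_l; [assumption|]. apply Rmult_le_compat; try nra.
  - right. ring.
Qed.

Lemma superpotential_bounded (l c a x : R) :
  0 < l -> 0 < c -> 0 < a <= x -> Rabs (superpotential l c x) <= (l + 1) / a + c / (l + 1).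
Proof.
  intros Hl Hc Hx. unfold superpotential, Rminus. apply Rle_trans with (1 := Rabs_triang _ _).
  rewrite Rabs_Ropp. rewrite !Rabs_pos_eq.
  - apply Rplus_le_compat_r. apply Rmult_le_compat_l; [lra|]. apply Rinv_le_contravar; lra.
  - left; apply Rdiv_lt_0_compat; lra.
  - left; apply Rdiv_lt_0_compat; lra.
Qed.

Lemma antiderivative_not_bounded (U u : R -> R) (a M b eps : R) :
  0 < eps -> (forall x, a <= x -> is_derive U x (u x) /\ Rabs (U x) <= M) ->
  a <= b -> (forall x, b <= x -> eps <= u x) -> False.
Proof.
  intros He HU Hab Hu.
  assert (HM : 0 <= M) by (apply Rle_trans with (2 := proj2 (HU a ltac:(lra))); apply Rabs_pos).
  set (x := b + (2 * M + 1) / eps).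
  assert (Hq : 0 < (2 * M + 1) / eps) by (apply Rdiv_lt_0_compat; lra).
  assert (H : eps * x - eps * b <= U x - U b).
  { apply (derive_le (fun x => eps * x) U (fun _ => eps) u); [unfold x; lra | | |]; intros z Hz.
    - auto_derive; [exact I | ring].
    - apply HU; lra.
    - apply Hu; lra. }
  replace (eps * x - eps * b) with (2 * M + 1) in H by (unfold x; field; lra).
  destruct (HU x ltac:(unfold x; lra)) as [_ H1]. destruct (HU b Hab) as [_ H2].
  apply Rabs_le_between in H1. apply Rabs_le_between in H2. lra.
Qed.

(** In [(y^2)' = 2 y w + 2 superpotential y^2] the last term is at most [2 G y^2] in modulus, the
    derivative of the bounded [2 G U]. With [s y w >= eps], [s y^2] would therefore grow at least
    linearly: for [s = 1] against square-integrability, for [s = - 1] against the sign of [y^2]. *)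
Lemma radial_tail_product (l c kappa eps b s : R) (y w : R -> R) :
  0 < l -> 0 < c -> 0 < eps -> s * s = 1 ->
  radial_system l c kappa y w -> square_integrable_tail y ->
  (forall x, b <= x -> eps <= s * (y x * w x)) -> False.
Proof.
  intros Hl Hc He Hs Hsys [U [a [M [Ha HU]]]] Hge.
  set (a' := Rmax a b). assert (H1 : a <= a') by apply Rmax_l. assert (H2 : b <= a') by apply Rmax_r.
  set (G := (l + 1) / a + c / (l + 1)).
  assert (HG : 0 < G) by (apply Rplus_lt_0_compat; apply Rdiv_lt_0_compat; lra).
  assert (HM : 0 <= M) by (apply Rle_trans with (2 := proj2 (HU a ltac:(lra))); apply Rabs_pos).
  assert (Hs1 : s = 1 \/ s = - 1).
  { assert (Hf : (s - 1) * (s + 1) = 0) by lra. apply Rmult_integral in Hf. lra. }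
  assert (Hgrow : forall x, a' <= x -> 2 * eps * x - 2 * eps * a' <=
     (s * (y x * y x) + 2 * G * U x) - (s * (y a' * y a') + 2 * G * U a')).
  { intros x Hx.
    apply (derive_le (fun x => 2 * eps * x) (fun x => s * (y x * y x) + 2 * G * U x) (fun _ => 2 * eps)
      (fun x => s * (2 * (y x * (w x + superpotential l c x * y x))) + 2 * G * y x ^ 2)); [lra | | |];
      intros z Hz.
    - auto_derive; [exact I | ring].
    - destruct (Hsys z ltac:(lra)) as [Hy _]. eapply is_derive_eq.
      + apply is_derive_Rplus; apply is_derive_Rscal; [apply is_derive_Rmult; exact Hy | apply HU; lra].
      + ring.
    - specialize (Hge z ltac:(lra)).
      assert (Hg := superpotential_bounded l c a z Hl Hc ltac:(lra)). fold G in Hg.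
      assert (Hy2 : 0 <= y z * y z) by apply Rle_0_sqr.
      apply Rabs_le_between in Hg.
      assert (0 <= (s * superpotential l c z + G) * (y z * y z)) by (apply Rmult_le_pos; [destruct Hs1; subst s; lra | lra]).
      simpl. lra. }
  set (B := Rabs (y a' * y a') + 4 * G * M + 1).
  assert (Hlarge : forall x, a' + B / (2 * eps) <= x -> 1 <= s * (y x * y x)).
  { intros x Hx. assert (HB : 0 < B) by (unfold B; assert (HA := Rabs_pos (y a' * y a')); assert (0 <= G * M) by (apply Rmult_le_pos; lra); lra).
    assert (0 < B / (2 * eps)) by (apply Rdiv_lt_0_compat; lra).
    specialize (Hgrow x ltac:(lra)).
    assert (HB2 : B <= 2 * eps * x - 2 * eps * a').
    { replace B with (2 * eps * (B / (2 * eps))) by (field; lra).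
      rewrite <- Rmult_minus_distr_l. apply Rmult_le_compat_l; lra. }
    destruct (HU x ltac:(lra)) as [_ Hx1]. destruct (HU a' H1) as [_ Hx2].
    apply Rabs_le_between in Hx1. apply Rabs_le_between in Hx2.
    assert (G * U x <= G * M) by (apply Rmult_le_compat_l; lra).
    assert (G * - M <= G * U a') by (apply Rmult_le_compat_l; lra).
    assert (- Rabs (y a' * y a') <= s * (y a' * y a')).
    { assert (HA := Rabs_pos_eq _ (Rle_0_sqr (y a'))). unfold Rsqr in HA. rewrite HA.
      assert (HA' := Rle_0_sqr (y a')). unfold Rsqr in HA'. destruct Hs1; subst s; lra. }
    unfold B in HB2. lra. }
  assert (HB : 0 < B) by (unfold B; assert (HA := Rabs_pos (y a' * y a')); assert (0 <= G * M) by (apply Rmult_le_pos; lra); lra).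
  assert (HBe : 0 < B / (2 * eps)) by (apply Rdiv_lt_0_compat; lra).
  destruct Hs1 as [-> | ->].
  - apply (antiderivative_not_bounded U (fun x => y x ^ 2) a M (a' + B / (2 * eps)) 1); auto; try lra.
    intros x Hx. specialize (Hlarge x Hx). simpl. lra.
  - specialize (Hlarge _ (Rle_refl _)). assert (HA' := Rle_0_sqr (y (a' + B / (2 * eps)))).
    unfold Rsqr in HA'. lra.
Qed.

(** [y w + e U] is an antiderivative of [w^2], hence monotone; once too large, it would keep [y w]
    above 1 for good. So [w] inherits the tail condition whatever the sign of [e]. If [y w] were not
    frequently small, it would keep one sign and a distance from 0. *)
Lemma radial_tail (l c kappa : R) (y w : R -> R) :
  0 < l -> 0 < c -> radial_system l c kappa y w -> square_integrable_tail y ->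
  square_integrable_tail w /\ small_right positive (fun x => y x * w x).
Proof.
  intros Hl Hc Hsys Hy. split.
  - assert (Hy' := Hy). destruct Hy as [U [a [M [Ha HU]]]].
    set (e := (c / (l + 1)) ^ 2 - kappa).
    set (W := fun x => y x * w x + e * U x).
    assert (HW : forall x, a <= x -> is_derive W x (w x ^ 2)).
    { intros x Hx. destruct (Hsys x ltac:(lra)) as [H1 H2]. eapply is_derive_eq.
      - apply is_derive_Rplus; [apply is_derive_Rmult; eassumption | apply is_derive_Rscal, HU, Hx].
      - fold e. ring. }
    assert (Hmon : forall x z, a <= x -> x <= z -> W x <= W z).
    { intros x z Hx Hz. cut (0 - 0 <= W z - W x); [lra|].
      apply (derive_le (fun _ => 0) W (fun _ => 0) (fun x => w x ^ 2)); [assumption | | |]; intros t Ht.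
      - apply is_derive_Rconst.
      - apply HW; lra.
      - apply pow2_ge_0. }
    set (B := 1 + Rabs e * M).
    assert (HeU : forall x, a <= x -> Rabs (e * U x) <= Rabs e * M).
    { intros x Hx. rewrite Rabs_mult. apply Rmult_le_compat_l; [apply Rabs_pos | apply HU, Hx]. }
    assert (Hub : forall x, a <= x -> W x <= B).
    { intros x Hx. destruct (Rle_or_lt (W x) B) as [|Hlt]; [assumption|exfalso].
      apply (radial_tail_product l c kappa 1 x 1 y w); auto; try lra.
      intros z Hz. specialize (Hmon x z Hx Hz). specialize (HeU z ltac:(lra)).
      apply Rabs_le_between in HeU. unfold W in Hmon at 2. unfold B in Hlt. lra. }
    exists W, a, (Rmax (Rabs (W a)) B). split; [assumption|].
    intros x Hx. split; [apply HW, Hx|].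
    assert (H1 := Rmax_l (Rabs (W a)) B). assert (H2 := Rmax_r (Rabs (W a)) B).
    apply Rabs_le. specialize (Hub x Hx). specialize (Hmon a x (Rle_refl a) Hx).
    assert (H3 := Rabs_maj2 (W a)). lra.
  - intros eps He x Hx. unfold positive in *. apply NNPP. intros Hn.
    assert (Hge : forall z, x < z -> eps <= Rabs (y z * w z)).
    { intros z Hz. destruct (Rle_or_lt eps (Rabs (y z * w z))); [assumption|].
      exfalso. apply Hn. exists z. repeat split; lra. }
    destruct (constant_sign (fun z => x < z) (fun z => y z * w z)) as [Hs | Hs].
    + intros u v t; lra.
    + intros z Hz. destruct (Hsys z ltac:(lra)) as [H1 H2].
      eapply continuous_of_derive. apply is_derive_Rmult; eassumption.
    + intros z Hz H0. specialize (Hge z Hz). rewrite H0, Rabs_R0 in Hge. lra.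
    + apply (radial_tail_product l c kappa eps (x + 1) 1 y w); auto; try lra.
      intros z Hz. specialize (Hge z ltac:(lra)). specialize (Hs z ltac:(lra)).
      rewrite Rabs_pos_eq in Hge; lra.
    + apply (radial_tail_product l c kappa eps (x + 1) (-1) y w); auto; try lra.
      intros z Hz. specialize (Hge z ltac:(lra)). specialize (Hs z ltac:(lra)).
      rewrite Rabs_left in Hge; lra.
Qed.

(** Gronwall for [y^2 + w^2]: its derivative is controlled because the superpotential is bounded
    between [x0] and [x], away from the origin. *)
Lemma radial_unique (l c kappa x0 x : R) (y w : R -> R) :
  0 < l -> 0 < c -> radial_system l c kappa y w ->
  0 < x0 -> y x0 = 0 -> w x0 = 0 -> 0 < x -> y x = 0 /\ w x = 0.
Proof.
  intros Hl Hc Hsys Hx0 Hy0 Hw0 Hx.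
  set (e := (c / (l + 1)) ^ 2 - kappa).
  set (a := Rmin x0 x). assert (Ha : 0 < a) by (apply Rmin_glb_lt; assumption).
  set (G := (l + 1) / a + c / (l + 1)).
  assert (HN : y x * y x + w x * w x <= 0).
  { apply (gronwall (fun x => y x * y x + w x * w x)
     (fun x => 2 * (y x * (w x + superpotential l c x * y x))
               + 2 * (w x * (- e * y x - superpotential l c x * w x)))
     (1 + Rabs e + 2 * G) x0 x).
    - intros z Hz. fold a in Hz. destruct (Hsys z ltac:(lra)) as [H1 H2]. eapply is_derive_eq.
      + apply is_derive_Rplus; apply is_derive_Rmult; eassumption.
      + fold e. ring.
    - intros z Hz. fold a in Hz.
      assert (Hg := superpotential_bounded l c a z Hl Hc ltac:(lra)). fold G in Hg.
      set (g := superpotential l c z) in *.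
      assert (Hyw : Rabs (2 * (y z * w z)) <= y z * y z + w z * w z).
      { apply Rabs_le. assert (A1 := Rle_0_sqr (y z - w z)). assert (A2 := Rle_0_sqr (y z + w z)).
        unfold Rsqr in *. lra. }
      assert (Hyy : Rabs (y z * y z - w z * w z) <= y z * y z + w z * w z).
      { apply Rabs_le. assert (A1 := Rle_0_sqr (y z)). assert (A2 := Rle_0_sqr (w z)).
        unfold Rsqr in *. lra. }
      replace (2 * (y z * (w z + g * y z)) + 2 * (w z * (- e * y z - g * w z)))
        with (2 * (y z * w z) + (- e) * (2 * (y z * w z)) + 2 * g * (y z * y z - w z * w z)) by ring.
      apply Rle_trans with (1 := Rabs_triang _ _).
      rewrite !Rmult_plus_distr_r. apply Rplus_le_compat.
      + apply Rle_trans with (1 := Rabs_triang _ _). apply Rplus_le_compat; [lra|].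
        rewrite Rabs_mult, Rabs_Ropp. apply Rmult_le_compat_l; [apply Rabs_pos | assumption].
      + rewrite Rabs_mult. apply Rmult_le_compat; auto; try apply Rabs_pos.
        rewrite Rabs_mult, (Rabs_pos_eq 2); lra.
    - cbv beta. rewrite Hy0, Hw0. ring. }
  assert (A1 := Rle_0_sqr (y x)). assert (A2 := Rle_0_sqr (w x)). unfold Rsqr in *.
  split; nra.
Qed.

(** * The radial ladder and the nodes *)

Lemma kappa_positive (l c kappa : R) (y w : R -> R) :
  0 < l -> 0 < c -> radial_system l c kappa y w -> square_integrable_tail y ->
  (exists x, 0 < x /\ y x <> 0) -> 0 < kappa.
Proof.
  intros Hl Hc Hsys Hy [x1 [Hx1 Hne]].
  destruct (Rlt_or_le 0 kappa) as [|Hk]; [assumption|exfalso].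
  destruct (radial_tail l c kappa y w Hl Hc Hsys Hy) as [[W [a2 [M2 [Ha2 HW]]]] _].
  destruct Hy as [U [a1 [M1 [Ha1 HU]]]].
  (* Both antiderivatives are available beyond [R0], and beyond [l (l + 1) / c] the centrifugal term
     of [P] is at most [c], which leaves [P >= c]. *)
  set (R0 := Rmax (Rmax a1 a2) (l * (l + 1) / c)).
  assert (HA1 : a1 <= R0) by (apply Rle_trans with (2 := Rmax_l _ _); apply Rmax_l).
  assert (HA2 : a2 <= R0) by (apply Rle_trans with (2 := Rmax_l _ _); apply Rmax_r).
  assert (HA3 : l * (l + 1) / c <= R0) by apply Rmax_r.
  assert (HR0 : 0 < R0) by lra.
  (* [z] is [y'], and the equation reads [z' = - (P / x) y]. *)
  set (z := fun x => w x + superpotential l c x * y x).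
  set (P := fun x => - kappa * x + 2 * c - l * (l + 1) / x).
  assert (HPp : forall x, R0 <= x -> c <= P x).
  { intros x Hx.
    assert (Hlc : l * (l + 1) <= c * x).
    { replace (l * (l + 1)) with (c * (l * (l + 1) / c)) by (field; lra).
      apply Rmult_le_compat_l; lra. }
    assert (l * (l + 1) / x <= c).
    { apply Rmult_le_reg_r with x; [lra|].
      replace (l * (l + 1) / x * x) with (l * (l + 1)) by (field; lra). lra. }
    assert (0 <= - kappa * x) by (apply Rmult_le_pos; lra). unfold P. lra. }
  (* [x (z^2 + Q y^2)] with [Q = P / x]; its derivative is [z^2 + P' y^2] *)
  set (H := fun x => x * (z x * z x) + P x * (y x * y x)).
  assert (Hmon : forall x, R0 <= x -> H R0 <= H x).
  { intros x Hx. cut (0 - 0 <= H x - H R0); [lra|].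
    apply (derive_le (fun _ => 0) H (fun _ => 0)
      (fun x => z x * z x + (- kappa + l * (l + 1) / x ^ 2) * (y x * y x))); [assumption | | |]; intros t Ht.
    - apply is_derive_Rconst.
    - destruct (Hsys t ltac:(lra)) as [H1 H2].
      assert (Hdz : is_derive z t (- (P t / t) * y t)).
      { unfold z. eapply is_derive_eq.
        - apply is_derive_Rplus; [exact H2|]. apply is_derive_Rmult; [|exact H1].
          unfold superpotential. auto_derive; [lra | reflexivity].
        - unfold P, superpotential. field. lra. }
      assert (HdP : is_derive P t (- kappa + l * (l + 1) / t ^ 2)).
      { unfold P. auto_derive; [lra | field; lra]. }
      eapply is_derive_eq.
      + apply is_derive_Rplus; apply is_derive_Rmult.
        * apply (is_derive_id (K := R_AbsRing)).
        * apply is_derive_Rmult; exact Hdz.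
        * exact HdP.
        * apply is_derive_Rmult; exact H1.
      + unfold one; simpl. unfold z. field. lra.
    - assert (Hz := Rle_0_sqr (z t)). assert (Hyy := Rle_0_sqr (y t)). unfold Rsqr in *.
      assert (0 < l * (l + 1) / t ^ 2).
      { apply Rdiv_lt_0_compat; [apply Rmult_lt_0_compat; lra | apply pow_lt; lra]. }
      assert (0 <= (- kappa + l * (l + 1) / t ^ 2) * (y t * y t)) by (apply Rmult_le_pos; lra). lra. }
  set (C0 := H R0).
  assert (HC0 : 0 < C0).
  { assert (Hz := Rle_0_sqr (z R0)). assert (Hyy := Rle_0_sqr (y R0)). unfold Rsqr in *.
    assert (Hp := HPp R0 (Rle_refl _)).
    assert (Hqy : 0 <= P R0 * (y R0 * y R0)) by (apply Rmult_le_pos; lra).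
    assert (Hqz : 0 <= R0 * (z R0 * z R0)) by (apply Rmult_le_pos; lra).
    destruct (Req_dec C0 0) as [HH | HH]; [exfalso | unfold C0, H in *; lra].
    unfold C0, H in HH.
    assert (Hqy0 : P R0 * (y R0 * y R0) = 0) by lra.
    assert (Hqz0 : R0 * (z R0 * z R0) = 0) by lra.
    assert (Hy0 : y R0 = 0) by (apply Rmult_integral in Hqy0; destruct Hqy0; [lra | nra]).
    assert (Hz0 : z R0 = 0) by (apply Rmult_integral in Hqz0; destruct Hqz0; [lra | nra]).
    apply Hne. apply (radial_unique l c kappa R0 x1 y w); auto.
    unfold z in Hz0. rewrite Hy0 in Hz0. lra. }
  set (G := (l + 1) / R0 + c / (l + 1)).
  assert (HG : 0 < G) by (apply Rplus_lt_0_compat; apply Rdiv_lt_0_compat; lra).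
  set (K := 2 + 2 * (G * G) + (- kappa + 2 * c / R0)).
  assert (HcR : 0 < 2 * c / R0) by (apply Rdiv_lt_0_compat; lra).
  assert (HK : 0 < K) by (unfold K; nra).
  (* From [x (z^2 + Q y^2) >= C0], the integrable [w^2 + y^2] dominates a multiple of [1 / x], whose
     integral diverges. *)
  assert (Hup : forall x, R0 <= x -> C0 * / x <= K * (w x ^ 2 + y x ^ 2)).
  { intros x Hx. assert (Hg := superpotential_bounded l c R0 x Hl Hc ltac:(lra)). fold G in Hg.
    set (g := superpotential l c x) in *.
    assert (Hg2 : g * g <= G * G).
    { rewrite <- (Rabs_pos_eq (g * g)) by apply Rle_0_sqr. rewrite Rabs_mult.
      apply Rmult_le_compat; auto; apply Rabs_pos. }
    assert (HQx : P x / x <= - kappa + 2 * c / R0).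
    { assert (2 * c / x <= 2 * c / R0).
      { apply Rmult_le_compat_l; [lra|]. apply Rinv_le_contravar; lra. }
      assert (0 < l * (l + 1) / x ^ 2).
      { apply Rdiv_lt_0_compat; [apply Rmult_lt_0_compat; lra | apply pow_lt; lra]. }
      replace (P x / x) with (- kappa + 2 * c / x - l * (l + 1) / x ^ 2) by (unfold P; field; lra).
      lra. }
    assert (Hyy := Rle_0_sqr (y x)). assert (Hww := Rle_0_sqr (w x)). unfold Rsqr in *.
    assert (Hzz : z x * z x <= 2 * (w x * w x) + 2 * (g * g * (y x * y x))).
    { assert (Hd := Rle_0_sqr (w x - g * y x)). unfold Rsqr in Hd.
      change (z x) with (w x + g * y x). lra. }
    assert (g * g * (y x * y x) <= G * G * (y x * y x)) by (apply Rmult_le_compat_r; lra).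
    assert (P x / x * (y x * y x) <= (- kappa + 2 * c / R0) * (y x * y x)) by (apply Rmult_le_compat_r; lra).
    assert (0 <= (- kappa + 2 * c / R0) * (w x * w x)) by (apply Rmult_le_pos; lra).
    assert (0 <= G * G * (w x * w x)) by (apply Rmult_le_pos; [nra | lra]).
    apply Rle_trans with (H x * / x).
    { apply Rmult_le_compat_r; [left; apply Rinv_0_lt_compat; lra | now apply Hmon]. }
    replace (H x * / x) with (z x * z x + P x / x * (y x * y x)) by (unfold H; field; lra).
    unfold K. simpl. lra. }
  set (B := K * (2 * (M1 + M2)) + 1).
  (* The point at which [C0 (ln x - ln R0)] equals [B], one more than [K (W + U)] can increase. *)
  set (x := R0 * exp (B / C0)).
  assert (HB : 0 < B).
  { assert (0 <= M1) by (apply Rle_trans with (2 := proj2 (HU a1 (Rle_refl _))); apply Rabs_pos).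
    assert (0 <= M2) by (apply Rle_trans with (2 := proj2 (HW a2 (Rle_refl _))); apply Rabs_pos).
    assert (0 <= K * (2 * (M1 + M2))) by (apply Rmult_le_pos; lra). unfold B. lra. }
  assert (Hx : R0 < x).
  { unfold x. rewrite <- (Rmult_1_r R0) at 1. apply Rmult_lt_compat_l; [assumption|].
    assert (Hbc : 0 < B / C0) by (apply Rdiv_lt_0_compat; assumption).
    apply Rlt_trans with (2 := exp_ineq1 _ (Rgt_not_eq _ _ Hbc)). lra. }
  assert (Hlog : C0 * ln x - C0 * ln R0 <= K * (W x + U x) - K * (W R0 + U R0)).
  { apply (derive_le (fun x => C0 * ln x) (fun x => K * (W x + U x)) (fun x => C0 * / x)
      (fun x => K * (w x ^ 2 + y x ^ 2))); [lra | | |]; intros t Ht.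
    - auto_derive; [lra | field; lra].
    - apply is_derive_Rscal, is_derive_Rplus; [apply HW; lra | apply HU; lra].
    - apply Hup; lra. }
  assert (Hln : C0 * ln x - C0 * ln R0 = B).
  { unfold x. rewrite ln_mult by (auto using exp_pos). rewrite ln_exp. field. lra. }
  rewrite Hln in Hlog.
  destruct (HU x ltac:(lra)) as [_ G1]. destruct (HU R0 ltac:(lra)) as [_ G2].
  destruct (HW x ltac:(lra)) as [_ G3]. destruct (HW R0 ltac:(lra)) as [_ G4].
  apply Rabs_le_between in G1. apply Rabs_le_between in G2.
  apply Rabs_le_between in G3. apply Rabs_le_between in G4.
  assert (Hcontr : K * (W x + U x) - K * (W R0 + U R0) <= K * (2 * (M1 + M2))).
  { rewrite <- Rmult_minus_distr_l. apply Rmult_le_compat_l; lra. }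
  unfold B in Hlog. lra.
Qed.

(** * Zeros and their interlacing *)

(** Keeping the zeros in increasing order, together with the absence of zeros in the gaps, lets the
    node count proceed by induction one gap at a time. *)
Fixpoint zeros_from (f : R -> R) (a : R) (xs : list R) : Prop :=
  match xs with
  | nil => forall r, a < r -> f r <> 0
  | x :: xs' => a < x /\ f x = 0 /\ (forall r, a < r < x -> f r <> 0) /\ zeros_from f x xs'
  end.

Lemma zeros_from_ext (f g : R -> R) (xs : list R) : forall a,
  (forall r, a < r -> (f r = 0 <-> g r = 0)) -> zeros_from f a xs -> zeros_from g a xs.
Proof.
  induction xs as [|x xs IH]; intros a He; simpl.
  - intros H r Hr. rewrite <- (He r Hr). now apply H.
  - intros [Hx [Hf [Hn Hz]]]. repeat split.
    + assumption.
    + now apply He.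
    + intros r Hr. rewrite <- (He r) by lra. now apply Hn.
    + apply IH; [|assumption]. intros r Hr. apply He. lra.
Qed.

Lemma zeros_from_extend (f : R -> R) (a b : R) (xs : list R) :
  a <= b -> (forall r, a < r <= b -> f r <> 0) -> zeros_from f b xs -> zeros_from f a xs.
Proof.
  intros Hab Hn. destruct xs as [|x xs]; simpl.
  - intros H r Hr. destruct (Rle_or_lt r b); [apply Hn; lra | now apply H].
  - intros [Hx [Hf [H Hz]]]. repeat split; auto; [lra|].
    intros r Hr. destruct (Rle_or_lt r b); [apply Hn; lra | apply H; lra].
Qed.

Lemma zeros_from_spec (f : R -> R) (xs : list R) : forall a,
  zeros_from f a xs -> NoDup xs /\ forall r, In r xs <-> (a < r /\ f r = 0).
Proof.
  induction xs as [|x xs IH]; intros a; simpl.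
  - intros H. split; [constructor|]. intros r. split; [tauto|]. intros [Hr Hf]. now apply (H r).
  - intros [Hx [Hf [Hn Hz]]]. destruct (IH x Hz) as [Hd Hin]. split.
    + constructor; [|assumption]. rewrite Hin. lra.
    + intros r. rewrite Hin. split.
      * intros [<- | [H1 H2]]; split; auto; lra.
      * intros [H1 H2]. destruct (Rtotal_order r x) as [H|[H|H]]; auto.
        exfalso. apply (Hn r); auto.
Qed.

Lemma rolle (f f' : R -> R) (a b : R) :
  a < b -> (forall x, a <= x <= b -> is_derive f x (f' x)) -> f a = 0 -> f b = 0 ->
  exists x, a <= x <= b /\ f' x = 0.
Proof.
  intros Hab Hf Ha Hb.
  destruct (MVT_gen f a b f') as [x [Hx Heq]].
  - intros x Hx. rewrite Rmin_left, Rmax_right in Hx by lra. apply Hf; lra.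
  - intros x Hx. rewrite Rmin_left, Rmax_right in Hx by lra.
    apply continuity_pt_filterlim. apply (continuous_of_derive f x (f' x)), Hf, Hx.
  - rewrite Rmin_left, Rmax_right in Hx by lra. exists x. split; [assumption|].
    rewrite Ha, Hb in Heq.
    assert (Hp : f' x * (b - a) = 0) by lra. apply Rmult_integral in Hp. destruct Hp; lra.
Qed.

(** Two zeros of [v] would enclose a zero of [h] by Rolle. Without any zero, [v] would have constant
    sign, so [h] would be monotone and small at both ends, hence zero. *)
Lemma unique_zero_between (D : R -> Prop) (v h p q : R -> R) :
  interval D -> open D -> (exists x, D x) ->
  (forall x, D x -> is_derive v x (p x * h x)) ->
  (forall x, D x -> is_derive h x (- q x * v x)) ->
  (forall x, D x -> 0 < p x) -> (forall x, D x -> 0 < q x) ->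
  (forall x, D x -> h x <> 0) ->
  small_left D h -> small_right D h ->
  exists r, D r /\ v r = 0 /\ forall t, D t -> v t = 0 -> t = r.
Proof.
  intros HD HDo [x0 Hx0] Hv Hh Hp Hq Hne Hl Hr.
  assert (Hlt : forall s t, D s -> D t -> v s = 0 -> v t = 0 -> s < t -> False).
  { intros s t Hs Ht Hvs Hvt Hst.
    destruct (rolle v (fun x => p x * h x) s t Hst) as [x [Hx Hx0']]; auto.
    - intros x Hx. apply Hv. now apply (HD s x t).
    - assert (HDx : D x) by now apply (HD s x t).
      specialize (Hp x HDx). specialize (Hne x HDx).
      apply Rmult_integral in Hx0'. destruct Hx0'; [lra | auto]. }
  destruct (classic (exists r, D r /\ v r = 0)) as [[r [Hr0 Hvr]] | Hnone].
  - exists r. repeat split; auto. intros t Ht Hvt.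
    destruct (Rtotal_order t r) as [H|[H|H]]; auto; exfalso; eauto.
  - exfalso. apply (Hne x0 Hx0).
    destruct (constant_sign D v) as [Hs | Hs]; auto.
    + intros x Hx. eapply continuous_of_derive. now apply Hv.
    + intros x Hx Hvx. apply Hnone. eauto.
    + cut (- h x0 = 0); [lra|].
      apply (monotone_small_ends D (fun x => - h x) (fun x => q x * v x)); auto.
      * intros x Hx. eapply is_derive_eq; [apply is_derive_Ropp, Hh, Hx | ring].
      * intros x Hx. apply Rmult_le_pos; left; auto.
      * now apply small_opp_left.
      * now apply small_opp_right.
    + apply (monotone_small_ends D h (fun x => - q x * v x)); auto.
      intros x Hx. specialize (Hs x Hx). specialize (Hq x Hx).
      replace (- q x * v x) with (q x * - v x) by ring. apply Rmult_le_pos; lra.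
Qed.

Lemma near_zero (f : R -> R) (a eps : R) :
  continuous f a -> f a = 0 -> 0 < eps ->
  exists d, 0 < d /\ forall t, Rabs (t - a) < d -> Rabs (f t) < eps.
Proof.
  intros Hc Ha He.
  destruct (proj1 (filterlim_locally f (f a)) Hc (mkposreal eps He)) as [d Hd].
  exists d. split; [apply cond_pos|]. intros t Ht.
  replace (f t) with (f t - f a) by (rewrite Ha; ring). exact (Hd t Ht).
Qed.

Lemma small_of_zero_left (f : R -> R) (a : R) (D : R -> Prop) :
  continuous f a -> f a = 0 -> (forall x, D x -> a < x /\ forall t, a < t < x -> D t) ->
  small_left D f.
Proof.
  intros Hc Ha HD eps He x Hx. destruct (HD x Hx) as [Hax HDx].
  destruct (near_zero f a eps Hc Ha He) as [d [Hd Hs]].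
  destruct (common_bound (x - a) d ltac:(lra) Hd) as [b [Hb [Hb1 Hb2]]].
  exists (a + b / 2). split; [apply HDx; lra|]. split; [lra|].
  apply Hs. rewrite Rabs_pos_eq; lra.
Qed.

Lemma small_of_zero_right (f : R -> R) (b : R) (D : R -> Prop) :
  continuous f b -> f b = 0 -> (forall x, D x -> x < b /\ forall t, x < t < b -> D t) ->
  small_right D f.
Proof.
  intros Hc Hb HD eps He x Hx. destruct (HD x Hx) as [Hxb HDx].
  destruct (near_zero f b eps Hc Hb He) as [d [Hd Hs]].
  destruct (common_bound (b - x) d ltac:(lra) Hd) as [a [Ha [Ha1 Ha2]]].
  exists (b - a / 2). split; [apply HDx; lra|]. split; [lra|].
  apply Hs. rewrite Rabs_left; lra.
Qed.

(** Every gap of [h], including the one that starts at [a] and the unbounded last one, contains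
    exactly one zero of [v], and [v] does not vanish at the zeros of [h]. There is one more gap than
    there are zeros. *)
Lemma interlacing (v h p q : R -> R) (xs : list R) : forall a,
  0 <= a ->
  (forall x, 0 < x -> is_derive v x (p x * h x)) ->
  (forall x, 0 < x -> is_derive h x (- q x * v x)) ->
  (forall x, 0 < x -> 0 < p x) -> (forall x, 0 < x -> 0 < q x) ->
  (forall x, 0 < x -> h x = 0 -> v x <> 0) ->
  small_left (fun x => a < x) h -> small_right positive h ->
  zeros_from h a xs ->
  exists ys, length ys = S (length xs) /\ zeros_from v a ys.
Proof.
  induction xs as [|x xs IH]; intros a Ha Hv Hh Hp Hq Hnc Hl Hr Hz; simpl in Hz.
  - destruct (unique_zero_between (fun x => a < x) v h p q) as [r [Har [Hvr Hun]]].
    + intros s t u; lra.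
    + apply open_gt.
    + exists (a + 1); lra.
    + intros x Hx; apply Hv; lra.
    + intros x Hx; apply Hh; lra.
    + intros x Hx; apply Hp; lra.
    + intros x Hx; apply Hq; lra.
    + exact Hz.
    + exact Hl.
    + intros eps He x Hx. destruct (Hr eps He x) as [t [Ht [Hxt Hs]]]; [unfold positive; lra|].
      exists t. repeat split; auto. lra.
    + exists (r :: nil). split; [reflexivity|]. simpl. repeat split; auto.
      * intros t Ht H0. apply Hun in H0; lra.
      * intros t Ht H0. apply Hun in H0; lra.
  - destruct Hz as [Hax [Hhx [Hn Hz]]].
    assert (Hcx : continuous h x) by (eapply continuous_of_derive; apply Hh; lra).
    destruct (unique_zero_between (fun t => a < t < x) v h p q) as [r [Har [Hvr Hun]]].
    + intros s t u; lra.
    + apply (open_and (fun t => a < t) (fun t => t < x)); [apply open_gt | apply open_lt].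
    + exists ((a + x) / 2); lra.
    + intros t Ht; apply Hv; lra.
    + intros t Ht; apply Hh; lra.
    + intros t Ht; apply Hp; lra.
    + intros t Ht; apply Hq; lra.
    + exact Hn.
    + intros eps He t Ht. destruct (Hl eps He t) as [u Hu]; [lra|]. exists u.
      destruct Hu as [H1 [H2 H3]]. repeat split; auto; lra.
    + apply (small_of_zero_right h x); auto. intros t Ht. split; [lra | intros; lra].
    + destruct (IH x ltac:(lra) Hv Hh Hp Hq Hnc) as [ys [Hlen Hys]]; auto.
      * apply (small_of_zero_left h x); auto. intros t Ht. split; [lra | intros; lra].
      * exists (r :: ys). split; [simpl; now rewrite Hlen|]. simpl. repeat split; try tauto.
        { intros t Ht H0. apply Hun in H0; lra. }
        (* No zero of [v] lies between [r] and the end of its gap, by uniqueness, and none at [x]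
           itself, by [Hnc]. *)
        apply (zeros_from_extend v r x); [lra | | assumption].
        intros t Ht H0. destruct (Req_dec t x) as [-> | Htx].
        { apply (Hnc x); auto; lra. }
        apply Hun in H0; lra.
Qed.

Lemma radial_raise (l c kappa : R) (y w : R -> R) :
  0 < l -> 0 < c -> radial_system l c kappa y w ->
  radial_system (l + 1) c kappa w
    (fun x => - ((c / (l + 1)) ^ 2 - kappa) * y x
              - (superpotential l c x + superpotential (l + 1) c x) * w x).
Proof.
  intros Hl Hc H x Hx. destruct (H x Hx) as [H1 H2]. split.
  - eapply is_derive_eq; [exact H2 | ring].
  - eapply is_derive_eq.
    + apply is_derive_Rminus.
      * apply is_derive_Rscal, H1.
      * apply (is_derive_Rmult (fun x => superpotential l c x + superpotential (l + 1) c x) w); [|exact H2].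
        unfold superpotential. auto_derive; [lra | reflexivity].
    + unfold superpotential. field. lra.
Qed.

Lemma ln_le_sub_1 (x : R) : 0 < x -> ln x <= x - 1.
Proof.
  intros Hx. destruct (Req_dec (ln x) 0) as [H | H].
  - assert (Hx1 : x = 1) by (rewrite <- (exp_ln x Hx), H; apply exp_0). lra.
  - assert (H2 := exp_ineq1 _ H). rewrite exp_ln in H2 by assumption. lra.
Qed.

(** The bound is the maximum of [x^a exp (- k x)], attained at [x = a / k]; it comes from
    [ln t <= t - 1] at [t = k x / a]. *)
Lemma Rpower_exp_bounded (a k : R) :
  0 < a -> 0 < k -> exists B, 0 < B /\ forall x, 0 < x -> Rpower x a * exp (- k * x) <= B.
Proof.
  intros Ha Hk. exists (exp (a * (- 1 - ln (k / a)))). split; [apply exp_pos|]. intros x Hx.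
  unfold Rpower. rewrite <- exp_plus.
  assert (Hka : 0 < k / a) by (apply Rdiv_lt_0_compat; assumption).
  assert (Hln := ln_le_sub_1 (k / a * x) ltac:(apply Rmult_lt_0_compat; assumption)).
  rewrite ln_mult in Hln by assumption.
  assert (Hle : a * ln x + - k * x <= a * (- 1 - ln (k / a))).
  { replace (- k * x) with (- (a * (k / a * x))) by (field; lra).
    assert (H : a * ln x <= a * (k / a * x - 1 - ln (k / a))) by (apply Rmult_le_compat_l; lra).
    lra. }
  destruct Hle as [Hle | ->]; [left; now apply exp_increasing | right; reflexivity].
Qed.

Lemma regular_weight_bounded (l c : R) :
  0 < l -> 0 < c -> exists B, 0 < B /\ forall x, 0 < x -> regular_weight l c x <= B.
Proof.
  intros Hl Hc. apply Rpower_exp_bounded; [lra | apply Rdiv_lt_0_compat; lra].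
Qed.

(** If [w = 0], then [e = 0], and a zero of [y] would make the solution trivial. Otherwise [e > 0],
    and [y / weight], [w * weight] satisfy [v' = p h], [h' = - q v] with positive [p] and [q]. They
    have the zeros of [y] and [w], so interlacing applies. *)
Lemma radial_step (l c kappa : R) (y w : R -> R) :
  0 < l -> 0 < c -> radial_system l c kappa y w ->
  linear_at_0 y -> square_integrable_tail y -> (exists x, 0 < x /\ y x <> 0) ->
  ((c / (l + 1)) ^ 2 = kappa /\ zeros_from y 0 nil) \/
  (kappa < (c / (l + 1)) ^ 2 /\ linear_at_0 w /\ square_integrable_tail w /\
   (exists x, 0 < x /\ w x <> 0) /\
   forall xs, zeros_from w 0 xs -> exists ys, length ys = S (length xs) /\ zeros_from y 0 ys).
Proof.
  intros Hl Hc Hsys H0 Hinf [x0 [Hx0 Hne]].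
  set (e := (c / (l + 1)) ^ 2 - kappa).
  assert (Hw0 := radial_linear_at_0 l c kappa y w Hl Hc Hsys H0).
  destruct (radial_tail l c kappa y w Hl Hc Hsys Hinf) as [Hwinf Hsr].
  assert (Hsl := linear_at_0_small positive _ initial_positive
    (linear_at_0_mult y w (bounded_of_linear_at_0 y H0) Hw0)).
  assert (Hzero : (forall x, positive x -> w x = 0) -> e = 0).
  { intros Hw. destruct (Hsys x0 Hx0) as [_ Hdw].
    apply (derive_of_zero positive w x0 _ open_positive Hw Hx0) in Hdw.
    rewrite (Hw x0 Hx0) in Hdw. fold e in Hdw.
    assert (Hm : e * y x0 = 0) by lra. apply Rmult_integral in Hm. tauto. }
  assert (Hcase : (forall x, positive x -> w x = 0) \/ (0 < e /\ exists x, 0 < x /\ w x <> 0)).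
  { destruct (Rlt_or_le 0 e) as [He | He].
    - right. split; [assumption|]. apply NNPP. intros Hn.
      assert (e = 0); [|lra]. apply Hzero. intros x Hx. apply NNPP. intros Hx'. apply Hn. now exists x.
    - left. intros x Hx.
      assert (H : w x * w x = 0).
      { apply (factorisation_step positive (fun x => y x * w x) (fun x => w x * w x)
          (fun x => y x * y x) e interval_positive open_positive He); auto.
        - intros t Ht. destruct (Hsys t Ht) as [H1 H2]. eapply is_derive_eq.
          + apply is_derive_Rmult; eassumption.
          + fold e. ring.
        - intros t _. split; apply Rle_0_sqr. }
      apply Rmult_integral in H. tauto. }
  destruct Hcase as [Hw | [He Hw]]; [left | right].
  - specialize (Hzero Hw). split; [unfold e in Hzero; lra|]. intros r Hr Hyr.
    apply Hne. apply (radial_unique l c kappa r x0 y w); auto.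
  - split; [unfold e in He; lra|]. do 3 (split; [assumption|]). intros xs Hxs.
    assert (Hm := regular_weight_pos l c).
    destruct (interlacing (fun x => y x / regular_weight l c x) (fun x => w x * regular_weight l c x)
      (fun x => / regular_weight l c x ^ 2) (fun x => e * regular_weight l c x ^ 2) xs 0) as [ys [Hlen Hys]].
    + lra.
    + intros x Hx. now apply (radial_regular_part l c kappa).
    + intros x Hx. specialize (Hm x). eapply is_derive_eq; [now apply (radial_singular_part l c kappa y w)|].
      fold e. field. lra.
    + intros x Hx. apply Rinv_0_lt_compat, pow_lt, Hm.
    + intros x Hx. apply Rmult_lt_0_compat; [assumption | apply pow_lt, Hm].
    + intros x Hx Hh0 Hv0. specialize (Hm x).
      apply Hne. apply (radial_unique l c kappa x x0 y w); auto.
      * replace (y x) with (y x / regular_weight l c x * regular_weight l c x) by (field; lra).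
        rewrite Hv0. ring.
      * apply Rmult_integral in Hh0. destruct Hh0; [assumption | lra].
    + apply linear_at_0_small; [apply initial_positive|]. destruct Hw0 as [C [d [Hd HC]]]. exists C, d. split; [assumption|].
      intros x Hx. rewrite Rabs_mult, (Rabs_pos_eq (regular_weight _ _ _)) by (left; apply Hm).
      rewrite <- (Rmult_1_r (C * x)). apply Rmult_le_compat; auto; [apply Rabs_pos | left; apply Hm|].
      apply Rle_trans with (1 := regular_weight_le_Rpower l c x Hl Hc ltac:(lra)).
      apply Rpower_le_1; lra.
    + (* the weight is bounded, and [w] being square-integrable is frequently small *)
      destruct (regular_weight_bounded l c Hl Hc) as [B [HB Hwt]]. intros eps Heps x Hx. unfold positive in *.
      apply NNPP. intros Hn.
      destruct Hwinf as [U [a [M [Ha HU]]]].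
      apply (antiderivative_not_bounded U (fun x => w x ^ 2) a M (Rmax a (x + 1)) ((eps / B) ^ 2)); auto.
      * apply pow_lt, Rdiv_lt_0_compat; assumption.
      * apply Rmax_l.
      * intros t Ht. assert (H1 := Rmax_r a (x + 1)).
        rewrite <- (pow2_abs (w t)). apply pow_incr. split; [left; now apply Rdiv_lt_0_compat|].
        destruct (Rle_or_lt (eps / B) (Rabs (w t))) as [|Hlt]; [assumption|exfalso].
        apply Hn. exists t. split; [lra|]. split; [lra|].
        rewrite Rabs_mult, (Rabs_pos_eq (regular_weight _ _ _)) by (left; apply Hm).
        apply Rle_lt_trans with (Rabs (w t) * B).
        { apply Rmult_le_compat_l; [apply Rabs_pos | apply Hwt; lra]. }
        replace eps with (eps / B * B) by (field; lra). now apply Rmult_lt_compat_r.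
    + apply (zeros_from_ext w); [|assumption]. intros r Hr. specialize (Hm r). split.
      * intros ->. ring.
      * intros Hz. apply Rmult_integral in Hz. destruct Hz; [assumption | lra].
    + exists ys. split; [assumption|].
      apply (zeros_from_ext (fun x => y x / regular_weight l c x)); [|assumption].
      intros r Hr. specialize (Hm r). split.
      * intros Hz. replace (y r) with (y r / regular_weight l c r * regular_weight l c r) by (field; lra).
        rewrite Hz. ring.
      * intros ->. unfold Rdiv. ring.
Qed.

(** As in the polar case [n] bounds the number of steps. The list of zeros is empty at the top and
    gains one entry on the way back through each step, so its length is the number of raises. *)
Lemma radial_ladder (c kappa : R) (n : nat) : forall (l : R) (y w : R -> R),
  0 < l -> 0 < c -> radial_system l c kappa y w ->
  linear_at_0 y -> square_integrable_tail y -> (exists x, 0 < x /\ y x <> 0) ->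
  (c / (l + INR n + 1)) ^ 2 <= kappa ->
  exists xs, kappa = (c / (l + INR (length xs) + 1)) ^ 2 /\ zeros_from y 0 xs.
Proof.
  induction n as [|n IH]; intros l y w Hl Hc Hsys H0 Hinf Hne Hk;
    destruct (radial_step l c kappa y w Hl Hc Hsys H0 Hinf Hne)
      as [[He Hz] | [He [Hw0 [Hwinf [Hwne Hz]]]]];
    try solve [exists nil; simpl length; simpl INR; rewrite Rplus_0_r; auto].
  - exfalso. simpl INR in Hk. rewrite Rplus_0_r in Hk. lra.
  - destruct (IH (l + 1) w _ ltac:(lra) Hc (radial_raise l c kappa y w Hl Hc Hsys) Hw0 Hwinf Hwne)
      as [xs [Hxs Hzxs]].
    + rewrite S_INR in Hk. replace (l + 1 + INR n + 1) with (l + (INR n + 1) + 1) by ring. assumption.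
    + destruct (Hz xs Hzxs) as [ys [Hlen Hys]]. exists ys. split; [|assumption].
      rewrite Hlen, S_INR. replace (l + (INR (length xs) + 1) + 1) with (l + 1 + INR (length xs) + 1) by ring.
      assumption.
Qed.

(** Positivity of [kappa] makes the ladder finite: [c / (l + n + 1)] falls below [sqrt kappa] for
    large [n]. *)
Lemma radial_spectrum (l c kappa : R) (y w : R -> R) :
  0 < l -> 0 < c -> radial_system l c kappa y w ->
  linear_at_0 y -> square_integrable_tail y -> (exists x, 0 < x /\ y x <> 0) ->
  exists xs, kappa = (c / (l + INR (length xs) + 1)) ^ 2 /\ zeros_from y 0 xs.
Proof.
  intros Hl Hc Hsys H0 Hinf Hne.
  assert (Hk := kappa_positive l c kappa y w Hl Hc Hsys Hinf Hne).
  destruct (INR_unbounded (c / sqrt kappa)) as [n Hn].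
  apply (radial_ladder c kappa n l y w); auto.
  assert (Hs : 0 < sqrt kappa) by (apply sqrt_lt_R0; exact Hk).
  rewrite <- (pow2_sqrt kappa (Rlt_le _ _ Hk)). apply pow_incr.
  assert (Hn0 := pos_INR n). split; [left; apply Rdiv_lt_0_compat; lra|].
  apply Rmult_le_reg_r with (l + INR n + 1); [lra|].
  replace (c / (l + INR n + 1) * (l + INR n + 1)) with (sqrt kappa * (c / sqrt kappa)) by (field; lra).
  apply Rmult_le_compat_l; lra.
Qed.

(** * The azimuthal problem *)

Definition near_ends (Phi d x : R) : Prop := 0 < x < Phi /\ (x < d \/ Phi - d < x).

Definition vanishing_ends (Phi : R) (f : R -> R) : Prop :=
  forall eps, 0 < eps -> exists d, 0 < d /\ forall x, near_ends Phi d x -> Rabs (f x) < eps.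

Lemma vanishing_ends_small (Phi : R) (f : R -> R) :
  vanishing_ends Phi f ->
  small_left (fun x => 0 < x < Phi) f /\ small_right (fun x => 0 < x < Phi) f.
Proof.
  intros H. split; intros eps He x Hx; destruct (H eps He) as [d [Hd Hs]].
  - destruct (common_bound x d ltac:(lra) Hd) as [b [Hb [H1 H2]]].
    exists (b / 2). split; [lra|]. split; [lra|]. apply Hs. unfold near_ends. lra.
  - destruct (common_bound (Phi - x) d ltac:(lra) Hd) as [b [Hb [H1 H2]]].
    exists (Phi - b / 2). split; [lra|]. split; [lra|]. apply Hs. unfold near_ends. lra.
Qed.

Lemma vanishing_ends_minus (Phi : R) (f g : R -> R) :
  vanishing_ends Phi f -> vanishing_ends Phi g -> vanishing_ends Phi (fun x => f x - g x).
Proof.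
  intros Hf Hg eps He. destruct (Hf (eps / 2) ltac:(lra)) as [d1 [Hd1 H1]].
  destruct (Hg (eps / 2) ltac:(lra)) as [d2 [Hd2 H2]].
  destruct (common_bound d1 d2 Hd1 Hd2) as [d [Hd [A1 A2]]].
  exists d. split; [assumption|]. intros x Hx. unfold near_ends in *.
  specialize (H1 x ltac:(lra)). specialize (H2 x ltac:(lra)).
  unfold Rminus. apply Rle_lt_trans with (1 := Rabs_triang _ _). rewrite Rabs_Ropp. lra.
Qed.

Lemma vanishing_ends_mult (Phi B d : R) (f g : R -> R) :
  vanishing_ends Phi f -> 0 < d -> (forall x, near_ends Phi d x -> Rabs (g x) <= B) ->
  vanishing_ends Phi (fun x => f x * g x).
Proof.
  intros Hf Hd Hg eps He.
  set (A := Rabs B + 1). assert (HA : 0 < A) by (unfold A; assert (H := Rabs_pos B); lra).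
  destruct (Hf (eps / A)) as [d1 [Hd1 H1]]; [apply Rdiv_lt_0_compat; lra|].
  destruct (common_bound d1 d Hd1 Hd) as [d2 [Hd2 [A1 A2]]].
  exists d2. split; [assumption|].
  intros x Hx. unfold near_ends in *. specialize (H1 x ltac:(lra)). specialize (Hg x ltac:(lra)).
  rewrite Rabs_mult. apply Rle_lt_trans with (Rabs (f x) * A).
  - apply Rmult_le_compat_l; [apply Rabs_pos|]. unfold A. assert (H := Rle_abs B). lra.
  - replace eps with (eps / A * A) by (field; lra). apply Rmult_lt_compat_r; assumption.
Qed.

Lemma bounded_of_bounded_derivative (f f' : R -> R) (alpha beta K : R) :
  alpha < beta ->
  (forall x, alpha < x < beta -> is_derive f x (f' x) /\ Rabs (f' x) <= K) ->
  exists B, forall x, alpha < x < beta -> Rabs (f x) <= B.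
Proof.
  intros Hab Hf. set (m := (alpha + beta) / 2). exists (Rabs (f m) + K * (beta - alpha)).
  assert (HK : 0 <= K) by (apply Rle_trans with (2 := proj2 (Hf m ltac:(unfold m; lra))); apply Rabs_pos).
  assert (G : forall u v, alpha < u -> u <= v -> v < beta -> Rabs (f v - f u) <= K * (beta - alpha)).
  { intros u v Hu Huv Hv. apply Rle_trans with (K * v - K * u).
    - apply (derive_abs_le f (fun x => K * x) f' (fun _ => K)); [assumption | | |]; intros t Ht.
      + apply Hf; lra.
      + auto_derive; [exact I | ring].
      + apply Hf; lra.
    - rewrite <- Rmult_minus_distr_l. apply Rmult_le_compat_l; lra. }
  intros x Hx.
  replace (f x) with (f m + (f x - f m)) by ring.
  apply Rle_trans with (1 := Rabs_triang _ _). apply Rplus_le_compat_l.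
  destruct (Rle_or_lt m x).
  - apply G; unfold m in *; lra.
  - rewrite Rabs_minus_sym. apply G; unfold m in *; lra.
Qed.

Definition azimuthal_system (Phi : R) (a a1 f : R -> R) : Prop :=
  forall x, 0 < x < Phi -> is_derive a x (a1 x) /\ is_derive a1 x (- f x).

(** Only the values are known to vanish at the barriers, so the derivative needs an argument: near
    an end [a] and [b] are below 1, hence [a1'] is bounded, and so is [a1] on that bounded
    interval. *)
Lemma azimuthal_derivative_bounded (Phi p q : R) (a a1 b : R -> R) :
  0 < Phi -> azimuthal_system Phi a a1 (fun x => p * a x + q * b x) ->
  vanishing_ends Phi a -> vanishing_ends Phi b ->
  exists B d', 0 < d' /\ forall x, near_ends Phi d' x -> Rabs (a1 x) <= B.
Proof.
  intros HPhi H Ha Hb.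
  destruct (Ha 1 Rlt_0_1) as [d1 [Hd1 H1]]. destruct (Hb 1 Rlt_0_1) as [d2 [Hd2 H2]].
  destruct (common_bound d1 d2 Hd1 Hd2) as [d3 [Hd3 [A1 A2]]].
  destruct (common_bound d3 Phi Hd3 HPhi) as [d [Hd [A3 A4]]].
  assert (Hf : forall x, near_ends Phi d x ->
    is_derive a1 x (- (p * a x + q * b x)) /\ Rabs (- (p * a x + q * b x)) <= Rabs p + Rabs q).
  { intros x Hx. split; [apply H, Hx|]. unfold near_ends in *.
    specialize (H1 x ltac:(lra)). specialize (H2 x ltac:(lra)). rewrite Rabs_Ropp.
    apply Rle_trans with (1 := Rabs_triang _ _). rewrite !Rabs_mult.
    assert (Hp := Rabs_pos p). assert (Hq := Rabs_pos q). nra. }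
  destruct (bounded_of_bounded_derivative a1 (fun x => - (p * a x + q * b x)) 0 d (Rabs p + Rabs q) Hd) as [B1 HB1].
  { intros x Hx. apply Hf. unfold near_ends. lra. }
  destruct (bounded_of_bounded_derivative a1 (fun x => - (p * a x + q * b x)) (Phi - d) Phi (Rabs p + Rabs q) ltac:(lra)) as [B2 HB2].
  { intros x Hx. apply Hf. unfold near_ends. lra. }
  exists (Rmax B1 B2), d. split; [assumption|]. intros x [Hx [Hx1 | Hx1]].
  - apply Rle_trans with (2 := Rmax_l _ _). apply HB1. lra.
  - apply Rle_trans with (2 := Rmax_r _ _). apply HB2. lra.
Qed.

Lemma azimuthal_system_ext (Phi : R) (a a1 f g : R -> R) :
  (forall x, f x = g x) -> azimuthal_system Phi a a1 f -> azimuthal_system Phi a a1 g.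
Proof. intros He H x Hx. rewrite <- He. apply H, Hx. Qed.

Lemma interval_open_interval (alpha beta : R) : interval (fun x => alpha < x < beta).
Proof. intros x y z; lra. Qed.

Lemma open_open_interval (alpha beta : R) : open (fun x => alpha < x < beta).
Proof. apply (open_and (fun x => alpha < x) (fun x => x < beta)); [apply open_gt | apply open_lt]. Qed.

(** The Wronskian [a b' - b a'] has derivative [- q (a^2 + b^2)] and vanishes at the barriers
    because the derivatives are bounded there. *)
Lemma azimuthal_real (Phi p q : R) (a a1 b b1 : R -> R) :
  0 < Phi ->
  azimuthal_system Phi a a1 (fun x => p * a x + - q * b x) ->
  azimuthal_system Phi b b1 (fun x => p * b x + q * a x) ->
  vanishing_ends Phi a -> vanishing_ends Phi b ->
  (exists x, 0 < x < Phi /\ (a x <> 0 \/ b x <> 0)) -> q = 0.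
Proof.
  intros HPhi Ha Hb Va Vb [x0 [Hx0 Hne]].
  destruct (azimuthal_derivative_bounded Phi p (- q) a a1 b HPhi) as [Ba [da [Hda HBa]]]; auto.
  destruct (azimuthal_derivative_bounded Phi p q b b1 a HPhi) as [Bb [db [Hdb HBb]]]; auto.
  set (W := fun x => a x * b1 x - b x * a1 x).
  destruct (vanishing_ends_small Phi W) as [Wl Wr].
  { apply vanishing_ends_minus.
    - now apply (vanishing_ends_mult Phi Bb db).
    - now apply (vanishing_ends_mult Phi Ba da). }
  destruct (constant_sign_small_ends (fun x => 0 < x < Phi) W (fun x => a x * a x + b x * b x) q
    (interval_open_interval _ _) (open_open_interval _ _)) with (x := x0) as [|H]; auto.
  - intros x Hx. destruct (Ha x Hx) as [H1 H2], (Hb x Hx) as [H3 H4]. eapply is_derive_eq.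
    + apply is_derive_Rminus; apply is_derive_Rmult; eassumption.
    + ring.
  - intros x _. apply Rplus_le_le_0_compat; apply Rle_0_sqr.
  - exfalso. destruct Hne; nra.
Qed.

Lemma derive_zero_constant (D : R -> Prop) (f : R -> R) (x y : R) :
  interval D -> (forall t, D t -> is_derive f t 0) -> D x -> D y -> f x = f y.
Proof.
  intros HD Hf Hx Hy.
  assert (G : forall u v, D u -> D v -> u <= v -> f u = f v).
  { intros u v Hu Hv Huv.
    assert (H : Rabs (f v - f u) <= 0 - 0).
    { apply (derive_abs_le f (fun _ => 0) (fun _ => 0) (fun _ => 0)); [assumption | | |]; intros t Ht.
      - apply Hf. now apply (HD u t v).
      - apply is_derive_Rconst.
      - rewrite Rabs_R0. lra. }
    assert (H0 := Rabs_pos (f v - f u)).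
    assert (H1 : Rabs (f v - f u) = 0) by lra.
    destruct (Req_dec (f v - f u) 0) as [H2 | H2]; [lra|]. apply Rabs_no_R0 in H2. contradiction. }
  destruct (Rle_or_lt x y); [auto | symmetry; apply G; auto; lra].
Qed.

Lemma eq_0_of_abs_lt (r : R) : (forall eps, 0 < eps -> Rabs r < eps) -> r = 0.
Proof.
  intros H. destruct (Req_dec r 0) as [|Hr]; [assumption|].
  assert (Hp := Rabs_pos_lt r Hr). specialize (H (Rabs r) Hp). lra.
Qed.

Lemma abs_sin_le (u : R) : Rabs (sin u) <= Rabs u.
Proof.
  assert (G : forall v, 0 <= v -> Rabs (sin v) <= v).
  { intros v Hv. replace v with (v - 0) at 2 by ring.
    replace (sin v) with (sin v - sin 0) by (rewrite sin_0; ring).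
    apply (derive_abs_le sin (fun x => x) cos (fun _ => 1)); [assumption | | |]; intros t Ht.
    - apply is_derive_sin.
    - apply (is_derive_id (K := R_AbsRing)).
    - apply Rabs_le, COS_bound. }
  destruct (Rle_or_lt 0 u) as [Hu | Hu].
  - rewrite (Rabs_pos_eq u Hu). now apply G.
  - rewrite (Rabs_left u Hu). rewrite <- Rabs_Ropp, <- sin_neg. apply G. lra.
Qed.

(** For [p <= 0] the factorisation step with [w = a1] makes [a] constant, hence 0. For [p = om^2],
    transporting the solution from [x] to an end [s] expresses its value there through [a x] and
    [a1 x]; eliminating [a1] between the two ends leaves [a x0 * sin (om * Phi) = 0]. *)
Lemma azimuthal_spectrum (Phi p : R) (a a1 : R -> R) :
  0 < Phi -> azimuthal_system Phi a a1 (fun x => p * a x) -> vanishing_ends Phi a ->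
  (exists x, 0 < x < Phi /\ a x <> 0) ->
  exists n : nat, (1 <= n)%nat /\ p = (INR n * PI / Phi) ^ 2.
Proof.
  intros HPhi Ha Va [x0 [Hx0 Hne]].
  destruct (azimuthal_derivative_bounded Phi p 0 a a1 a HPhi) as [B [d [Hd HB]]]; auto.
  { eapply azimuthal_system_ext; [|exact Ha]. intros x; cbv beta. ring. }
  assert (Hp : 0 < p).
  { destruct (Rlt_or_le 0 p) as [|Hp]; [assumption|exfalso].
    set (D := fun x => 0 < x < Phi) in *.
    destruct (vanishing_ends_small Phi (fun x => a x * a1 x)) as [Gl Gr].
    { now apply (vanishing_ends_mult Phi B d). }
    assert (Ha1 : forall x, D x -> a1 x = 0).
    { intros x Hx. assert (H : a1 x * a1 x = 0).
      { apply (factorisation_step D (fun x => a x * a1 x) (fun x => a1 x * a1 x) (fun x => a x * a x) p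
          (interval_open_interval _ _) (open_open_interval _ _) Hp); auto.
        - intros t Ht. destruct (Ha t Ht) as [H1 H2]. eapply is_derive_eq.
          + apply is_derive_Rmult; eassumption.
          + cbv beta. ring.
        - intros t _. split; apply Rle_0_sqr. }
      apply Rmult_integral in H. tauto. }
    apply Hne. apply eq_0_of_abs_lt. intros eps He.
    destruct (proj1 (vanishing_ends_small Phi a Va) eps He x0 Hx0) as [y [Hy [_ Hs]]].
    rewrite (derive_zero_constant D a x0 y (interval_open_interval _ _)); auto.
    intros t Ht. rewrite <- (Ha1 t Ht). apply Ha, Ht. }
  set (om := sqrt p). assert (Hom : 0 < om) by (apply sqrt_lt_R0; assumption).
  assert (Hom2 : om * om = p) by (apply sqrt_sqrt; lra).
  (* both combinations are conserved and vanish at the corresponding end *)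
  assert (Hk : forall s, s = 0 \/ s = Phi -> forall x, 0 < x < Phi ->
     a x * cos (om * (x - s)) - a1 x / om * sin (om * (x - s)) = 0).
  { intros s Hs x Hx. set (k := fun x => a x * cos (om * (x - s)) - a1 x / om * sin (om * (x - s))).
    assert (Hdk : forall t, 0 < t < Phi -> is_derive k t 0).
    { intros t Ht. destruct (Ha t Ht) as [H1 H2]. eapply is_derive_eq.
      - apply is_derive_Rminus.
        + apply is_derive_Rmult; [exact H1|].
          auto_derive; [exact I | reflexivity].
        + apply is_derive_Rmult.
          * apply (is_derive_ext (fun t => / om * a1 t)); [intros u; apply Rmult_comm|].
            apply is_derive_Rscal, H2.
          * auto_derive; [exact I | reflexivity].
      - cbv beta. rewrite <- Hom2. unfold Rminus. field. lra. }
    change (k x = 0). apply eq_0_of_abs_lt. intros eps He.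
    destruct (Va (eps / 2) ltac:(lra)) as [d1 [Hd1 H1]].
    destruct (scale_small (Rabs B) (eps / 2) ltac:(lra)) as [d2 [Hd2 H2]].
    destruct (common_bound d d1 Hd Hd1) as [d3 [Hd3 [A1 A2]]].
    destruct (common_bound d2 Phi Hd2 HPhi) as [d4 [Hd4 [A3 A4]]].
    destruct (common_bound d3 d4 Hd3 Hd4) as [b [Hb [A5 A6]]].
    (* At such a point [a] is below [eps / 2], and since [sin u] is at most [u] in modulus, the
       other term is at most [B b / 2]. *)
    assert (Hy : exists y, near_ends Phi d y /\ near_ends Phi d1 y /\ Rabs (y - s) <= b / 2).
    { destruct Hs as [-> | ->].
      - exists (b / 2). unfold near_ends. repeat split; try lra. rewrite Rabs_pos_eq; lra.
      - exists (Phi - b / 2). unfold near_ends. repeat split; try lra. rewrite Rabs_left; lra. }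
    destruct Hy as [y [Hy1 [Hy2 Hy3]]].
    rewrite (derive_zero_constant (fun x => 0 < x < Phi) k x y (interval_open_interval _ _) Hdk Hx);
      [|apply Hy1].
    unfold k, Rminus at 1. apply Rle_lt_trans with (1 := Rabs_triang _ _). rewrite Rabs_Ropp.
    replace eps with (eps / 2 + eps / 2) by lra. apply Rplus_lt_le_compat.
    - rewrite Rabs_mult. apply Rle_lt_trans with (Rabs (a y) * 1); [|rewrite Rmult_1_r; auto].
      apply Rmult_le_compat_l; [apply Rabs_pos | apply Rabs_le, COS_bound].
    - unfold Rdiv at 1. rewrite !Rabs_mult.
      apply Rle_trans with (Rabs (a1 y) * Rabs (/ om) * (om * (b / 2))).
      + apply Rmult_le_compat_l; [apply Rmult_le_pos; apply Rabs_pos|].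
        apply Rle_trans with (1 := abs_sin_le _). rewrite Rabs_mult, (Rabs_pos_eq om) by lra.
        apply Rmult_le_compat_l; lra.
      + rewrite (Rabs_pos_eq (/ om)) by (left; now apply Rinv_0_lt_compat).
        replace (Rabs (a1 y) * / om * (om * (b / 2))) with (Rabs (a1 y) * (b / 2)) by (field; lra).
        specialize (HB y Hy1). specialize (H2 (b / 2) ltac:(lra)).
        apply Rle_trans with (Rabs B * (b / 2)); [|lra]. apply Rmult_le_compat_r; [lra|].
        assert (H := Rle_abs B). lra. }
  assert (Hsin : sin (om * Phi) = 0).
  { assert (H1 := Hk 0 ltac:(auto) x0 Hx0). assert (H2 := Hk Phi ltac:(auto) x0 Hx0).
    rewrite Rminus_0_r in H1.
    assert (Hs : sin (om * Phi) = sin (om * x0) * cos (om * (x0 - Phi)) - cos (om * x0) * sin (om * (x0 - Phi))).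
    { rewrite <- sin_minus. f_equal. ring. }
    assert (H3 : a x0 * sin (om * Phi) = 0).
    { rewrite Hs.
      replace (a x0 * (sin (om * x0) * cos (om * (x0 - Phi)) - cos (om * x0) * sin (om * (x0 - Phi))))
        with ((a x0 * cos (om * (x0 - Phi)) - a1 x0 / om * sin (om * (x0 - Phi))) * sin (om * x0)
          - (a x0 * cos (om * x0) - a1 x0 / om * sin (om * x0)) * sin (om * (x0 - Phi))) by ring.
      rewrite H1, H2. ring. }
    apply Rmult_integral in H3. tauto. }
  apply sin_eq_0_0 in Hsin. destruct Hsin as [k Hkk].
  assert (HPI := PI_RGT_0).
  assert (Hkpos : (0 < k)%Z).
  { apply lt_IZR. assert (Hop : 0 < om * Phi) by (apply Rmult_lt_0_compat; assumption).
    destruct (Rlt_or_le 0 (IZR k)); [assumption|exfalso]. nra. }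
  exists (Z.to_nat k). split; [lia|].
  rewrite INR_IZR_INZ, Z2Nat.id by lia. rewrite <- Hkk. rewrite <- Hom2. field. lra.
Qed.

(** * Improper integrals and separation of variables *)

Lemma is_derive_RInt_open (D : R -> Prop) (g : R -> R) (x0 x : R) :
  interval D -> open D -> (forall t, D t -> continuous g t) -> D x0 -> D x ->
  is_derive (fun t => RInt g x0 t) x (g x).
Proof.
  intros HD Ho Hc Hx0 Hx. apply is_derive_RInt with x0; [|now apply Hc].
  destruct (Ho x Hx) as [d Hd]. exists d. intros y Hy. specialize (Hd y Hy).
  apply (RInt_correct (V := R_CompleteNormedModule)).
  apply (ex_RInt_continuous (V := R_CompleteNormedModule)).
  intros z Hz. apply Hc. destruct (Rle_or_lt x0 y).
  - rewrite Rmin_left, Rmax_right in Hz by lra. now apply (HD x0 z y).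
  - rewrite Rmin_right, Rmax_left in Hz by lra. now apply (HD y z x0).
Qed.

Lemma antiderivative_mono (D : R -> Prop) (g S : R -> R) (x y : R) :
  interval D -> (forall t, D t -> is_derive S t (g t)) -> (forall t, D t -> 0 <= g t) ->
  D x -> D y -> x <= y -> S x <= S y.
Proof.
  intros HD HS Hg Hx Hy Hxy. cut (0 - 0 <= S y - S x); [lra|].
  apply (derive_le (fun _ => 0) S (fun _ => 0) g); [assumption | | |]; intros t Ht.
  - apply is_derive_Rconst.
  - apply HS. now apply (HD x t y).
  - apply Hg. now apply (HD x t y).
Qed.

Lemma is_RInt_antiderivative (D : R -> Prop) (g S : R -> R) (x y : R) :
  interval D -> (forall t, D t -> is_derive S t (g t)) -> (forall t, D t -> continuous g t) ->
  D x -> D y -> is_RInt g x y (S y - S x).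
Proof.
  intros HD HS Hc Hx Hy.
  assert (Hin : forall t, Rmin x y <= t <= Rmax x y -> D t).
  { intros t Ht. destruct (Rle_or_lt x y).
    - rewrite Rmin_left, Rmax_right in Ht by lra. now apply (HD x t y).
    - rewrite Rmin_right, Rmax_left in Ht by lra. now apply (HD y t x). }
  apply (is_RInt_derive (V := R_CompleteNormedModule) S g); auto.
Qed.

Lemma ball_R (x e y : R) : ball x e y <-> Rabs (y - x) < e.
Proof. reflexivity. Qed.

(** Convergence puts the integral between any two points far enough out within 1 of its limit [L],
    so the increments of [S] are at most [L + 1]. *)
Lemma ex_RInt_gen_bound (D : R -> Prop) (g S : R -> R) (Fa Fb : (R -> Prop) -> Prop) :
  interval D -> (forall t, D t -> is_derive S t (g t)) -> (forall t, D t -> continuous g t) ->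
  ex_RInt_gen g Fa Fb ->
  exists (M : R) (A B : R -> Prop), Fa A /\ Fb B /\
    forall a b, A a -> B b -> D a -> D b -> S b - S a <= M.
Proof.
  intros HD HS Hc [L HL].
  destruct (HL (ball L 1)) as [A B HA HB HAB]; [apply (locally_ball L (mkposreal 1 Rlt_0_1))|].
  exists (L + 1), A, B. do 2 (split; [assumption|]).
  intros a b Ha Hb Hda Hdb. destruct (HAB a b Ha Hb) as [y [Hy1 Hy2]]. simpl in Hy1.
  assert (Hu := is_RInt_unique g a b y Hy1).
  assert (Hu' := is_RInt_unique g a b _ (is_RInt_antiderivative D g S a b HD HS Hc Hda Hdb)).
  apply ball_R in Hy2. apply Rabs_lt_between in Hy2.
  assert (Hy3 : S b - S a = y) by (rewrite <- Hu, <- Hu'; reflexivity). unfold minus, plus, opp in Hy2. simpl in Hy2. lra.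
Qed.

(** The antiderivative based at [PI / 2] is monotone, so its modulus at [x] is at most the integral
    over an interval containing both [x] and [PI / 2]; [a1] and [b1] are small enough for that. *)
Lemma polar_antiderivative (g : R -> R) :
  (forall x, on_sphere x -> continuous g x) -> (forall x, on_sphere x -> 0 <= g x) ->
  ex_RInt_gen g (at_right 0) (at_left PI) ->
  exists (S : R -> R) (M : R), forall x, on_sphere x -> is_derive S x (g x) /\ Rabs (S x) <= M.
Proof.
  intros Hc Hg Hex. assert (HP := PI2_3_2).
  assert (Hm : on_sphere (PI / 2)) by (unfold on_sphere; lra).
  set (S := fun x => RInt g (PI / 2) x).
  assert (HS : forall x, on_sphere x -> is_derive S x (g x)).
  { intros x Hx. now apply (is_derive_RInt_open on_sphere); [apply interval_sphere | apply open_sphere | ..]. }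
  destruct (ex_RInt_gen_bound on_sphere g S _ _ interval_sphere HS Hc Hex) as [M [A [B [HA [HB HM]]]]].
  exists S, M. intros x Hx. split; [now apply HS|].
  assert (S0 : S (PI / 2) = 0) by apply (RInt_point (V := R_CompleteNormedModule)).
  destruct HA as [da Hda]. destruct HB as [db Hdb].
  assert (Hda0 := cond_pos da). assert (Hdb0 := cond_pos db). unfold on_sphere in *.
  destruct (common_bound da x Hda0 ltac:(lra)) as [a0 [Ha0 [A1 A2]]].
  destruct (common_bound a0 (PI / 2) Ha0 ltac:(lra)) as [a1 [Ha1 [A3 A4]]].
  destruct (common_bound db (PI - x) Hdb0 ltac:(lra)) as [b0 [Hb0 [B1 B2]]].
  destruct (common_bound b0 (PI / 2) Hb0 ltac:(lra)) as [b1 [Hb1 [B3 B4]]].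
  set (a := a1 / 2). set (b := PI - b1 / 2).
  assert (Ha : 0 < a < PI) by (unfold a; lra). assert (Hb : 0 < b < PI) by (unfold b; lra).
  assert (Hab : S b - S a <= M).
  { apply HM; auto.
    - apply Hda; [|lra]. apply ball_R. rewrite Rabs_pos_eq; unfold a; lra.
    - apply Hdb; [|lra]. apply ball_R. rewrite Rabs_left; unfold b; lra. }
  assert (Hmono := antiderivative_mono on_sphere g S).
  assert (S a <= S x) by (apply Hmono; auto using interval_sphere; unfold a; lra).
  assert (S x <= S b) by (apply Hmono; auto using interval_sphere; unfold b; lra).
  assert (S a <= S (PI / 2)) by (apply Hmono; auto using interval_sphere; unfold a; lra).
  assert (S (PI / 2) <= S b) by (apply Hmono; auto using interval_sphere; unfold b; lra).
  apply Rabs_le. lra.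
Qed.

(** In the application [g] is the density of the complex function and [v] that of one component;
    comparison passes integrability on to each component. *)
Lemma radial_antiderivative (g v : R -> R) (a : R) :
  0 < a ->
  (forall x, positive x -> continuous g x) -> (forall x, positive x -> continuous v x) ->
  (forall x, positive x -> 0 <= v x <= g x) ->
  ex_RInt_gen g (at_point a) (Rbar_locally p_infty) ->
  exists (U : R -> R) (M : R), forall x, a <= x -> is_derive U x (v x) /\ Rabs (U x) <= M.
Proof.
  intros Ha Hg Hv Hvg Hex.
  assert (HS : forall h : R -> R, (forall x, positive x -> continuous h x) ->
     forall x, positive x -> is_derive (fun x => RInt h a x) x (h x)).
  { intros h Hh x Hx. apply (is_derive_RInt_open positive); auto using interval_positive, open_positive. }
  destruct (ex_RInt_gen_bound positive g _ _ _ interval_positive (HS g Hg) Hg Hex)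
    as [M [A [B [HA [[N HB] HM]]]]].
  assert (HA' : A a) by exact HA.
  assert (Z : forall h : R -> R, RInt h a a = 0) by (intros h; apply (RInt_point (V := R_CompleteNormedModule))).
  exists (fun x => RInt v a x), M. intros x Hx. split; [apply HS; auto; unfold positive; lra|].
  set (b := Rmax x (N + 1)). assert (Hb : x <= b) by apply Rmax_l. assert (Hb' : N + 1 <= b) by apply Rmax_r.
  specialize (HM a b HA' (HB b ltac:(lra)) ltac:(unfold positive; lra) ltac:(unfold positive; lra)).
  cbv beta in HM. rewrite Z in HM.
  assert (H1 : RInt g a x <= RInt g a b).
  { apply (antiderivative_mono positive g (fun x => RInt g a x)); auto using interval_positive; try (unfold positive; lra).
    intros t Ht. specialize (Hvg t Ht). lra. }
  assert (H2 : RInt v a a <= RInt v a x).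
  { apply (antiderivative_mono positive v (fun x => RInt v a x)); auto using interval_positive; try (unfold positive; lra).
    intros t Ht. specialize (Hvg t Ht). lra. }
  assert (H3 : RInt v a x - RInt v a a <= RInt g a x - RInt g a a).
  { apply (derive_le (fun x => RInt v a x) (fun x => RInt g a x) v g); [assumption | | |]; intros t Ht.
    - apply HS; auto; unfold positive; lra.
    - apply HS; auto; unfold positive; lra.
    - apply Hvg; unfold positive; lra. }
  rewrite Z in H2. rewrite !Z in H3. apply Rabs_le. lra.
Qed.

(** * Complex derivatives and separation of variables *)

Lemma is_derive_Re (f : R -> C) (x : R) :
  ex_CDerive f x -> is_derive (fun t => Re (f t)) x (Re (CDerive f x)).
Proof. intros [H _]. now apply Derive_correct. Qed.

Lemma is_derive_Im (f : R -> C) (x : R) :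
  ex_CDerive f x -> is_derive (fun t => Im (f t)) x (Im (CDerive f x)).
Proof. intros [_ H]. now apply Derive_correct. Qed.

Lemma CDerive_of_components (f : R -> C) (x a b : R) :
  is_derive (fun t => Re (f t)) x a -> is_derive (fun t => Im (f t)) x b ->
  ex_CDerive f x /\ CDerive f x = (a, b).
Proof.
  intros Ha Hb. split; [split; eexists; eassumption|].
  apply injective_projections; simpl; now apply is_derive_unique.
Qed.

Lemma CDerive_ext_on (D : R -> Prop) (f g : R -> C) (x : R) :
  open D -> D x -> (forall t, D t -> f t = g t) -> CDerive f x = CDerive g x.
Proof.
  intros HD Hx He. unfold CDerive. f_equal; apply Derive_ext_loc;
    destruct (HD x Hx) as [d Hd]; exists d; intros y Hy; now rewrite (He y (Hd y Hy)).
Qed.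

Lemma CDerive_mult_const (f : R -> C) (k : C) (x : R) :
  ex_CDerive f x -> CDerive (fun t => (f t * k)%C) x = (CDerive f x * k)%C.
Proof.
  intros H. assert (Ha := is_derive_Re f x H). assert (Hb := is_derive_Im f x H).
  apply (CDerive_of_components (fun t => (f t * k)%C) x).
  - apply (is_derive_ext (fun t => Re k * Re (f t) - Im k * Im (f t))).
    { intros t. simpl. unfold Re, Im. ring. }
    eapply is_derive_eq; [apply is_derive_Rminus; apply is_derive_Rscal; eassumption|].
    unfold Re, Im. ring.
  - apply (is_derive_ext (fun t => Im k * Re (f t) + Re k * Im (f t))).
    { intros t. simpl. unfold Re, Im. ring. }
    eapply is_derive_eq; [apply is_derive_Rplus; apply is_derive_Rscal; eassumption|].
    unfold Re, Im. ring.
Qed.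

Lemma CDerive_weighted (wgt : R -> R) (f : R -> C) (x dw : R) :
  is_derive wgt x dw -> ex_CDerive f x ->
  ex_CDerive (fun s => (RtoC (wgt s) * f s)%C) x /\
  CDerive (fun s => (RtoC (wgt s) * f s)%C) x
  = (RtoC dw * f x + RtoC (wgt x) * CDerive f x)%C.
Proof.
  intros Hw Hf. assert (Ha := is_derive_Re f x Hf). assert (Hb := is_derive_Im f x Hf).
  apply CDerive_of_components.
  - apply (is_derive_ext (fun t => wgt t * Re (f t))).
    { intros t. simpl. unfold Re, Im. ring. }
    eapply is_derive_eq; [apply is_derive_Rmult; eassumption|].
    simpl. unfold Re, Im. ring.
  - apply (is_derive_ext (fun t => wgt t * Im (f t))).
    { intros t. simpl. unfold Re, Im. ring. }
    eapply is_derive_eq; [apply is_derive_Rmult; eassumption|].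
    simpl. unfold Re, Im. ring.
Qed.

Lemma CDerive_weighted_mult_const (D : R -> Prop) (wgt dw : R -> R) (f : R -> C) (k : C) (x : R) :
  open D -> (forall t, D t -> is_derive wgt t (dw t)) -> twice_differentiable_on D f -> D x ->
  CDerive (fun s => (RtoC (wgt s) * CDerive (fun t => f t * k) s)%C) x
  = (CDerive (fun s => (RtoC (wgt s) * CDerive f s)%C) x * k)%C.
Proof.
  intros HD Hw Hf Hx.
  rewrite <- CDerive_mult_const.
  - apply (CDerive_ext_on D); auto. intros t Ht. rewrite CDerive_mult_const by apply Hf, Ht. ring.
  - apply (CDerive_weighted wgt (CDerive f) x (dw x)); [auto | apply Hf, Hx].
Qed.

Lemma CDerive2_mult_const (D : R -> Prop) (f : R -> C) (k : C) (x : R) :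
  open D -> twice_differentiable_on D f -> D x ->
  CDerive (CDerive (fun t => (f t * k)%C)) x = (CDerive (CDerive f) x * k)%C.
Proof.
  intros HD Hf Hx. rewrite <- CDerive_mult_const by apply Hf, Hx.
  apply (CDerive_ext_on D); auto. intros t Ht. apply CDerive_mult_const, Hf, Ht.
Qed.

Lemma is_derive_sqr (t : R) : is_derive (fun s => s ^ 2) t (2 * t).
Proof. auto_derive; [exact I | ring]. Qed.

(** For each partial derivative the other two factors form a complex constant, which can be pulled
    out of both differentiations. *)
Lemma laplacian_separated (Phi : R) (Rad Th F : R -> C) (r theta phi : R) :
  twice_differentiable_on (fun r => 0 < r) Rad ->
  twice_differentiable_on (fun theta => 0 < theta < PI) Th ->
  twice_differentiable_on (fun phi => 0 < phi < Phi) F ->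
  in_wedge Phi r theta phi ->
  (spherical_laplacian (separated Rad Th F) r theta phi
   = RtoC (/ r ^ 2) * CDerive (fun s => RtoC (s ^ 2) * CDerive Rad s) r * (Th theta * F phi)
   + RtoC (/ (r ^ 2 * sin theta)) * CDerive (fun s => RtoC (sin s) * CDerive Th s) theta
       * (Rad r * F phi)
   + RtoC (/ (r ^ 2 * sin theta ^ 2)) * CDerive (CDerive F) phi * (Rad r * Th theta))%C.
Proof.
  intros HR HT HF [Hr [Hth Hphi]]. unfold spherical_laplacian.
  f_equal; [f_equal|].
  - rewrite <- Cmult_assoc. f_equal.
    rewrite <- (CDerive_weighted_mult_const positive (fun s => s ^ 2) (fun s => 2 * s)).
    + apply (CDerive_ext_on positive); [apply open_positive | exact Hr|]. intros s Hs. f_equal.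
      apply (CDerive_ext_on positive); [apply open_positive | exact Hs|]. intros t Ht.
      unfold separated. ring.
    + apply open_positive.
    + intros; apply is_derive_sqr.
    + exact HR.
    + exact Hr.
  - rewrite <- Cmult_assoc. f_equal.
    rewrite <- (CDerive_weighted_mult_const on_sphere sin cos).
    + apply (CDerive_ext_on on_sphere); [apply open_sphere | exact Hth|]. intros s Hs. f_equal.
      apply (CDerive_ext_on on_sphere); [apply open_sphere | exact Hs|]. intros t Ht.
      unfold separated. ring.
    + apply open_sphere.
    + intros; apply is_derive_sin.
    + exact HT.
    + exact Hth.
  - rewrite <- Cmult_assoc. f_equal.
    rewrite <- (CDerive2_mult_const (fun phi => 0 < phi < Phi)).
    + apply (CDerive_ext_on (fun phi => 0 < phi < Phi)); [apply open_open_interval | exact Hphi|].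
      intros s Hs.
      apply (CDerive_ext_on (fun phi => 0 < phi < Phi)); [apply open_open_interval | exact Hs|].
      intros t Ht. unfold separated. ring.
    + apply open_open_interval.
    + exact HF.
    + exact Hphi.
Qed.

Lemma Cmult_neq_0_inv (a b : C) : (a * b)%C <> RtoC 0 -> a <> RtoC 0 /\ b <> RtoC 0.
Proof. intros H. split; intros H0; apply H; rewrite H0; ring. Qed.

Lemma RtoC_neq_0 (x : R) : x <> 0 -> RtoC x <> RtoC 0.
Proof. intros H H0. apply H. now apply RtoC_inj. Qed.

Lemma Clinear_solve (A x B : C) : A <> RtoC 0 -> (A * x = B)%C -> x = (B / A)%C.
Proof. intros HA H. rewrite <- H. field. assumption. Qed.

Lemma separation (K E Phi r0 th0 ph0 : R) (V : R -> R) (Rad Th F : R -> C) :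
  K <> 0 ->
  twice_differentiable_on (fun r => 0 < r) Rad ->
  twice_differentiable_on (fun theta => 0 < theta < PI) Th ->
  twice_differentiable_on (fun phi => 0 < phi < Phi) F ->
  in_wedge Phi r0 th0 ph0 ->
  Rad r0 <> RtoC 0 -> Th th0 <> RtoC 0 -> F ph0 <> RtoC 0 ->
  (forall r theta phi, in_wedge Phi r theta phi ->
    (RtoC K * spherical_laplacian (separated Rad Th F) r theta phi
     + RtoC (V r) * separated Rad Th F r theta phi
     = RtoC E * separated Rad Th F r theta phi)%C) ->
  exists M lam : C,
    (forall phi, 0 < phi < Phi -> CDerive (CDerive F) phi = (- M * F phi)%C) /\
    (forall theta, 0 < theta < PI ->
      (RtoC (/ sin theta) * CDerive (fun s => RtoC (sin s) * CDerive Th s) theta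
       + (lam - M * RtoC (/ sin theta ^ 2)) * Th theta = RtoC 0)%C) /\
    (forall r, 0 < r ->
      (RtoC K * (RtoC (/ r ^ 2) * CDerive (fun s => RtoC (s ^ 2) * CDerive Rad s) r)
       - lam * RtoC K * RtoC (/ r ^ 2) * Rad r + RtoC (V r) * Rad r = RtoC E * Rad r)%C).
Proof.
  intros HK HR HT HF Hw0 HR0 HT0 HF0 Hs.
  assert (Hs' : forall r theta phi, in_wedge Phi r theta phi ->
    (RtoC K * RtoC (/ (r ^ 2 * sin theta ^ 2)) * (Rad r * Th theta) * CDerive (CDerive F) phi
     + RtoC K * RtoC (/ (r ^ 2 * sin theta)) * (Rad r * F phi)
        * CDerive (fun s => RtoC (sin s) * CDerive Th s) theta
     + RtoC K * RtoC (/ r ^ 2) * (Th theta * F phi)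
        * CDerive (fun s => RtoC (s ^ 2) * CDerive Rad s) r
     + (RtoC (V r) - RtoC E) * (Rad r * Th theta * F phi) = RtoC 0)%C).
  { intros r th ph Hw. specialize (Hs r th ph Hw).
    rewrite (laplacian_separated Phi) in Hs by assumption. unfold separated in Hs.
    match type of Hs with ?l = ?r => assert (Hlr : (l - r = RtoC 0)%C) by (rewrite Hs; ring) end.
    rewrite <- Hlr. ring. }
  clear Hs. destruct Hw0 as [Hr0 [Hth0 Hph0]].
  assert (Hsin : forall t, 0 < t < PI -> 0 < sin t) by (intros t Ht; apply sin_gt_0; lra).
  assert (HKc : RtoC K <> RtoC 0) by now apply RtoC_neq_0.
  set (LR := CDerive (fun s => (RtoC (s ^ 2) * CDerive Rad s)%C)) in *.
  set (LT := CDerive (fun s => (RtoC (sin s) * CDerive Th s)%C)) in *.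
  set (F2 := CDerive (CDerive F)) in *.
  assert (Hr2 : forall r, 0 < r -> RtoC (/ r ^ 2) <> RtoC 0).
  { intros r Hr. apply RtoC_neq_0, Rinv_neq_0_compat, pow_nonzero. lra. }
  assert (Hsp : forall r t, 0 < r -> 0 < t < PI ->
    RtoC (/ (r ^ 2 * sin t)) = (RtoC (/ r ^ 2) * RtoC (/ sin t))%C /\
    RtoC (/ (r ^ 2 * sin t ^ 2)) = (RtoC (/ r ^ 2) * RtoC (/ sin t ^ 2))%C).
  { intros r t Hr Ht. specialize (Hsin t Ht). rewrite <- !RtoC_mult. split; f_equal; field; lra. }
  assert (Hst : forall t, 0 < t < PI -> RtoC (/ sin t ^ 2) <> RtoC 0).
  { intros t Ht. specialize (Hsin t Ht). apply RtoC_neq_0, Rinv_neq_0_compat, pow_nonzero. lra. }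
  (* With [r0] and [th0] frozen the equation becomes [A F'' + B F = 0]. *)
  assert (HMex : exists M, forall phi, 0 < phi < Phi -> F2 phi = (- M * F phi)%C).
  { destruct (Hsp r0 th0 Hr0 Hth0) as [E1 E2].
    set (A := (RtoC K * RtoC (/ (r0 ^ 2 * sin th0 ^ 2)) * (Rad r0 * Th th0))%C).
    assert (HA : A <> RtoC 0).
    { unfold A. rewrite E2. repeat apply Cmult_neq_0; auto. }
    set (B := (RtoC K * RtoC (/ (r0 ^ 2 * sin th0)) * Rad r0 * LT th0
       + RtoC K * RtoC (/ r0 ^ 2) * Th th0 * LR r0 + (RtoC (V r0) - RtoC E) * (Rad r0 * Th th0))%C).
    exists (B / A)%C. intros phi Hphi.
    assert (H := Hs' r0 th0 phi (conj Hr0 (conj Hth0 Hphi))).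
    rewrite (Clinear_solve A (F2 phi) (- B * F phi)%C HA).
    - field. assumption.
    - replace (A * F2 phi)%C with
        ((A * F2 phi + B * F phi) - B * F phi)%C by ring.
      replace (A * F2 phi + B * F phi)%C with (RtoC 0); [ring|].
      rewrite <- H. unfold A, B. ring. }
  destruct HMex as [M HM]. exists M.
  assert (Hlex : exists lam, forall theta, 0 < theta < PI ->
     (RtoC (/ sin theta) * LT theta + (lam - M * RtoC (/ sin theta ^ 2)) * Th theta = RtoC 0)%C).
  { set (A := (RtoC K * RtoC (/ r0 ^ 2) * Rad r0 * F ph0)%C).
    assert (HA : A <> RtoC 0) by (unfold A; repeat apply Cmult_neq_0; auto).
    set (B := (RtoC K * RtoC (/ r0 ^ 2) * F ph0 * LR r0 + (RtoC (V r0) - RtoC E) * (Rad r0 * F ph0))%C).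
    exists (B / A)%C. intros t Ht.
    assert (H := Hs' r0 t ph0 (conj Hr0 (conj Ht Hph0))).
    destruct (Hsp r0 t Hr0 Ht) as [E1 E2]. rewrite E1, E2, (HM ph0 Hph0) in H.
    assert (Hx : (A * (RtoC (/ sin t) * LT t + (B / A - M * RtoC (/ sin t ^ 2)) * Th t) = RtoC 0)%C).
    { replace (A * (RtoC (/ sin t) * LT t + (B / A - M * RtoC (/ sin t ^ 2)) * Th t))%C
        with (A * (RtoC (/ sin t) * LT t - M * RtoC (/ sin t ^ 2) * Th t) + B * Th t)%C
        by (field; assumption).
      rewrite <- H. unfold A, B. ring. }
    rewrite (Clinear_solve A _ _ HA Hx). field. assumption. }
  destruct Hlex as [lam Hlam]. exists lam. split; [exact HM|]. split; [exact Hlam|].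
  intros r Hr.
  assert (H := Hs' r th0 ph0 (conj Hr (conj Hth0 Hph0))).
  destruct (Hsp r th0 Hr Hth0) as [E1 E2]. rewrite E1, E2, (HM ph0 Hph0) in H.
  specialize (Hlam th0 Hth0).
  set (A := (Th th0 * F ph0)%C). assert (HA : A <> RtoC 0) by (unfold A; now apply Cmult_neq_0).
  set (X := (RtoC K * (RtoC (/ r ^ 2) * LR r) - lam * RtoC K * RtoC (/ r ^ 2) * Rad r
     + RtoC (V r) * Rad r - RtoC E * Rad r)%C).
  assert (HX : (A * X = RtoC 0)%C).
  { assert (Hlt : (RtoC (/ sin th0) * LT th0 = - (lam - M * RtoC (/ sin th0 ^ 2)) * Th th0)%C).
    { replace (RtoC (/ sin th0) * LT th0)%C with
       ((RtoC (/ sin th0) * LT th0 + (lam - M * RtoC (/ sin th0 ^ 2)) * Th th0)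
        - (lam - M * RtoC (/ sin th0 ^ 2)) * Th th0)%C by ring.
      rewrite Hlam. ring. }
    rewrite <- H.
    replace (RtoC K * (RtoC (/ r ^ 2) * RtoC (/ sin th0)) * (Rad r * F ph0) * LT th0)%C
      with (RtoC K * RtoC (/ r ^ 2) * (Rad r * F ph0) * (RtoC (/ sin th0) * LT th0))%C by ring.
    rewrite Hlt. unfold A, X. ring. }
  apply (Clinear_solve A X _ HA) in HX.
  assert (HX0 : X = RtoC 0) by (rewrite HX; field; assumption).
  replace (RtoC K * (RtoC (/ r ^ 2) * LR r) - lam * RtoC K * RtoC (/ r ^ 2) * Rad r
     + RtoC (V r) * Rad r)%C with (X + RtoC E * Rad r)%C by (unfold X; ring).
  rewrite HX0. ring.
Qed.

(** * From bound states to quantum numbers *)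

Lemma filterlim_scaled_0 (Flt : (R -> Prop) -> Prop) (HF : Filter Flt) (f : R -> C) (k : C) :
  k <> RtoC 0 -> filterlim (fun x => (f x * k)%C) Flt (locally (RtoC 0)) ->
  forall eps, 0 < eps -> Flt (fun x => Rabs (Re (f x)) < eps /\ Rabs (Im (f x)) < eps).
Proof.
  intros Hk Hl eps He.
  assert (Hkp : 0 < Cmod k) by now apply Cmod_gt_0.
  set (q := eps * Cmod k / 2).
  assert (Hq : 0 < q) by (unfold q; assert (0 < eps * Cmod k) by (apply Rmult_lt_0_compat; assumption); lra).
  assert (Hq2 : q + q = eps * Cmod k) by (unfold q; field).
  assert (Hb := proj1 (filterlim_locally (U := C_UniformSpace) _ _) Hl (mkposreal q Hq)).
  apply (filter_imp _ _) with (2 := Hb). intros x [H1 H2].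
  change (Rabs (Re (f x * k)%C - 0) < q) in H1.
  change (Rabs (Im (f x * k)%C - 0) < q) in H2. rewrite Rminus_0_r in H1, H2.
  assert (Hf : Cmod (f x) < eps).
  { apply Rmult_lt_reg_r with (Cmod k); [assumption|]. rewrite <- Cmod_mult.
    apply Rle_lt_trans with (Rabs (Re (f x * k)%C) + Rabs (Im (f x * k)%C)); [|lra].
    set (u := Rabs (Re (f x * k)%C)) in *. set (v := Rabs (Im (f x * k)%C)) in *.
    assert (Hu : 0 <= u) by apply Rabs_pos. assert (Hv : 0 <= v) by apply Rabs_pos.
    rewrite <- (sqrt_pow2 (u + v)) by lra. apply sqrt_le_1_alt.
    change (Re (f x * k)%C ^ 2 + Im (f x * k)%C ^ 2 <= (u + v) ^ 2).
    rewrite <- (pow2_abs (Re _)), <- (pow2_abs (Im _)). fold u v. nra. }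
  assert (Hm := Rmax_Cmod (f x)). split.
  - apply Rle_lt_trans with (2 := Hf), Rle_trans with (2 := Hm), Rmax_l.
  - apply Rle_lt_trans with (2 := Hf), Rle_trans with (2 := Hm), Rmax_r.
Qed.

Lemma vanishing_of_barriers (Phi : R) (F : R -> C) (k : C) :
  0 < Phi -> k <> RtoC 0 ->
  continuous_on (fun phi => 0 <= phi <= Phi) (fun phi => (k * F phi)%C) ->
  (k * F 0)%C = RtoC 0 -> (k * F Phi)%C = RtoC 0 ->
  vanishing_ends Phi (fun x => Re (F x)) /\ vanishing_ends Phi (fun x => Im (F x)) /\
  F 0 = RtoC 0 /\ F Phi = RtoC 0.
Proof.
  intros HPhi Hk Hc H0 H1.
  assert (G : forall s, 0 <= s <= Phi -> (k * F s)%C = RtoC 0 -> forall eps, 0 < eps ->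
    exists d, 0 < d /\ forall x, 0 < x < Phi -> Rabs (x - s) < d ->
      Rabs (Re (F x)) < eps /\ Rabs (Im (F x)) < eps).
  { intros s Hs Hks eps He.
    assert (Hc' : filterlim (fun x => (F x * k)%C) (within (fun phi => 0 <= phi <= Phi) (locally s))
       (locally (RtoC 0))).
    { rewrite <- Hks. apply filterlim_ext with (2 := Hc s Hs). intros x. apply Cmult_comm. }
    destruct (filterlim_scaled_0 _ _ F k Hk Hc' eps He) as [d Hd].
    exists d. split; [apply cond_pos|]. intros x Hx Hxs. apply Hd; [exact Hxs | lra]. }
  assert (G' : forall eps, 0 < eps -> exists d, 0 < d /\ forall x, near_ends Phi d x ->
     Rabs (Re (F x)) < eps /\ Rabs (Im (F x)) < eps).
  { intros eps He. destruct (G 0 ltac:(lra) H0 eps He) as [d1 [Hd1 G1]].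
    destruct (G Phi ltac:(lra) H1 eps He) as [d2 [Hd2 G2]].
    destruct (common_bound d1 d2 Hd1 Hd2) as [d [Hd [A1 A2]]].
    exists d. split; [assumption|].
    intros x [Hx [Hx1 | Hx1]].
    - apply G1; [assumption|]. rewrite Rabs_pos_eq; lra.
    - apply G2; [assumption|]. rewrite Rabs_left; lra. }
  split; [|split; [|split]].
  - intros eps He. destruct (G' eps He) as [d [Hd H]]. exists d. split; [assumption|]. intros x Hx. apply H, Hx.
  - intros eps He. destruct (G' eps He) as [d [Hd H]]. exists d. split; [assumption|]. intros x Hx. apply H, Hx.
  - rewrite (Clinear_solve k _ _ Hk H0). field. assumption.
  - rewrite (Clinear_solve k _ _ Hk H1). field. assumption.
Qed.

Lemma azimuthal_number (Phi : R) (M : C) (F : R -> C) :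
  0 < Phi ->
  twice_differentiable_on (fun phi => 0 < phi < Phi) F ->
  (forall phi, 0 < phi < Phi -> CDerive (CDerive F) phi = (- M * F phi)%C) ->
  vanishing_ends Phi (fun x => Re (F x)) -> vanishing_ends Phi (fun x => Im (F x)) ->
  (exists phi, 0 < phi < Phi /\ F phi <> RtoC 0) ->
  exists n : nat, (1 <= n)%nat /\ M = RtoC (effective_azimuthal_number Phi n ^ 2).
Proof.
  intros HPhi HF Heq Va Vb [x0 [Hx0 Hne]].
  set (p := Re M). set (q := Im M).
  assert (Ha : azimuthal_system Phi (fun x => Re (F x)) (fun x => Re (CDerive F x))
     (fun x => p * Re (F x) + - q * Im (F x))).
  { intros x Hx. destruct (HF x Hx) as [H1 H2]. split; [exact (is_derive_Re F x H1)|].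
    eapply is_derive_eq; [exact (is_derive_Re _ x H2)|].
    rewrite (Heq x Hx). unfold p, q, Re, Im; simpl. ring. }
  assert (Hb : azimuthal_system Phi (fun x => Im (F x)) (fun x => Im (CDerive F x))
     (fun x => p * Im (F x) + q * Re (F x))).
  { intros x Hx. destruct (HF x Hx) as [H1 H2]. split; [exact (is_derive_Im F x H1)|].
    eapply is_derive_eq; [exact (is_derive_Im _ x H2)|].
    rewrite (Heq x Hx). unfold p, q, Re, Im; simpl. ring. }
  assert (Hne' : Re (F x0) <> 0 \/ Im (F x0) <> 0).
  { apply NNPP. intros H. apply Hne. apply injective_projections; apply NNPP; intros H'; apply H; auto. }
  assert (Hq : q = 0) by (apply (azimuthal_real Phi p q _ _ _ _ HPhi Ha Hb Va Vb); eauto).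
  assert (Hp : exists n : nat, (1 <= n)%nat /\ p = (INR n * PI / Phi) ^ 2).
  { destruct Hne' as [H | H].
    - apply (azimuthal_spectrum Phi p _ (fun x => Re (CDerive F x)) HPhi) with (2 := Va); eauto.
      eapply azimuthal_system_ext; [|exact Ha]. intros x. cbv beta. rewrite Hq. ring.
    - apply (azimuthal_spectrum Phi p _ (fun x => Im (CDerive F x)) HPhi) with (2 := Vb); eauto.
      eapply azimuthal_system_ext; [|exact Hb]. intros x. cbv beta. rewrite Hq. ring. }
  destruct Hp as [n [Hn Hp]]. exists n. split; [assumption|].
  apply injective_projections; simpl; [exact Hp | exact Hq].
Qed.

(** [mu cot] solves the Riccati equation belonging to [lam = mu (mu + 1)], so subtracting [mu cot a]
    from the derivative absorbs the singular potential, by [1 / sin^2 = 1 + cot^2]. *)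
Lemma polar_system_of_equation (mu : R) (a a1 a2 f : R -> R) :
  (forall x, on_sphere x -> is_derive a x (a1 x)) ->
  (forall x, on_sphere x -> is_derive a1 x (a2 x)) ->
  (forall x, on_sphere x -> / sin x * (cos x * a1 x + sin x * a2 x) + f x - mu ^ 2 / sin x ^ 2 * a x = 0) ->
  polar_system mu a (fun x => a1 x - mu * (cot x * a x)) (fun x => f x - mu * (mu + 1) * a x).
Proof.
  intros H1 H2 He x Hx. specialize (H1 x Hx). specialize (H2 x Hx). specialize (He x Hx).
  assert (Hs := sin_gt_0 x (proj1 Hx) (proj2 Hx)). split.
  - eapply is_derive_eq; [exact H1|]. ring.
  - eapply is_derive_eq.
    + apply is_derive_Rminus; [exact H2|]. apply is_derive_Rscal, is_derive_Rmult; [|exact H1].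
      now apply is_derive_cot.
    + assert (Ha2 : a2 x = mu ^ 2 * (/ sin x ^ 2) * a x - f x - cot x * a1 x).
      { unfold cot.
        replace (a2 x) with (/ sin x * (cos x * a1 x + sin x * a2 x) - cos x / sin x * a1 x) by (field; lra).
        unfold Rdiv in He. lra. }
      assert (Hc : / sin x ^ 2 = 1 + cot x ^ 2).
      { assert (H := sin2_cos2 x). unfold Rsqr in H. unfold cot.
        replace (1 + (cos x / sin x) ^ 2) with ((sin x * sin x + cos x * cos x) / sin x ^ 2) by (field; lra).
        rewrite H. unfold Rdiv. ring. }
      rewrite Ha2, Hc. ring.
Qed.

(** Otherwise the modulus of [y] would be at least [eps x^(-mu) >= eps / x] near the pole, and
    [sin x * y^2] would dominate [c / x] with [c = eps^2 / 2], whose integral diverges. This is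
    where [1 <= mu] enters. *)
Lemma polar_square_integrable_small (mu d M : R) (y Y S : R -> R) :
  1 <= mu -> 0 < d <= 1 ->
  (forall x, 0 < x < d -> is_derive S x (sin x * Y x)) ->
  (forall x, 0 < x < d -> Rabs (S x) <= M) ->
  (forall x, 0 < x < d -> y x ^ 2 <= Y x) ->
  small_left (fun x => 0 < x < d) (fun x => y x * Rpower x mu).
Proof.
  intros Hmu Hd HS HM HY eps He b Hb. apply NNPP. intros Hn. assert (HP := PI2_3_2).
  assert (Hge : forall x, 0 < x < b -> eps <= Rabs (y x) * Rpower x mu).
  { intros x Hx. destruct (Rle_or_lt eps (Rabs (y x) * Rpower x mu)) as [|Hlt]; [assumption|].
    exfalso. apply Hn. exists x. split; [lra|]. split; [lra|].
    rewrite Rabs_mult, (Rabs_pos_eq (Rpower _ _)); [assumption | apply Rpower_ge_0]. }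
  set (c := eps ^ 2 / 2). assert (Hc : 0 < c) by (unfold c; assert (0 < eps ^ 2) by (apply pow_lt; lra); lra).
  set (t := b / 2). assert (Ht : 0 < t < b) by (unfold t; lra).
  (* Chosen so that [c (ln t - ln x)] equals [2 M + 1], more than [S] can increase. *)
  set (x := t * exp (- ((2 * M + 1) / c))).
  assert (HM0 : 0 <= M) by (apply Rle_trans with (2 := HM t ltac:(lra)); apply Rabs_pos).
  assert (Hq : 0 < (2 * M + 1) / c) by (apply Rdiv_lt_0_compat; lra).
  assert (Hx : 0 < x < t).
  { unfold x. split; [apply Rmult_lt_0_compat; [lra | apply exp_pos]|].
    rewrite <- (Rmult_1_r t) at 2. apply Rmult_lt_compat_l; [lra|].
    apply Rlt_le_trans with (exp 0); [apply exp_increasing; lra | rewrite exp_0; lra]. }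
  assert (H : c * ln t - c * ln x <= S t - S x).
  { apply (derive_le (fun x => c * ln x) S (fun x => c * / x) (fun x => sin x * Y x)); [lra | | |]; intros z Hz.
    - auto_derive; [lra | field; lra].
    - apply HS; lra.
    - specialize (Hge z ltac:(lra)). specialize (HY z ltac:(lra)).
      assert (Hs := sin_ge_half z ltac:(lra)).
      assert (Hp : Rpower z mu <= z).
      { rewrite <- (Rpower_1 z) at 2 by lra. apply Rpower_le_exponent; lra. }
      assert (Hyz : eps <= Rabs (y z) * z).
      { apply Rle_trans with (1 := Hge). apply Rmult_le_compat_l; [apply Rabs_pos | assumption]. }
      assert (Hyz2 : eps ^ 2 <= y z ^ 2 * z ^ 2).
      { rewrite <- (pow2_abs (y z)), <- Rpow_mult_distr. apply pow_incr. lra. }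
      apply Rmult_le_reg_r with z; [lra|]. rewrite Rmult_assoc, Rinv_l, Rmult_1_r by lra.
      unfold c. apply Rle_trans with (z / 2 * y z ^ 2 * z).
      + replace (z / 2 * y z ^ 2 * z) with (y z ^ 2 * z ^ 2 / 2) by field. lra.
      + apply Rmult_le_compat_r; [lra|]. apply Rmult_le_compat; try lra. apply pow2_ge_0. }
  assert (Hln : c * ln t - c * ln x = 2 * M + 1).
  { unfold x. rewrite ln_mult by (auto using exp_pos; lra). rewrite ln_exp. field. lra. }
  assert (H1 := HM t ltac:(lra)). assert (H2 := HM x ltac:(lra)).
  apply Rabs_le_between in H1. apply Rabs_le_between in H2. lra.
Qed.

Definition vanishing_at_0 (y : R -> R) : Prop :=
  forall eps, 0 < eps -> exists d, 0 < d /\ forall x, 0 < x < d -> Rabs (y x) < eps.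

Lemma polar_vanishing_small (mu d : R) (y : R -> R) :
  0 <= mu -> 0 < d <= 1 -> vanishing_at_0 y ->
  small_left (fun x => 0 < x < d) (fun x => y x * Rpower x mu).
Proof.
  intros Hmu Hd H. apply small_left_of_vanishing; [apply initial_interval|].
  intros eps He. destruct (H eps He) as [d0 [Hd0 H0]]. exists d0. split; [assumption|].
  intros x Hx Hxd. specialize (H0 x ltac:(lra)). rewrite Rabs_mult, Rabs_Rpower.
  assert (H1 := Rpower_le_1 x mu ltac:(lra) Hmu). assert (H2 := Rpower_pos x mu).
  assert (H3 := Rabs_pos (y x)). nra.
Qed.

(** [z] is the other component of the complex solution, coupled through [q]. The common density
    [y^2 + z^2] controls the forcing, because [(p y + q z)^2 + (p y - q z)^2 = 2 p^2 y^2 + 2 q^2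
    z^2]. *)
Lemma polar_regular_end (mu p q M : R) (y z w S : R -> R) :
  0 < mu -> (1 <= mu \/ vanishing_at_0 y) ->
  polar_system mu y w (fun x => p * y x + q * z x) ->
  (forall x, on_sphere x -> is_derive S x (sin x * (y x ^ 2 + z x ^ 2)) /\ Rabs (S x) <= M) ->
  bounded_at_0 y.
Proof.
  intros Hmu Hor Hsys HS. assert (HP := PI2_3_2).
  assert (HS' : forall x, 0 < x < 1 ->
    is_derive S x (sin x * (y x ^ 2 + z x ^ 2)) /\ Rabs (S x) <= M).
  { intros x Hx. apply HS. unfold on_sphere. lra. }
  apply (polar_square_integrable_end mu 1 (2 * p ^ 2 + 2 * q ^ 2) M y w _ (fun x => y x ^ 2 + z x ^ 2) S
     Hmu ltac:(lra) Hsys); try (intros x Hx; now apply HS').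
  - destruct Hor as [Hor | Hor]; [|apply polar_vanishing_small; auto; lra].
    apply (polar_square_integrable_small mu 1 M y (fun x => y x ^ 2 + z x ^ 2) S);
      auto; try lra; try (intros x Hx; now apply HS').
    intros x Hx. assert (A := pow2_ge_0 (z x)). lra.
  - intros x Hx. assert (H1 := Rle_0_sqr (p * z x)). assert (H2 := Rle_0_sqr (q * y x)).
    assert (H3 := Rle_0_sqr (p * y x - q * z x)). unfold Rsqr in *. simpl. lra.
  - intros x Hx. apply Rplus_le_le_0_compat; apply pow2_ge_0.
  - assert (A1 := pow2_ge_0 p). assert (A2 := pow2_ge_0 q). lra.
Qed.

Lemma polar_regular_ends (mu p q M : R) (y z w S : R -> R) :
  0 < mu -> (1 <= mu \/ both_ends vanishing_at_0 y) ->
  polar_system mu y w (fun x => p * y x + q * z x) ->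
  (forall x, on_sphere x -> is_derive S x (sin x * (y x ^ 2 + z x ^ 2)) /\ Rabs (S x) <= M) ->
  both_ends bounded_at_0 y.
Proof.
  intros Hmu Hor Hsys HS. split.
  - apply (polar_regular_end mu p q M y z w S); auto. destruct Hor as [|[H _]]; auto.
  - apply (polar_regular_end mu p q M (fun x => y (PI - x)) (fun x => z (PI - x))
      (fun x => - w (PI - x)) (fun x => - S (PI - x))); auto.
    + destruct Hor as [|[_ H]]; auto.
    + exact (polar_reflect mu y w _ Hsys).
    + intros x Hx. destruct (HS (PI - x)) as [H1 H2]; [unfold on_sphere in *; lra|].
      split; [|now rewrite Rabs_Ropp].
      eapply is_derive_eq; [apply is_derive_Ropp, is_derive_reflect; exact H1|].
      rewrite Rtrigo_facts.sin_pi_minus. ring.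
Qed.

(** The order is essential: regularity at both poles is proved for the coupled components, the
    Wronskian then gives [q = 0], and only after this decoupling can the ladder run, on a component
    that is not identically zero. *)
Lemma polar_number_exists (mu : R) (lam : C) (Th : R -> C) :
  0 < mu ->
  twice_differentiable_on (fun theta => 0 < theta < PI) Th ->
  (forall theta, 0 < theta < PI ->
      (RtoC (/ sin theta) * CDerive (fun s => RtoC (sin s) * CDerive Th s) theta
       + (lam - RtoC (mu ^ 2) * RtoC (/ sin theta ^ 2)) * Th theta = RtoC 0)%C) ->
  polar_square_integrable Th ->
  (1 <= mu \/ (both_ends vanishing_at_0 (fun x => Re (Th x)) /\ both_ends vanishing_at_0 (fun x => Im (Th x)))) ->
  (exists theta, 0 < theta < PI /\ Th theta <> RtoC 0) ->
  exists k : nat, lam = RtoC ((mu + INR k) * (mu + INR k + 1)).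
Proof.
  intros Hmu HT Heq Hsq Hor [x0 [Hx0 Hne]].
  set (p := Re lam). set (q := Im lam).
  set (a := fun x => Re (Th x)). set (b := fun x => Im (Th x)).
  set (a1 := fun x => Re (CDerive Th x)). set (b1 := fun x => Im (CDerive Th x)).
  set (a2 := fun x => Re (CDerive (CDerive Th) x)). set (b2 := fun x => Im (CDerive (CDerive Th) x)).
  assert (Da : forall x, on_sphere x -> is_derive a x (a1 x)).
  { intros x Hx. exact (is_derive_Re _ x (proj1 (HT x Hx))). }
  assert (Da1 : forall x, on_sphere x -> is_derive a1 x (a2 x)).
  { intros x Hx. exact (is_derive_Re _ x (proj2 (HT x Hx))). }
  assert (Db : forall x, on_sphere x -> is_derive b x (b1 x)).
  { intros x Hx. exact (is_derive_Im _ x (proj1 (HT x Hx))). }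
  assert (Db1 : forall x, on_sphere x -> is_derive b1 x (b2 x)).
  { intros x Hx. exact (is_derive_Im _ x (proj2 (HT x Hx))). }
  assert (Hc : forall x, on_sphere x ->
    / sin x * (cos x * a1 x + sin x * a2 x) + (p * a x + - q * b x) - mu ^ 2 / sin x ^ 2 * a x = 0 /\
    / sin x * (cos x * b1 x + sin x * b2 x) + (p * b x + q * a x) - mu ^ 2 / sin x ^ 2 * b x = 0).
  { intros x Hx. assert (H := Heq x Hx).
    destruct (CDerive_weighted sin (CDerive Th) x (cos x) (is_derive_sin x) (proj2 (HT x Hx))) as [_ Hw].
    rewrite Hw in H. split.
    - apply (f_equal Re) in H. unfold a, b, a1, a2, p, q, Re, Im, Rdiv in *. simpl in H |- *. lra.
    - apply (f_equal Im) in H. unfold a, b, b1, b2, p, q, Re, Im, Rdiv in *. simpl in H |- *. lra. }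
  set (e := p - mu * (mu + 1)).
  set (wa := fun x => a1 x - mu * (cot x * a x)). set (wb := fun x => b1 x - mu * (cot x * b x)).
  assert (Ha : polar_system mu a wa (fun x => e * a x + - q * b x)).
  { eapply polar_system_ext; [|apply (polar_system_of_equation mu a a1 a2 (fun x => p * a x + - q * b x))].
    - intros x. unfold e. ring.
    - exact Da.
    - exact Da1.
    - intros x Hx. exact (proj1 (Hc x Hx)). }
  assert (Hb : polar_system mu b wb (fun x => e * b x + q * a x)).
  { eapply polar_system_ext; [|apply (polar_system_of_equation mu b b1 b2 (fun x => p * b x + q * a x))].
    - intros x. unfold e. ring.
    - exact Db.
    - exact Db1.
    - intros x Hx. exact (proj2 (Hc x Hx)). }
  assert (Hmod : forall x, Cmod (Th x) ^ 2 * sin x = sin x * (a x ^ 2 + b x ^ 2)).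
  { intros x. unfold Cmod. rewrite pow2_sqrt.
    - unfold a, b, Re, Im. ring.
    - apply Rplus_le_le_0_compat; apply pow2_ge_0. }
  destruct (polar_antiderivative (fun x => Cmod (Th x) ^ 2 * sin x)) as [S [M HS]].
  { intros x Hx. apply (continuous_ext_R (fun x => sin x * (a x * a x + b x * b x))).
    { intros t. rewrite Hmod. ring. }
    eapply continuous_of_derive. apply is_derive_Rmult; [apply is_derive_sin|].
    apply is_derive_Rplus; apply is_derive_Rmult;
      first [exact (Da x Hx) | exact (Db x Hx)]. }
  { intros x Hx. apply Rmult_le_pos; [apply pow2_ge_0|]. left. apply sin_gt_0; apply Hx. }
  { exact Hsq. }
  assert (HSa : forall x, on_sphere x -> is_derive S x (sin x * (a x ^ 2 + b x ^ 2)) /\ Rabs (S x) <= M).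
  { intros x Hx. destruct (HS x Hx) as [H1 H2]. split; [|assumption]. now rewrite <- Hmod. }
  assert (Ba : both_ends bounded_at_0 a).
  { apply (polar_regular_ends mu e (- q) M a b wa S); auto.
    destruct Hor as [|[H1 H2]]; [left | right]; assumption. }
  assert (Bb : both_ends bounded_at_0 b).
  { apply (polar_regular_ends mu e q M b a wb S); auto.
    - destruct Hor as [|[H1 H2]]; [left | right]; assumption.
    - intros x Hx. rewrite (Rplus_comm (b x ^ 2)). now apply HSa. }
  assert (Hne' : a x0 <> 0 \/ b x0 <> 0).
  { apply NNPP. intros H. apply Hne. apply injective_projections; apply NNPP; intros H'; apply H; auto. }
  assert (Hq : q = 0).
  { apply (polar_real mu e q a wa b wb); auto. exists x0. split; assumption. }
  assert (Hlarge : exists n : nat, p <= (mu + INR n) * (mu + INR n + 1)).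
  { destruct (INR_unbounded (Rabs p + 1)) as [n Hn]. exists n.
    assert (Hp := Rle_abs p). assert (Hp0 := Rabs_pos p). nra. }
  destruct Hlarge as [n Hn].
  assert (Hk : exists k : nat, p = (mu + INR k) * (mu + INR k + 1)).
  { destruct Hne' as [H | H].
    - apply (polar_ladder p n mu a wa); auto; [| exists x0; split; assumption].
      eapply polar_system_ext; [|exact Ha]. intros x. cbv beta. rewrite Hq. unfold e. ring.
    - apply (polar_ladder p n mu b wb); auto; [| exists x0; split; assumption].
      eapply polar_system_ext; [|exact Hb]. intros x. cbv beta. rewrite Hq. unfold e. ring. }
  destruct Hk as [k Hk]. exists k. apply injective_projections; simpl; [exact Hk | exact Hq].
Qed.

(** The Wronskian of two regular solutions is constant and small near the origin, hence 0. At a zero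
    of [y1] therefore [y2] or [w1] vanishes, and the latter would make [y1] trivial. So the nodes of
    a complex solution are the zeros of one real component. *)
Lemma radial_proportional (l c kappa : R) (y1 w1 y2 w2 : R -> R) (r : R) :
  0 < l -> 0 < c -> radial_system l c kappa y1 w1 -> radial_system l c kappa y2 w2 ->
  linear_at_0 y1 -> linear_at_0 y2 -> (exists x, 0 < x /\ y1 x <> 0) ->
  0 < r -> y1 r = 0 -> y2 r = 0.
Proof.
  intros Hl Hc H1 H2 L1 L2 [x0 [Hx0 Hne]] Hr Hy.
  set (W := fun x => y1 x * w2 x - y2 x * w1 x).
  assert (LW : linear_at_0 W).
  { apply linear_at_0_minus; apply linear_at_0_mult; auto using bounded_of_linear_at_0.
    - exact (radial_linear_at_0 l c kappa y2 w2 Hl Hc H2 L2).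
    - exact (radial_linear_at_0 l c kappa y1 w1 Hl Hc H1 L1). }
  assert (HdW : forall x, positive x -> is_derive W x 0).
  { intros x Hx. destruct (H1 x Hx) as [A1 A2], (H2 x Hx) as [A3 A4]. eapply is_derive_eq.
    - apply is_derive_Rminus; apply is_derive_Rmult; eassumption.
    - ring. }
  assert (HW : W r = 0).
  { apply eq_0_of_abs_lt. intros eps He.
    destruct (linear_at_0_small positive W initial_positive LW eps He r Hr) as [t [Ht [_ Hs]]].
    now rewrite (derive_zero_constant positive W r t interval_positive HdW Hr Ht). }
  unfold W in HW. rewrite Hy in HW.
  assert (Hp : y2 r * w1 r = 0) by lra. apply Rmult_integral in Hp. destruct Hp as [|Hw]; [assumption|].
  exfalso. apply Hne. now apply (radial_unique l c kappa r x0 y1 w1).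
Qed.

(** Multiplication by [x] removes the first-derivative term, and the superpotential solves the
    Riccati equation belonging to [kappa = (c / (l + 1))^2]. *)
Lemma radial_system_of_equation (l c kappa : R) (a a1 a2 : R -> R) :
  0 < l ->
  (forall x, 0 < x -> is_derive a x (a1 x)) ->
  (forall x, 0 < x -> is_derive a1 x (a2 x)) ->
  (forall x, 0 < x -> / x ^ 2 * (2 * x * a1 x + x ^ 2 * a2 x)
     = (l * (l + 1) / x ^ 2 - 2 * c / x + kappa) * a x) ->
  radial_system l c kappa (fun x => x * a x)
    (fun x => a x + x * a1 x - superpotential l c x * (x * a x)).
Proof.
  intros Hl H1 H2 He x Hx. specialize (H1 x Hx). specialize (H2 x Hx). specialize (He x Hx).
  assert (Hid : is_derive (fun x : R => x) x 1) by apply (is_derive_id (K := R_AbsRing)).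
  split.
  - eapply is_derive_eq; [apply is_derive_Rmult; eassumption|]. cbv beta. ring.
  - eapply is_derive_eq.
    + apply is_derive_Rminus.
      * apply is_derive_Rplus; [exact H1|]. apply is_derive_Rmult; eassumption.
      * apply is_derive_Rmult; [|apply is_derive_Rmult; eassumption].
        unfold superpotential. auto_derive; [lra | reflexivity].
    + assert (Ha2 : a2 x = (l * (l + 1) / x ^ 2 - 2 * c / x + kappa) * a x - 2 / x * a1 x).
      { rewrite <- He. field. lra. }
      rewrite Ha2. unfold superpotential. field. lra.
Qed.

Lemma vanishing_poles_of_edge (f : R -> C) (k : C) :
  k <> RtoC 0 ->
  filterlim (fun x => (f x * k)%C) (at_right 0) (locally (RtoC 0)) ->
  filterlim (fun x => (f x * k)%C) (at_left PI) (locally (RtoC 0)) ->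
  both_ends vanishing_at_0 (fun x => Re (f x)) /\ both_ends vanishing_at_0 (fun x => Im (f x)).
Proof.
  intros Hk H1 H2.
  assert (G1 : forall eps, 0 < eps -> exists d, 0 < d /\ forall x, 0 < x < d ->
    Rabs (Re (f x)) < eps /\ Rabs (Im (f x)) < eps).
  { intros eps He. destruct (filterlim_scaled_0 _ _ f k Hk H1 eps He) as [d Hd].
    exists d. split; [apply cond_pos|]. intros x Hx.
    apply Hd; [|lra]. apply ball_R. rewrite Rabs_pos_eq; lra. }
  assert (G2 : forall eps, 0 < eps -> exists d, 0 < d /\ forall x, 0 < x < d ->
    Rabs (Re (f (PI - x))) < eps /\ Rabs (Im (f (PI - x))) < eps).
  { intros eps He. destruct (filterlim_scaled_0 _ _ f k Hk H2 eps He) as [d Hd].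
    exists d. split; [apply cond_pos|]. intros x Hx.
    apply Hd; [|lra]. apply ball_R. rewrite Rabs_left; lra. }
  split; split; intros eps He;
    [destruct (G1 eps He) as [d [Hd H]] | destruct (G2 eps He) as [d [Hd H]]
    |destruct (G1 eps He) as [d [Hd H]] | destruct (G2 eps He) as [d [Hd H]]];
    exists d; split; auto; intros x Hx; now apply H.
Qed.

(** The inverse Bohr radius, which is the [c] of the radial system. *)
Definition bohr_wavenumber (me e eps0 hbar : R) : R := me * e ^ 2 / (4 * PI * eps0 * hbar ^ 2).

Lemma bohr_wavenumber_pos (me e eps0 hbar : R) :
  0 < me -> 0 < e -> 0 < eps0 -> 0 < hbar -> 0 < bohr_wavenumber me e eps0 hbar.
Proof.
  intros. assert (HP := PI_RGT_0). unfold bohr_wavenumber.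
  assert (0 < me * e ^ 2) by (apply Rmult_lt_0_compat; [|apply pow_lt]; assumption).
  assert (0 < 4 * PI * eps0) by (apply Rmult_lt_0_compat; lra).
  apply Rdiv_lt_0_compat; [assumption|]. apply Rmult_lt_0_compat; [|apply pow_lt]; assumption.
Qed.

(** The [kappa] of the radial system; for a bound state, the square of the decay rate at
    infinity. *)
Definition reduced_energy (me hbar E : R) : R := - (2 * me * E / hbar ^ 2).

Lemma energy_level (me e eps0 hbar E n : R) :
  0 < me -> 0 < eps0 -> 0 < hbar -> 0 < n ->
  (reduced_energy me hbar E = (bohr_wavenumber me e eps0 hbar / n) ^ 2 <->
   E = - (rydberg_energy me e eps0 hbar / n ^ 2)).
Proof.
  intros Hm He Hh Hn. assert (HP := PI_RGT_0).
  unfold reduced_energy, bohr_wavenumber, rydberg_energy. split; intros H.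
  - replace E with (- (hbar ^ 2 / (2 * me)) * - (2 * me * E / hbar ^ 2)) by (field; lra).
    rewrite H. field. repeat split; lra.
  - rewrite H. field. repeat split; lra.
Qed.

(** As [E] and [nu] are real, [x] times the real and [x] times the imaginary part solve the same
    system. One that is nonzero gives the energy and the list of nodes; the other vanishes at the
    same points by proportionality. *)
Lemma radial_states (me e eps0 hbar nu E : R) (Rad : R -> C) :
  0 < me -> 0 < e -> 0 < eps0 -> 0 < hbar -> 0 < nu ->
  twice_differentiable_on (fun r => 0 < r) Rad ->
  radial_equation me e eps0 hbar nu E Rad ->
  regular_at_origin Rad -> normalisable_at_infinity Rad ->
  (exists r, 0 < r /\ Rad r <> RtoC 0) ->
  exists nr : nat, number_of_radial_nodes Rad nr /\
    E = - (rydberg_energy me e eps0 hbar / (nu + INR nr + 1) ^ 2).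
Proof.
  intros Hme He Heps Hh Hnu HR Heq [lim Hlim] [a0 [Ha0 Hint]] [r0 [Hr0 Hne]].
  assert (HP := PI_RGT_0).
  set (c := bohr_wavenumber me e eps0 hbar).
  assert (Hc : 0 < c) by now apply bohr_wavenumber_pos.
  set (kappa := reduced_energy me hbar E).
  set (a := fun x => Re (Rad x)). set (b := fun x => Im (Rad x)).
  set (a1 := fun x => Re (CDerive Rad x)). set (b1 := fun x => Im (CDerive Rad x)).
  set (a2 := fun x => Re (CDerive (CDerive Rad) x)). set (b2 := fun x => Im (CDerive (CDerive Rad) x)).
  assert (Da : forall x, 0 < x -> is_derive a x (a1 x)).
  { intros x Hx. exact (is_derive_Re _ x (proj1 (HR x Hx))). }
  assert (Da1 : forall x, 0 < x -> is_derive a1 x (a2 x)).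
  { intros x Hx. exact (is_derive_Re _ x (proj2 (HR x Hx))). }
  assert (Db : forall x, 0 < x -> is_derive b x (b1 x)).
  { intros x Hx. exact (is_derive_Im _ x (proj1 (HR x Hx))). }
  assert (Db1 : forall x, 0 < x -> is_derive b1 x (b2 x)).
  { intros x Hx. exact (is_derive_Im _ x (proj2 (HR x Hx))). }
  assert (Hreal : forall x u u1 u2, 0 < x ->
    - (hbar ^ 2 / (2 * me)) * / x ^ 2 * (2 * x * u1 + x ^ 2 * u2)
      + nu * (nu + 1) * hbar ^ 2 / (2 * me * x ^ 2) * u + coulomb_potential e eps0 x * u = E * u ->
    / x ^ 2 * (2 * x * u1 + x ^ 2 * u2) = (nu * (nu + 1) / x ^ 2 - 2 * c / x + kappa) * u).
  { intros x u u1 u2 Hx H.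
    replace (/ x ^ 2 * (2 * x * u1 + x ^ 2 * u2)) with
      (- (2 * me / hbar ^ 2) * (- (hbar ^ 2 / (2 * me)) * / x ^ 2 * (2 * x * u1 + x ^ 2 * u2)))
      by (field; repeat split; lra).
    replace (- (hbar ^ 2 / (2 * me)) * / x ^ 2 * (2 * x * u1 + x ^ 2 * u2)) with
      (E * u - nu * (nu + 1) * hbar ^ 2 / (2 * me * x ^ 2) * u - coulomb_potential e eps0 x * u) by lra.
    unfold c, kappa, bohr_wavenumber, reduced_energy, coulomb_potential. field. repeat split; lra. }
  assert (Hcomp : forall x, 0 < x ->
    / x ^ 2 * (2 * x * a1 x + x ^ 2 * a2 x) = (nu * (nu + 1) / x ^ 2 - 2 * c / x + kappa) * a x /\
    / x ^ 2 * (2 * x * b1 x + x ^ 2 * b2 x) = (nu * (nu + 1) / x ^ 2 - 2 * c / x + kappa) * b x).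
  { intros x Hx. assert (H := Heq x Hx).
    destruct (CDerive_weighted (fun s => s ^ 2) (CDerive Rad) x (2 * x) (is_derive_sqr x) (proj2 (HR x Hx))) as [_ Hw].
    rewrite Hw in H. split; apply Hreal; auto.
    - apply (f_equal Re) in H. unfold a, a1, a2, Re, Im, RtoC, Cmult, Cplus in *.
      cbn [fst snd] in H. ring_simplify in H. ring_simplify. exact H.
    - apply (f_equal Im) in H. unfold b, b1, b2, Re, Im, RtoC, Cmult, Cplus in *.
      cbn [fst snd] in H. ring_simplify in H. ring_simplify. exact H. }
  set (ua := fun x => x * a x). set (ub := fun x => x * b x).
  assert (Sa : exists w, radial_system nu c kappa ua w).
  { eexists. apply (radial_system_of_equation nu c kappa a a1 a2); auto.
    - intros x Hx. exact (proj1 (Hcomp x Hx)). }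
  assert (Sb : exists w, radial_system nu c kappa ub w).
  { eexists. apply (radial_system_of_equation nu c kappa b b1 b2); auto.
    - intros x Hx. exact (proj2 (Hcomp x Hx)). }
  destruct Sa as [wa Sa]. destruct Sb as [wb Sb].
  assert (L : linear_at_0 ua /\ linear_at_0 ub).
  { destruct (proj1 (filterlim_locally (U := C_UniformSpace) _ _) Hlim (mkposreal 1 Rlt_0_1)) as [d Hdd].
    assert (A1 := Rmin_l d 1). assert (A2 := Rmin_r d 1).
    assert (A3 : 0 < Rmin d 1) by (apply Rmin_glb_lt; [apply cond_pos | lra]).
    assert (G : forall x, 0 < x < Rmin d 1 -> Rabs (a x - Re lim) < 1 /\ Rabs (b x - Im lim) < 1).
    { intros x Hx. apply Hdd; [|lra]. apply ball_R. rewrite Rabs_pos_eq; lra. }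
    assert (G2 : forall x u v, 0 < x -> Rabs (u - v) < 1 -> Rabs (x * u) <= (Rabs v + 1) * x).
    { intros x u v Hx Huv. rewrite Rabs_mult, (Rabs_pos_eq x), Rmult_comm by lra.
      apply Rmult_le_compat_r; [lra|]. replace u with (v + (u - v)) by ring.
      apply Rle_trans with (1 := Rabs_triang _ _). lra. }
    split; [exists (Rabs (Re lim) + 1), (Rmin d 1) | exists (Rabs (Im lim) + 1), (Rmin d 1)];
      (split; [lra|]); intros x Hx; apply G2; try lra; apply (G x Hx). }
  destruct L as [La Lb].
  assert (Hcont : forall x, positive x -> continuous ua x /\ continuous ub x).
  { intros x Hx. split.
    - exact (continuous_of_derive ua x _ (proj1 (Sa x Hx))).
    - exact (continuous_of_derive ub x _ (proj1 (Sb x Hx))). }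
  assert (Hcsq : forall u : R -> R, (forall x, positive x -> continuous u x) ->
     forall x, positive x -> continuous (fun x => u x ^ 2) x).
  { intros u Hu x Hx. apply (continuous_ext_R (fun x => u x * u x)); [intros t; ring|].
    apply (continuous_mult (K := R_AbsRing) u u); now apply Hu. }
  assert (Hmod : forall x, Cmod (Rad x) ^ 2 * x ^ 2 = ua x ^ 2 + ub x ^ 2).
  { intros x. unfold Cmod. rewrite pow2_sqrt.
    - unfold ua, ub, a, b, Re, Im. ring.
    - apply Rplus_le_le_0_compat; apply pow2_ge_0. }
  assert (T : forall u : R -> R, (forall x, positive x -> continuous u x) ->
     (forall x, u x ^ 2 <= ua x ^ 2 + ub x ^ 2) -> square_integrable_tail u).
  { intros u Hu Hle.
    destruct (radial_antiderivative (fun x => Cmod (Rad x) ^ 2 * x ^ 2) (fun x => u x ^ 2) a0 Ha0)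
      as [U [M HU]]; auto.
    - intros x Hx. apply (continuous_ext_R (fun x => ua x ^ 2 + ub x ^ 2)); [intros t; now rewrite Hmod|].
      apply (continuous_plus (K := R_AbsRing) (V := R_NormedModule) (fun x => ua x ^ 2) (fun x => ub x ^ 2));
        apply Hcsq; auto; intros t Ht; [exact (proj1 (Hcont t Ht)) | exact (proj2 (Hcont t Ht))].
    - intros x Hx. rewrite Hmod. split; [apply pow2_ge_0 | apply Hle].
    - exists U, a0, M. split; assumption. }
  assert (Ta : square_integrable_tail ua).
  { apply T; [intros x Hx; exact (proj1 (Hcont x Hx))|]. intros x. assert (A := pow2_ge_0 (ub x)). lra. }
  assert (Tb : square_integrable_tail ub).
  { apply T; [intros x Hx; exact (proj2 (Hcont x Hx))|]. intros x. assert (A := pow2_ge_0 (ua x)). lra. }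
  assert (Hzero : forall x, 0 < x -> (Rad x = RtoC 0 <-> ua x = 0 /\ ub x = 0)).
  { intros x Hx. unfold ua, ub, a, b. split.
    - intros ->. unfold Re, Im; simpl. split; ring.
    - intros [H1 H2]. apply Rmult_integral in H1. apply Rmult_integral in H2.
      apply injective_projections; simpl; [destruct H1 | destruct H2]; auto; lra. }
  (* Formulated for either order of the two components, since one of them may vanish identically. *)
  assert (Hfin : forall u v wu wv, radial_system nu c kappa u wu -> radial_system nu c kappa v wv ->
    linear_at_0 u -> linear_at_0 v -> square_integrable_tail u ->
    (forall x, 0 < x -> (Rad x = RtoC 0 <-> u x = 0 /\ v x = 0)) -> (exists x, 0 < x /\ u x <> 0) ->
    exists nr : nat, number_of_radial_nodes Rad nr /\
      E = - (rydberg_energy me e eps0 hbar / (nu + INR nr + 1) ^ 2)).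
  { intros u v wu wv Hu Hv Lu Lv Tu Hz Hn.
    destruct (radial_spectrum nu c kappa u wu Hnu Hc Hu Lu Tu Hn) as [xs [Hk Hxs]].
    exists (length xs). split.
    - destruct (zeros_from_spec u xs 0 Hxs) as [Hnd Hin].
      exists xs. split; [assumption|]. split; [reflexivity|].
      intros r. rewrite Hin. split; intros [Hr Hzr]; split; auto.
      + apply Hz; [assumption|]. split; [assumption|].
        now apply (radial_proportional nu c kappa u wu v wv r).
      + now apply Hz.
    - apply energy_level; auto. assert (Hp := pos_INR (length xs)). lra. }
  assert (Hne' : ua r0 <> 0 \/ ub r0 <> 0).
  { apply NNPP. intros H. apply Hne. apply Hzero; [assumption|].
    split; apply NNPP; intros H'; apply H; auto. }
  destruct Hne' as [H | H].
  - apply (Hfin ua ub wa wb); eauto.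
  - apply (Hfin ub ua wb wa); eauto. intros x Hx. rewrite (Hzero x Hx). tauto.
Qed.

Lemma effective_azimuthal_number_ge (Phi : R) (n : nat) :
  0 < Phi -> (1 <= n)%nat -> PI / Phi <= effective_azimuthal_number Phi n.
Proof.
  intros HPhi Hn. unfold effective_azimuthal_number, Rdiv. apply Rmult_le_compat_r.
  - left. now apply Rinv_0_lt_compat.
  - apply le_INR in Hn. simpl in Hn. assert (HP := PI_RGT_0). nra.
Qed.

Lemma effective_azimuthal_number_gt_half (Phi : R) (n : nat) :
  0 < Phi < 2 * PI -> (1 <= n)%nat -> / 2 < effective_azimuthal_number Phi n.
Proof.
  intros HPhi Hn. apply Rlt_le_trans with (2 := effective_azimuthal_number_ge Phi n ltac:(lra) Hn).
  apply Rmult_lt_reg_r with Phi; [lra|].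
  replace (PI / Phi * Phi) with PI by (field; lra). lra.
Qed.

Lemma bound_state_quantum_numbers (me e eps0 hbar Phi E : R) (Rad Th F : R -> C) :
  0 < me -> 0 < e -> 0 < eps0 -> 0 < hbar -> 0 < Phi < 2 * PI ->
  separated_bound_state me e eps0 hbar Phi E Rad Th F ->
  (PI < Phi -> vanishes_on_edge Phi (separated Rad Th F)) ->
  exists nphi k nr : nat,
    (1 <= nphi)%nat /\ has_quantum_numbers me e eps0 hbar Phi E Rad Th F nphi k nr.
Proof.
  intros Hme He Heps Hh HPhi Hst Hedge. assert (HP := PI_RGT_0).
  destruct Hst as [HR HT HF [r0 [th0 [ph0 [Hw0 Hne]]]] Hsch Hbar Hpol Hreg Hnorm].
  assert (Hw0' := Hw0). destruct Hw0' as [Hr0 [Hth0 Hph0]].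
  unfold separated in Hne. destruct (Cmult_neq_0_inv _ _ Hne) as [Hne2 HF0].
  destruct (Cmult_neq_0_inv _ _ Hne2) as [HR0 HT0].
  assert (Hk : - (hbar ^ 2 / (2 * me)) <> 0).
  { apply Rlt_not_eq. assert (0 < hbar ^ 2 / (2 * me)) by (apply Rdiv_lt_0_compat; [apply pow_lt|]; lra). lra. }
  destruct (separation (- (hbar ^ 2 / (2 * me))) E Phi r0 th0 ph0 (coulomb_potential e eps0) Rad Th F
    Hk HR HT HF Hw0 HR0 HT0 HF0 Hsch) as [M [lam [HFeq [HTeq HReq]]]].
  destruct (Hbar r0 th0 Hr0 Hth0) as [Hcont [Hb0 HbPhi]].
  destruct (vanishing_of_barriers Phi F (Rad r0 * Th th0)%C ltac:(lra) Hne2 Hcont Hb0 HbPhi)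
    as [Va [Vb [F0 FPhi]]].
  destruct (azimuthal_number Phi M F ltac:(lra) HF HFeq Va Vb) as [nphi [Hn HM]]; [eauto|].
  set (mu := effective_azimuthal_number Phi nphi) in *.
  assert (Hmu : / 2 < mu) by now apply effective_azimuthal_number_gt_half.
  subst M.
  destruct (polar_number_exists mu lam Th ltac:(lra) HT HTeq Hpol) as [k Hlam]; [|eauto|].
  (* For [Phi <= PI] every azimuthal number is at least [PI / Phi >= 1], and square-integrability
     excludes the singular solution; for wider wedges the edge condition does. *)
  { destruct (Rle_or_lt Phi PI) as [Hle | Hgt].
    - left. apply Rle_trans with (2 := effective_azimuthal_number_ge Phi nphi ltac:(lra) Hn).
      apply Rmult_le_reg_r with Phi; [lra|]. replace (PI / Phi * Phi) with PI by (field; lra). lra.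
    - right. destruct (Hedge Hgt r0 ph0 Hr0 Hph0) as [H1 H2].
      apply (vanishing_poles_of_edge Th (Rad r0 * F ph0)%C).
      + now apply Cmult_neq_0.
      + apply filterlim_ext with (2 := H1). intros x. unfold separated. ring.
      + apply filterlim_ext with (2 := H2). intros x. unfold separated. ring. }
  set (nu := polar_number Phi nphi k).
  assert (Hnu : nu = mu + INR k) by reflexivity.
  assert (Hk0 := pos_INR k). rewrite <- Hnu in Hlam.
  assert (HReq' : radial_equation me e eps0 hbar nu E Rad).
  { intros r Hr. specialize (HReq r Hr). rewrite Hlam in HReq. rewrite <- HReq.
    replace (nu * (nu + 1) * hbar ^ 2 / (2 * me * r ^ 2))
      with (- (nu * (nu + 1) * - (hbar ^ 2 / (2 * me)) * / r ^ 2)) by (field; lra).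
    rewrite (RtoC_opp (nu * (nu + 1) * - (hbar ^ 2 / (2 * me)) * / r ^ 2)), !RtoC_mult. ring. }
  destruct (radial_states me e eps0 hbar nu E Rad) as [nr [Hnodes HE]]; auto; [lra | eauto |].
  exists nphi, k, nr. split; [assumption|].
  unfold has_quantum_numbers. fold mu nu.
  split; [split; [|split] | split; [|split; [|split; [|split]]]].
  - intros phi Hphi. rewrite (HFeq phi Hphi). rewrite RtoC_opp. reflexivity.
  - assumption.
  - assumption.
  - intros t Ht. rewrite <- (HTeq t Ht). f_equal. f_equal.
    rewrite Hlam, <- RtoC_mult, <- RtoC_minus. reflexivity.
  - exact HReq'.
  - exact Hnodes.
  - rewrite HE. do 3 f_equal. unfold principal_number. fold nu. ring.
  - rewrite HE. do 3 f_equal. rewrite Hnu. unfold mu, effective_azimuthal_number. ring.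
Qed.

(** * Construction of the bound states *)

Lemma sin_bounds (x : R) : on_sphere x -> 0 < sin x <= 1.
Proof. intros [H0 H1]. split; [now apply sin_gt_0 | apply SIN_bound]. Qed.

Lemma abs_cot_le (x : R) : on_sphere x -> Rabs (cot x) <= / sin x.
Proof.
  intros Hx. assert (Hs := sin_bounds x Hx). unfold cot, Rdiv.
  assert (Hi : 0 < / sin x) by (apply Rinv_0_lt_compat; lra).
  rewrite Rabs_mult, (Rabs_pos_eq (/ sin x)) by lra.
  rewrite <- (Rmult_1_l (/ sin x)) at 2. apply Rmult_le_compat_r; [lra|].
  apply Rabs_le, COS_bound.
Qed.

(** Inverts [polar_raise]: equating the two expressions for [w'] at levels [mu] and [mu + 1]
    determines [y], provided that the factorisation constant is nonzero. *)
Lemma polar_lower (mu lam : R) (w w2 : R -> R) :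
  lam - mu * (mu + 1) <> 0 ->
  polar_system (mu + 1) w w2 (fun x => (lam - (mu + 1) * (mu + 1 + 1)) * w x) ->
  polar_system mu
    (fun x => - / (lam - mu * (mu + 1)) * (w2 x + (2 * mu + 2) * (cot x * w x))) w
    (fun x => (lam - mu * (mu + 1)) *
       (- / (lam - mu * (mu + 1)) * (w2 x + (2 * mu + 2) * (cot x * w x)))).
Proof.
  intros He H x Hx. destruct (H x Hx) as [H1 H2]. split.
  - eapply is_derive_eq.
    + apply is_derive_Rscal, is_derive_Rplus; [exact H2|].
      apply is_derive_Rscal, is_derive_Rmult; [|exact H1].
      apply is_derive_cot. now apply sin_bounds.
    + field. exact He.
  - eapply is_derive_eq; [exact H1|]. field. exact He.
Qed.

(** The top state [sin^(mu+k)] is lowered [k] times. The crude bound on [w] suffices for the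
    induction: at level [mu + 1] it reads [sin^mu], which is also the order of [cot] times the
    raised state. *)
Lemma polar_solution_exists (k : nat) : forall mu, 0 < mu ->
  exists (y w : R -> R) (C : R),
    polar_system mu y w
      (fun x => ((mu + INR k) * (mu + INR k + 1) - mu * (mu + 1)) * y x) /\
    (forall x, on_sphere x -> Rabs (y x) <= C * Rpower (sin x) mu) /\
    (forall x, on_sphere x -> Rabs (w x) <= C * Rpower (sin x) (mu - 1)) /\
    exists x, on_sphere x /\ y x <> 0.
Proof.
  assert (HP := PI_RGT_0).
  induction k as [|k IH]; intros mu Hmu.
  - exists (fun x => Rpower (sin x) mu), (fun _ => 0), 1. split; [|split; [|split]].
    + intros x Hx. assert (Hs := sin_bounds x Hx). split.
      * eapply is_derive_eq; [apply is_derive_Rpower_sin; lra|]. ring.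
      * eapply is_derive_eq; [apply (is_derive_const (V := R_NormedModule))|].
        simpl. unfold zero; simpl. ring.
    + intros x Hx. rewrite Rabs_pos_eq; [lra | apply Rpower_ge_0].
    + intros x Hx. rewrite Rabs_R0, Rmult_1_l. apply Rpower_ge_0.
    + exists (PI / 2). split; [unfold on_sphere; lra|]. apply Rgt_not_eq, Rpower_pos.
  - destruct (IH (mu + 1) ltac:(lra)) as [w [w2 [C [Hsys [Hw [Hw2 Hne]]]]]].
    assert (Hk := pos_INR k).
    set (lam := (mu + INR (S k)) * (mu + INR (S k) + 1)).
    assert (Hlam : (mu + 1 + INR k) * (mu + 1 + INR k + 1) = lam) by (unfold lam; rewrite S_INR; ring).
    rewrite Hlam in Hsys.
    set (e := lam - mu * (mu + 1)).
    assert (He : 0 < e).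
    { unfold e, lam. rewrite S_INR. assert (0 <= INR k * INR k) by (apply Rmult_le_pos; lra).
      assert (0 <= mu * INR k) by (apply Rmult_le_pos; lra). lra. }
    assert (Hlow := polar_lower mu lam w w2 (Rgt_not_eq _ _ He) Hsys). fold e in Hlow.
    set (y := fun x => - / e * (w2 x + (2 * mu + 2) * (cot x * w x))) in *.
    assert (Hie : 0 < / e) by now apply Rinv_0_lt_compat.
    assert (HC : 0 <= C).
    { assert (Hm : on_sphere (PI / 2)) by (unfold on_sphere; lra).
      specialize (Hw _ Hm). assert (A1 := Rabs_pos (w (PI / 2))).
      assert (A2 := Rpower_pos (sin (PI / 2)) (mu + 1)). nra. }
    set (C1 := / e * (C + (2 * mu + 2) * C)).
    exists y, w, (Rmax C C1). split; [|split; [|split]].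
    + exact Hlow.
    + intros x Hx. assert (Hs := sin_bounds x Hx).
      apply Rle_trans with (C1 * Rpower (sin x) mu);
        [|apply Rmult_le_compat_r; [apply Rpower_ge_0 | apply Rmax_r]].
      unfold y, C1. rewrite Rabs_mult, Rabs_Ropp, (Rabs_pos_eq (/ e)) by lra.
      rewrite Rmult_assoc. apply Rmult_le_compat_l; [lra|].
      apply Rle_trans with (1 := Rabs_triang _ _). rewrite (Rmult_plus_distr_r C). apply Rplus_le_compat.
      * specialize (Hw2 x Hx). replace (mu + 1 - 1) with mu in Hw2 by ring. exact Hw2.
      * rewrite Rabs_mult, (Rabs_pos_eq (2 * mu + 2)), Rmult_assoc by lra.
        apply Rmult_le_compat_l; [lra|]. rewrite Rabs_mult.
        apply Rle_trans with (/ sin x * (C * Rpower (sin x) (mu + 1))).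
        { apply Rmult_le_compat; auto using Rabs_pos, abs_cot_le. }
        rewrite Rpower_plus, Rpower_1 by lra. right. field. lra.
    + intros x Hx. assert (Hs := sin_bounds x Hx). apply Rle_trans with (1 := Hw x Hx).
      apply Rmult_le_compat; [assumption | apply Rpower_ge_0 | apply Rmax_l|].
      apply Rpower_le_exponent; lra.
    (* If [y] vanished identically, [y' = w + mu cot y] would force [w = 0]. *)
    + apply NNPP. intros Hn. destruct Hne as [x [Hx Hwx]]. apply Hwx.
      assert (Hy0 : forall t, on_sphere t -> y t = 0).
      { intros t Ht. apply NNPP. intros H. apply Hn. now exists t. }
      destruct (Hlow x Hx) as [H1 _].
      apply (derive_of_zero on_sphere y x _ open_sphere Hy0 Hx) in H1.
      rewrite (Hy0 x Hx) in H1. lra.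
Qed.

Lemma radial_lower (l c kappa : R) (w w2 : R -> R) :
  0 < l -> (c / (l + 1)) ^ 2 - kappa <> 0 ->
  radial_system (l + 1) c kappa w w2 ->
  radial_system l c kappa
    (fun x => - / ((c / (l + 1)) ^ 2 - kappa) *
       (w2 x + (superpotential (l + 1) c x + superpotential l c x) * w x)) w.
Proof.
  intros Hl He H x Hx. destruct (H x Hx) as [H1 H2].
  set (e := (c / (l + 1)) ^ 2 - kappa) in *.
  assert (Hk : kappa = (c / (l + 1)) ^ 2 - e) by (unfold e; ring).
  split.
  - eapply is_derive_eq.
    + apply is_derive_Rscal, is_derive_Rplus; [exact H2|].
      apply is_derive_Rmult; [|exact H1].
      unfold superpotential. auto_derive; [lra | reflexivity].
    + rewrite Hk. unfold superpotential. field. repeat split; lra.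
  - eapply is_derive_eq; [exact H1|]. unfold superpotential. field. repeat split; lra.
Qed.

(** Lowering costs at most a factor of order [1 / x] near the origin and a bounded factor beyond 1,
    so crude bounds propagate. At infinity [C / x] replaces the true exponential decay and still
    gives square-integrability. *)
Lemma radial_solution_exists (c : R) (n : nat) : 0 < c -> forall l, 0 < l ->
  exists (u w : R -> R) (C : R),
    radial_system l c ((c / (l + INR n + 1)) ^ 2) u w /\
    (forall x, 0 < x <= 1 -> Rabs (u x) <= C * Rpower x (l + 1) /\ Rabs (w x) <= C * Rpower x l) /\
    (forall x, 1 <= x -> Rabs (u x) <= C / x /\ Rabs (w x) <= C / x) /\
    exists x, 0 < x /\ u x <> 0.
Proof.
  intros Hc. induction n as [|n IH]; intros l Hl.
  (* One power more than in the weight, so that the weight itself is at most [B / x]. *)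
  - destruct (Rpower_exp_bounded (l + 1 + 1) (c / (l + 1))) as [B [HB HBd]];
      [lra | apply Rdiv_lt_0_compat; lra |].
    assert (H1 := Rmax_l 1 B). assert (H2 := Rmax_r 1 B).
    exists (regular_weight l c), (fun _ => 0), (Rmax 1 B). split; [|split; [|split]].
    + intros x Hx. simpl INR. rewrite Rplus_0_r. split.
      * eapply is_derive_eq; [now apply is_derive_regular_weight|]. ring.
      * eapply is_derive_eq; [apply (is_derive_const (V := R_NormedModule))|].
        unfold zero; simpl. ring.
    + intros x Hx. assert (Hp := Rpower_pos x (l + 1)). assert (Hp' := Rpower_pos x l).
      rewrite Rabs_R0, Rabs_pos_eq by (left; apply regular_weight_pos). split; [|nra].
      apply Rle_trans with (1 := regular_weight_le_Rpower l c x Hl Hc ltac:(lra)). nra.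
    + intros x Hx. rewrite Rabs_R0, Rabs_pos_eq by (left; apply regular_weight_pos). split.
      * specialize (HBd x ltac:(lra)). rewrite (Rpower_plus _ 1), Rpower_1 in HBd by lra.
        apply Rmult_le_reg_r with x; [lra|].
        replace (Rmax 1 B / x * x) with (Rmax 1 B) by (field; lra).
        unfold regular_weight. lra.
      * left. apply Rdiv_lt_0_compat; lra.
    + exists 1. split; [lra|]. apply Rgt_not_eq, regular_weight_pos.
  - destruct (IH (l + 1) ltac:(lra)) as [w [w2 [C [Hsys [H0 [Hinf Hne]]]]]].
    assert (Hn := pos_INR n).
    replace (l + 1 + INR n + 1) with (l + INR (S n) + 1) in Hsys by (rewrite S_INR; ring).
    set (kappa := (c / (l + INR (S n) + 1)) ^ 2) in *.
    set (e := (c / (l + 1)) ^ 2 - kappa).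
    assert (He : 0 < e).
    { unfold e, kappa. rewrite S_INR.
      assert (Hlt : c / (l + (INR n + 1) + 1) < c / (l + 1)).
      { apply Rmult_lt_compat_l; [lra|]. apply Rinv_lt_contravar; [apply Rmult_lt_0_compat|]; lra. }
      assert (Hp : 0 < c / (l + (INR n + 1) + 1)) by (apply Rdiv_lt_0_compat; lra).
      simpl. nra. }
    assert (Hlow := radial_lower l c kappa w w2 Hl (Rgt_not_eq _ _ He) Hsys). fold e in Hlow.
    set (u := fun x => - / e * (w2 x + (superpotential (l + 1) c x + superpotential l c x) * w x)) in *.
    assert (Hie : 0 < / e) by now apply Rinv_0_lt_compat.
    assert (HC : 0 <= C).
    { destruct (Hinf 1 ltac:(lra)) as [A _]. assert (A1 := Rabs_pos (w 1)). lra. }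
    (* The sum of the two superpotentials is at most [G / x] on [(0, 1]] and at most [G] beyond
       1. *)
    set (G := 2 * l + 3 + 2 * c).
    assert (HG : forall x, 0 < x ->
      Rabs (superpotential (l + 1) c x + superpotential l c x) <= (2 * l + 3) / x + 2 * c).
    { intros x Hx. apply Rle_trans with (1 := Rabs_triang _ _).
      assert (A1 := superpotential_bounded (l + 1) c x x ltac:(lra) Hc ltac:(lra)).
      assert (A2 := superpotential_bounded l c x x Hl Hc ltac:(lra)).
      assert (A3 : forall s, 0 < s -> c / (s + 1) <= c).
      { intros s Hs. apply Rmult_le_reg_r with (s + 1); [lra|].
        replace (c / (s + 1) * (s + 1)) with c by (field; lra). nra. }
      assert (A4 := A3 l Hl). assert (A5 := A3 (l + 1) ltac:(lra)).
      replace ((2 * l + 3) / x) with ((l + 1 + 1) / x + (l + 1) / x) by (field; lra). lra. }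
    set (C1 := / e * (C + G * C)).
    assert (HCm := Rmax_l C C1). assert (HC1m := Rmax_r C C1).
    assert (HGpos : 0 < G) by (unfold G; lra).
    exists u, w, (Rmax C C1). split; [exact Hlow|]. split; [|split].
    + intros x Hx. destruct (H0 x Hx) as [A1 A2]. assert (Hp := Rpower_pos x (l + 1)). split.
      * apply Rle_trans with (C1 * Rpower x (l + 1)); [|apply Rmult_le_compat_r; lra].
        unfold u, C1. rewrite Rabs_mult, Rabs_Ropp, (Rabs_pos_eq (/ e)) by lra.
        rewrite Rmult_assoc. apply Rmult_le_compat_l; [lra|].
        apply Rle_trans with (1 := Rabs_triang _ _). rewrite (Rmult_plus_distr_r C).
        apply Rplus_le_compat; [exact A2|]. rewrite Rabs_mult.
        apply Rle_trans with (G / x * (C * Rpower x (l + 1 + 1))).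
        { apply Rmult_le_compat; auto using Rabs_pos. apply Rle_trans with (1 := HG x ltac:(lra)).
          assert (Hix : 1 <= / x) by (rewrite <- Rinv_1; apply Rinv_le_contravar; lra).
          unfold G, Rdiv. nra. }
        rewrite (Rpower_plus (l + 1) 1), (Rpower_1 x) by lra. right. field. lra.
      * apply Rle_trans with (1 := A1). assert (Hp' := Rpower_pos x (l + 1 + 1)).
        apply Rmult_le_compat; [assumption | lra | assumption |].
        apply Rpower_le_exponent; lra.
    + intros x Hx. destruct (Hinf x Hx) as [A1 A2].
      assert (Hix : 0 < / x) by (apply Rinv_0_lt_compat; lra).
      assert (Hix1 : / x <= 1) by (rewrite <- Rinv_1; apply Rinv_le_contravar; lra). split.
      * apply Rle_trans with (C1 / x); [|apply Rmult_le_compat_r; lra].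
        unfold u, C1. rewrite Rabs_mult, Rabs_Ropp, (Rabs_pos_eq (/ e)) by lra.
        unfold Rdiv. rewrite Rmult_assoc. apply Rmult_le_compat_l; [lra|].
        apply Rle_trans with (1 := Rabs_triang _ _). rewrite (Rmult_plus_distr_r C).
        apply Rplus_le_compat; [exact A2|]. rewrite Rabs_mult, Rmult_assoc.
        apply Rmult_le_compat; auto using Rabs_pos. apply Rle_trans with (1 := HG x ltac:(lra)).
        unfold G, Rdiv. nra.
      * apply Rle_trans with (1 := A1). apply Rmult_le_compat_r; lra.
    + apply NNPP. intros Hnn. destruct Hne as [x [Hx Hwx]]. apply Hwx.
      assert (Hy0 : forall t, positive t -> u t = 0).
      { intros t Ht. apply NNPP. intros H. apply Hnn. now exists t. }
      destruct (Hlow x Hx) as [H1 _].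
      apply (derive_of_zero positive u x _ open_positive Hy0 Hx) in H1.
      rewrite (Hy0 x Hx) in H1. lra.
Qed.

(** * Existence of improper integrals *)

Lemma limit_of_cauchy (Flt : (R -> Prop) -> Prop) {HF : ProperFilter Flt} (S : R -> R) :
  (forall eps, 0 < eps -> exists P : R -> Prop, Flt P /\
    forall u v, P u -> P v -> Rabs (S v - S u) < eps) ->
  exists lim, forall eps, 0 < eps -> Flt (fun x => Rabs (S x - lim) < eps).
Proof.
  intros H. destruct (proj1 (filterlim_locally_cauchy (U := R_CompleteSpace) S)) as [lim Hlim].
  - intros eps. exact (H eps (cond_pos eps)).
  - exists lim. intros eps He. exact (proj1 (filterlim_locally S lim) Hlim (mkposreal eps He)).
Qed.

Lemma ex_RInt_gen_of_limits (D : R -> Prop) (g S : R -> R) (Fa Fb : (R -> Prop) -> Prop)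
    {HFa : Filter Fa} {HFb : Filter Fb} (la lb : R) :
  interval D -> (forall t, D t -> is_derive S t (g t)) -> (forall t, D t -> continuous g t) ->
  Fa D -> Fb D ->
  (forall eps, 0 < eps -> Fa (fun x => Rabs (S x - la) < eps)) ->
  (forall eps, 0 < eps -> Fb (fun x => Rabs (S x - lb) < eps)) ->
  ex_RInt_gen g Fa Fb.
Proof.
  intros HD HS Hc HDa HDb Ha Hb. exists (lb - la). intros P [eps HP].
  assert (He : 0 < eps / 2) by (assert (H := cond_pos eps); lra).
  apply (Filter_prod _ _ _ (fun x => D x /\ Rabs (S x - la) < eps / 2)
    (fun x => D x /\ Rabs (S x - lb) < eps / 2)).
  - apply filter_and; auto.
  - apply filter_and; auto.
  - intros a b [Hda HSa] [Hdb HSb]. exists (S b - S a). split.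
    + now apply (is_RInt_antiderivative D).
    + apply HP. apply ball_R.
      change (Rabs ((S b - S a) - (lb - la)) < eps).
      replace (S b - S a - (lb - la)) with ((S b - lb) + - (S a - la)) by ring.
      apply Rle_lt_trans with (1 := Rabs_triang _ _). rewrite Rabs_Ropp. lra.
Qed.

(** A bounded integrand has a Lipschitz antiderivative, which is therefore Cauchy at both poles. *)
Lemma ex_RInt_gen_sphere (g : R -> R) (C : R) :
  (forall x, on_sphere x -> continuous g x) -> (forall x, on_sphere x -> 0 <= g x <= C) ->
  ex_RInt_gen g (at_right 0) (at_left PI).
Proof.
  intros Hc Hg. assert (HP := PI2_3_2).
  assert (Hm : on_sphere (PI / 2)) by (unfold on_sphere; lra).
  set (S := fun x => RInt g (PI / 2) x).
  assert (HS : forall x, on_sphere x -> is_derive S x (g x)).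
  { intros x Hx. now apply (is_derive_RInt_open on_sphere); [apply interval_sphere | apply open_sphere | ..]. }
  assert (HC : 0 <= C) by (destruct (Hg _ Hm); lra).
  assert (Hle : forall x y, on_sphere x -> on_sphere y -> x <= y -> Rabs (S y - S x) <= C * y - C * x).
  { intros x y Hx Hy Hxy.
    apply (derive_abs_le S (fun x => C * x) g (fun _ => C)); [assumption | | |]; intros t Ht;
      assert (Hdt : on_sphere t) by now apply (interval_sphere x t y).
    - now apply HS.
    - auto_derive; [exact I | ring].
    - destruct (Hg t Hdt). rewrite Rabs_pos_eq; lra. }
  assert (G : forall (Flt : (R -> Prop) -> Prop) s, ProperFilter Flt -> Flt on_sphere ->
    (forall d : posreal, Flt (ball s d)) ->
    exists lim, forall eps, 0 < eps -> Flt (fun x => Rabs (S x - lim) < eps)).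
  { intros Flt s HF HD Hs. apply (limit_of_cauchy Flt S). intros eps He.
    destruct (scale_small (2 * C) eps He) as [d [Hd Hsm]].
    exists (fun x => on_sphere x /\ ball s (d / 2) x). split.
    - apply filter_and; [assumption|]. exact (Hs (mkposreal (d / 2) ltac:(lra))).
    - intros u v [Hu Hus] [Hv Hvs]. apply ball_R, Rabs_lt_between in Hus.
      apply ball_R, Rabs_lt_between in Hvs. specialize (Hsm (d / 2) ltac:(lra)).
      unfold minus, plus, opp in *; simpl in *.
      destruct (Rle_or_lt u v) as [Huv | Huv].
      + apply Rle_lt_trans with (1 := Hle u v Hu Hv Huv).
        assert (C * (v - u) <= C * d) by (apply Rmult_le_compat_l; lra). lra.
      + rewrite Rabs_minus_sym. apply Rle_lt_trans with (1 := Hle v u Hv Hu ltac:(lra)).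
        assert (C * (u - v) <= C * d) by (apply Rmult_le_compat_l; lra). lra. }
  assert (D0 : at_right 0 on_sphere).
  { exists (mkposreal 1 Rlt_0_1). intros x Hx Hx0. change (Rabs (x - 0) < 1) in Hx.
    apply Rabs_lt_between in Hx. unfold on_sphere. lra. }
  assert (DP : at_left PI on_sphere).
  { exists (mkposreal 1 Rlt_0_1). intros x Hx Hx0. change (Rabs (x - PI) < 1) in Hx.
    apply Rabs_lt_between in Hx. unfold on_sphere. lra. }
  destruct (G (at_right 0) 0 _ D0) as [la Hla]; [intros d; exists d; auto|].
  destruct (G (at_left PI) PI _ DP) as [lb Hlb]; [intros d; exists d; auto|].
  exact (ex_RInt_gen_of_limits on_sphere g S _ _ la lb interval_sphere HS Hc D0 DP Hla Hlb).
Qed.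

(** Comparison with the antiderivative [- C / x] bounds the increments beyond [x] by [C / x], so the
    antiderivative is Cauchy at infinity. *)
Lemma ex_RInt_gen_tail (g : R -> R) (C : R) :
  (forall x, positive x -> continuous g x) -> (forall x, positive x -> 0 <= g x) ->
  (forall x, 1 <= x -> g x <= C / x ^ 2) ->
  ex_RInt_gen g (at_point 1) (Rbar_locally p_infty).
Proof.
  intros Hc Hg HgC.
  set (S := fun x => RInt g 1 x).
  assert (H1 : positive 1) by (unfold positive; lra).
  assert (HS : forall x, positive x -> is_derive S x (g x)).
  { intros x Hx. now apply (is_derive_RInt_open positive); [apply interval_positive | apply open_positive | ..]. }
  assert (Hle : forall x y, 1 <= x <= y -> Rabs (S y - S x) <= C / x).
  { intros x y Hxy. apply Rle_trans with (- C / y - - C / x).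
    - apply (derive_abs_le S (fun x => - C / x) g (fun x => C / x ^ 2)); [lra | | |]; intros t Ht.
      + apply HS. unfold positive; lra.
      + auto_derive; [lra | field; lra].
      + rewrite Rabs_pos_eq; [apply HgC; lra | apply Hg; unfold positive; lra].
    - assert (HC : 0 <= C) by (specialize (HgC 1 ltac:(lra)); specialize (Hg 1 H1); lra).
      assert (0 <= C / y) by (apply Rmult_le_pos; [lra | left; apply Rinv_0_lt_compat; lra]).
      replace (- C / y - - C / x) with (C / x - C / y) by (field; lra). lra. }
  destruct (limit_of_cauchy (Rbar_locally p_infty) S) as [lb Hlb].
  { intros eps He. destruct (scale_small C eps He) as [d [Hd Hs]].
    assert (Hid : 0 < / d) by now apply Rinv_0_lt_compat.
    assert (Hsm : forall x, 1 + / d < x -> C / x < eps).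
    { intros x Hx. apply Hs. split; [apply Rinv_0_lt_compat; lra|].
      rewrite <- (Rinv_inv d). apply Rinv_lt_contravar; [apply Rmult_lt_0_compat|]; lra. }
    exists (fun x => 1 + / d < x). split; [now exists (1 + / d)|].
    intros u v Hu Hv. destruct (Rle_or_lt u v) as [Huv | Huv].
    - apply Rle_lt_trans with (2 := Hsm u Hu). apply Hle. lra.
    - rewrite Rabs_minus_sym. apply Rle_lt_trans with (2 := Hsm v Hv). apply Hle. lra. }
  apply (ex_RInt_gen_of_limits positive g S _ _ (S 1) lb interval_positive HS Hc); auto.
  - exists 0. intros x Hx. exact Hx.
  - intros eps He. unfold at_point. rewrite Rminus_eq_0, Rabs_R0. assumption.
Qed.

(** * Verification of the constructed states *)

Lemma filterlim_RtoC (Flt : (R -> Prop) -> Prop) {HF : Filter Flt} (g : R -> R) (lim : R) :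
  (forall eps, 0 < eps -> Flt (fun x => Rabs (g x - lim) < eps)) ->
  filterlim (fun x => RtoC (g x)) Flt (locally (RtoC lim)).
Proof.
  intros H. apply (filterlim_locally (U := C_UniformSpace)). intros eps.
  apply (filter_imp _ _) with (2 := H eps (cond_pos eps)). intros x Hx. split.
  - exact Hx.
  - apply (ball_center (M := R_UniformSpace)).
Qed.

Lemma real_twice_differentiable (D : R -> Prop) (f f1 f2 : R -> R) :
  open D -> (forall x, D x -> is_derive f x (f1 x)) -> (forall x, D x -> is_derive f1 x (f2 x)) ->
  twice_differentiable_on D (fun x => RtoC (f x)) /\
  (forall x, D x -> CDerive (fun x => RtoC (f x)) x = RtoC (f1 x)) /\
  (forall x, D x -> CDerive (CDerive (fun x => RtoC (f x))) x = RtoC (f2 x)).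
Proof.
  intros HD H1 H2.
  assert (G : forall h h1 x, is_derive h x h1 ->
    ex_CDerive (fun x => RtoC (h x)) x /\ CDerive (fun x => RtoC (h x)) x = RtoC h1).
  { intros h h1 x H. apply CDerive_of_components; [exact H|].
    apply (is_derive_const (V := R_NormedModule) 0). }
  assert (E : forall x, D x -> CDerive (fun x => RtoC (f x)) x = RtoC (f1 x)) by (intros x Hx; apply G, H1, Hx).
  assert (E2 : forall x, D x -> ex_CDerive (CDerive (fun x => RtoC (f x))) x).
  { intros x Hx. destruct (G f1 (f2 x) x (H2 x Hx)) as [[A B] _]. destruct (HD x Hx) as [d Hd].
    split.
    - apply (ex_derive_ext_loc (fun t => Re (RtoC (f1 t)))); [|exact A].
      exists d. intros t Ht. now rewrite (E t (Hd t Ht)).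
    - apply (ex_derive_ext_loc (fun t => Im (RtoC (f1 t)))); [|exact B].
      exists d. intros t Ht. now rewrite (E t (Hd t Ht)). }
  split; [|split].
  - intros x Hx. split; [apply (G f (f1 x) x), H1, Hx | now apply E2].
  - exact E.
  - intros x Hx. rewrite (CDerive_ext_on D _ (fun x => RtoC (f1 x)) x HD Hx E). apply G, H2, Hx.
Qed.

Lemma polar_second_derivative (mu lam : R) (y w : R -> R) :
  polar_system mu y w (fun x => (lam - mu * (mu + 1)) * y x) ->
  exists y1 y2 : R -> R,
    (forall x, on_sphere x -> is_derive y x (y1 x)) /\
    (forall x, on_sphere x -> is_derive y1 x (y2 x)) /\
    (forall x, on_sphere x -> cos x * y1 x + sin x * y2 x = sin x * (mu ^ 2 / sin x ^ 2 - lam) * y x).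
Proof.
  intros H.
  set (y1 := fun x => w x + mu * (cot x * y x)).
  exists y1, (fun x => - ((lam - mu * (mu + 1)) * y x) - (mu + 1) * cot x * w x
     + mu * (- (1 + cot x ^ 2) * y x + cot x * y1 x)).
  split; [|split].
  - intros x Hx. eapply is_derive_eq; [exact (proj1 (H x Hx))|]. unfold y1. ring.
  - intros x Hx. destruct (H x Hx) as [H1 H2]. eapply is_derive_eq.
    + unfold y1. apply is_derive_Rplus; [exact H2|]. apply is_derive_Rscal, is_derive_Rmult; [|exact H1].
      apply is_derive_cot. now apply sin_bounds.
    + unfold y1. ring.
  - intros x Hx. assert (Hs := sin_bounds x Hx). unfold y1.
    rewrite (cos_cot x Hx).
    assert (Hc : mu ^ 2 / sin x ^ 2 = mu ^ 2 * (1 + cot x ^ 2)).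
    { assert (H0 := sin2_cos2 x). unfold Rsqr in H0. unfold cot.
      replace (mu ^ 2 * (1 + (cos x / sin x) ^ 2)) with (mu ^ 2 * (sin x * sin x + cos x * cos x) / sin x ^ 2)
        by (field; lra).
      rewrite H0. unfold Rdiv. ring. }
    rewrite Hc. ring.
Qed.

Lemma radial_second_derivative (l c kappa : R) (u w : R -> R) :
  0 < l -> radial_system l c kappa u w ->
  exists a1 a2 : R -> R,
    (forall x, 0 < x -> is_derive (fun x => u x / x) x (a1 x)) /\
    (forall x, 0 < x -> is_derive a1 x (a2 x)) /\
    (forall x, 0 < x -> 2 * x * a1 x + x ^ 2 * a2 x
       = (l * (l + 1) - 2 * c * x + kappa * x ^ 2) * (u x / x)).
Proof.
  intros Hl H.
  set (u1 := fun x => w x + superpotential l c x * u x).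
  set (u2 := fun x => (l * (l + 1) / x ^ 2 - 2 * c / x + kappa) * u x).
  assert (H1 : forall x, 0 < x -> is_derive u x (u1 x)) by (intros x Hx; exact (proj1 (H x Hx))).
  assert (H2 : forall x, 0 < x -> is_derive u1 x (u2 x)).
  { intros x Hx. destruct (H x Hx) as [A1 A2]. eapply is_derive_eq.
    - unfold u1. apply is_derive_Rplus; [exact A2|]. apply is_derive_Rmult; [|exact A1].
      unfold superpotential. auto_derive; [lra | reflexivity].
    - unfold u2, superpotential. field. lra. }
  exists (fun x => u1 x * / x - u x * / x ^ 2),
    (fun x => u2 x / x - 2 * u1 x / x ^ 2 + 2 * u x / x ^ 3).
  assert (Hi : forall x, 0 < x -> is_derive (fun x => / x) x (- / x ^ 2)).
  { intros x Hx. auto_derive; [lra | field; lra]. }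
  assert (Hi2 : forall x, 0 < x -> is_derive (fun x => / x ^ 2) x (- 2 / x ^ 3)).
  { intros x Hx. auto_derive; [assert (x <> 0) by lra; simpl; nra | field; lra]. }
  split; [|split].
  - intros x Hx. unfold Rdiv. eapply is_derive_eq; [apply is_derive_Rmult; auto|]. ring.
  - intros x Hx. eapply is_derive_eq.
    + apply is_derive_Rminus; apply is_derive_Rmult; auto.
    + cbv beta. field. lra.
  - intros x Hx. unfold u2. field. lra.
Qed.

(** The construction fixes the energy but does not count nodes. The count is recovered from
    [radial_states], because for given [nu] different numbers of nodes give different energies. *)
Lemma quantum_numbers_realised (me e eps0 hbar Phi : R) (nphi k nr : nat) :
  0 < me -> 0 < e -> 0 < eps0 -> 0 < hbar -> 0 < Phi < 2 * PI -> (1 <= nphi)%nat ->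
  exists (E : R) (Rad Th F : R -> C),
    separated_bound_state me e eps0 hbar Phi E Rad Th F /\
    vanishes_on_edge Phi (separated Rad Th F) /\
    has_quantum_numbers me e eps0 hbar Phi E Rad Th F nphi k nr.
Proof.
  intros Hme He Heps Hh HPhi Hn. assert (HP := PI_RGT_0).
  set (mu := effective_azimuthal_number Phi nphi).
  assert (Hmu : / 2 < mu) by now apply effective_azimuthal_number_gt_half.
  set (nu := polar_number Phi nphi k).
  assert (Hnu : nu = mu + INR k) by reflexivity.
  assert (Hk0 := pos_INR k). assert (Hr0 := pos_INR nr).
  assert (Hnupos : 0 < nu) by lra.
  set (c := bohr_wavenumber me e eps0 hbar).
  assert (Hc : 0 < c) by now apply bohr_wavenumber_pos.
  set (E := - (rydberg_energy me e eps0 hbar / (nu + INR nr + 1) ^ 2)).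
  set (kappa := reduced_energy me hbar E).
  assert (Hkappa : kappa = (c / (nu + INR nr + 1)) ^ 2).
  { apply energy_level; auto; lra. }
  destruct (polar_solution_exists k mu ltac:(lra)) as [y [w [Cy [Hpol [Hy [_ [th0 [Hth0 Hyne]]]]]]]].
  destruct (radial_solution_exists c nr Hc nu Hnupos) as [u [v [Cu [Hrad [Hu0 [Huinf [r0 [Hr0' Hune]]]]]]]].
  rewrite <- Hkappa in Hrad. rewrite <- Hnu in Hpol.
  destruct (polar_second_derivative mu _ y w Hpol) as [y1 [y2 [Dy1 [Dy2 Ey]]]].
  destruct (radial_second_derivative nu c kappa u v Hnupos Hrad) as [a1 [a2 [Da1 [Da2 Ea]]]].
  set (a := fun x => u x / x) in *.
  set (f := fun x => sin (mu * x)).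
  assert (Df1 : forall x, 0 < x < Phi -> is_derive f x (mu * cos (mu * x))).
  { intros x Hx. unfold f. auto_derive; [exact I | ring]. }
  assert (Df2 : forall x, 0 < x < Phi -> is_derive (fun x => mu * cos (mu * x)) x (- mu ^ 2 * f x)).
  { intros x Hx. unfold f. auto_derive; [exact I | ring]. }
  destruct (real_twice_differentiable positive a a1 a2 open_positive Da1 Da2) as [SR [R1 R2]].
  destruct (real_twice_differentiable on_sphere y y1 y2 open_sphere Dy1 Dy2) as [ST [T1 T2]].
  destruct (real_twice_differentiable (fun x => 0 < x < Phi) f _ _ (open_open_interval 0 Phi) Df1 Df2)
    as [SF [F1 F2]].
  set (Rad := fun x => RtoC (a x)) in *. set (Th := fun x => RtoC (y x)) in *.
  set (F := fun x => RtoC (f x)) in *.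
  assert (LR : forall r, 0 < r -> CDerive (fun s => (RtoC (s ^ 2) * CDerive Rad s)%C) r
     = RtoC ((nu * (nu + 1) - 2 * c * r + kappa * r ^ 2) * a r)).
  { intros r Hr.
    destruct (CDerive_weighted (fun s => s ^ 2) (CDerive Rad) r (2 * r) (is_derive_sqr r) (proj2 (SR r Hr))) as [_ Hw].
    rewrite Hw, (R1 r Hr), (R2 r Hr), <- !RtoC_mult, <- RtoC_plus. f_equal. apply Ea, Hr. }
  assert (LT : forall t, on_sphere t -> CDerive (fun s => (RtoC (sin s) * CDerive Th s)%C) t
     = RtoC (sin t * (mu ^ 2 / sin t ^ 2 - nu * (nu + 1)) * y t)).
  { intros t Ht.
    destruct (CDerive_weighted sin (CDerive Th) t (cos t) (is_derive_sin t) (proj2 (ST t Ht))) as [_ Hw].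
    rewrite Hw, (T1 t Ht), (T2 t Ht), <- !RtoC_mult, <- RtoC_plus. f_equal. apply Ey, Ht. }
  assert (HKV : forall r, 0 < r ->
    - (hbar ^ 2 / (2 * me)) * (- 2 * c / r + kappa) + coulomb_potential e eps0 r = E).
  { intros r Hr. unfold kappa, c, reduced_energy, bohr_wavenumber, coulomb_potential. field.
    repeat split; lra. }
  assert (HReq : radial_equation me e eps0 hbar nu E Rad).
  { intros r Hr. rewrite (LR r Hr). unfold Rad.
    rewrite <- !RtoC_mult, <- !RtoC_plus. f_equal. rewrite <- (HKV r Hr). field. lra. }
  assert (Ff : F 0 = RtoC 0 /\ F Phi = RtoC 0).
  { unfold F, f. split; f_equal.
    - rewrite Rmult_0_r. apply sin_0.
    - apply sin_eq_0_1. exists (Z.of_nat nphi). rewrite <- INR_IZR_INZ.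
      unfold mu, effective_azimuthal_number. field. lra. }
  assert (Hsep : forall r t x, separated Rad Th F r t x = RtoC (a r * y t * f x)).
  { intros. unfold separated, Rad, Th, F. now rewrite !RtoC_mult. }
  assert (Hreg : regular_at_origin Rad).
  { exists (RtoC 0). apply (filterlim_RtoC (at_right 0) a 0). intros eps Heps'.
    destruct (Rpower_small Cu nu eps Hnupos Heps') as [d0 [Hd0 Hs]].
    destruct (common_bound d0 1 Hd0 Rlt_0_1) as [d [Hd [A1 A2]]].
    exists (mkposreal d Hd). intros x Hx Hx0. change (Rabs (x - 0) < d) in Hx.
    apply Rabs_lt_between in Hx. specialize (Hs x ltac:(lra)). destruct (Hu0 x ltac:(lra)) as [A _].
    rewrite Rminus_0_r. unfold a, Rdiv. rewrite Rabs_mult, (Rabs_pos_eq (/ x)) by (left; apply Rinv_0_lt_compat; lra).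
    apply Rle_lt_trans with (Cu * Rpower x (nu + 1) * / x).
    { apply Rmult_le_compat_r; [left; apply Rinv_0_lt_compat; lra | assumption]. }
    rewrite Rpower_plus, Rpower_1 by lra.
    replace (Cu * (Rpower x nu * x) * / x) with (Cu * Rpower x nu) by (field; lra). assumption. }
  assert (Hnorm : normalisable_at_infinity Rad).
  { exists 1. split; [lra|].
    assert (Hm : forall x, positive x -> Cmod (Rad x) ^ 2 * x ^ 2 = u x * u x).
    { intros x Hx. unfold Rad. rewrite Cmod_R, pow2_abs. unfold a, positive in *. field. lra. }
    apply (ex_RInt_gen_tail _ (Cu ^ 2)).
    - intros x Hx. apply (continuous_ext_loc _ (fun x => u x * u x)).
      + destruct (open_positive x Hx) as [d Hd]. exists d. intros t Ht. symmetry. apply Hm, Hd, Ht.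
      + eapply continuous_of_derive. apply is_derive_Rmult; exact (proj1 (Hrad x Hx)).
    - intros x Hx. rewrite Hm by assumption. apply Rle_0_sqr.
    - intros x Hx. rewrite Hm by (unfold positive; lra). destruct (Huinf x Hx) as [A _].
      replace (Cu ^ 2 / x ^ 2) with ((Cu / x) ^ 2) by (field; lra).
      replace (u x * u x) with (u x ^ 2) by ring. rewrite <- pow2_abs. apply pow_incr.
      split; [apply Rabs_pos | assumption]. }
  destruct (radial_states me e eps0 hbar nu E Rad) as [nr' [Hnodes HE']]; auto.
  { exists r0. split; [assumption|]. apply RtoC_neq_0. unfold a. intros H0.
    apply Hune. replace (u r0) with (u r0 / r0 * r0) by (field; lra). rewrite H0. ring. }
  assert (Hnr : nr' = nr).
  { apply INR_eq. assert (Hr1 := pos_INR nr').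
    apply energy_level in HE'; auto; [|lra]. fold kappa c in HE'. rewrite Hkappa in HE'.
    set (N := nu + INR nr + 1) in *. set (N' := nu + INR nr' + 1) in *.
    assert (HN : 0 < N) by (unfold N; lra). assert (HN' : 0 < N') by (unfold N'; lra).
    assert (Hq : 0 < c / N) by (apply Rdiv_lt_0_compat; lra).
    assert (Hq' : 0 < c / N') by (apply Rdiv_lt_0_compat; lra).
    assert (Heq : c / N = c / N') by nra.
    assert (HNN : N = N').
    { replace N with (c / (c / N)) by (field; lra). rewrite Heq. field; lra. }
    unfold N, N' in HNN. lra. }
  subst nr'.
  exists E, Rad, Th, F. split; [|split].
  - constructor.
    + exact SR.
    + exact ST.
    + exact SF.
    + assert (Hn1 : 0 < INR nphi) by (apply lt_0_INR; lia).
      (* At this angle [mu * phi] is [PI / 2], so the azimuthal factor is 1. *)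
      exists r0, th0, (Phi / (2 * INR nphi)). split.
      * split; [assumption|]. split; [exact Hth0|]. split; [apply Rdiv_lt_0_compat; lra|].
        apply Rmult_lt_reg_r with (2 * INR nphi); [lra|].
        replace (Phi / (2 * INR nphi) * (2 * INR nphi)) with Phi by (field; lra).
        apply le_INR in Hn. simpl in Hn. nra.
      * rewrite Hsep. apply RtoC_neq_0.
        assert (Hf : f (Phi / (2 * INR nphi)) = 1).
        { unfold f, mu, effective_azimuthal_number.
          replace (INR nphi * PI / Phi * (Phi / (2 * INR nphi))) with (PI / 2) by (field; lra).
          apply sin_PI2. }
        rewrite Hf, Rmult_1_r. apply Rmult_integral_contrapositive_currified; [|assumption].
        unfold a. intros H0. apply Hune.
        replace (u r0) with (u r0 / r0 * r0) by (field; lra). rewrite H0. ring.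
    + intros r t x Hw. rewrite (laplacian_separated Phi) by assumption.
      destruct Hw as [Hr [Ht Hx]]. rewrite (LR r Hr), (LT t Ht), (F2 x Hx), Hsep.
      unfold Rad, Th, F. rewrite <- !RtoC_mult, <- !RtoC_plus, <- !RtoC_mult, <- !RtoC_plus. f_equal.
      assert (Hs := sin_bounds t Ht). rewrite <- (HKV r Hr). field. lra.
    + intros r t Hr Ht. split; [|split].
      * intros x Hx. cbv beta. rewrite Hsep.
        apply (filterlim_ext (fun x => RtoC (a r * y t * f x))); [intros z; now rewrite Hsep|].
        apply (filterlim_RtoC (within (fun phi => 0 <= phi <= Phi) (locally x)) (fun x => a r * y t * f x)). intros eps Heps'.
        assert (Hcf : continuous (fun x => a r * y t * f x) x).
        { apply (ex_derive_continuous (V := R_NormedModule)). unfold f. auto_derive. exact I. }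
        destruct (proj1 (filterlim_locally _ _) Hcf (mkposreal eps Heps')) as [d Hd].
        exists d. intros z Hz _. exact (Hd z Hz).
      * rewrite Hsep. f_equal. destruct Ff as [F0 _]. apply RtoC_inj in F0. rewrite F0. ring.
      * rewrite Hsep. f_equal. destruct Ff as [_ F0]. apply RtoC_inj in F0. rewrite F0. ring.
    + assert (Hm : forall x, Cmod (Th x) ^ 2 * sin x = sin x * (y x * y x)).
      { intros x. unfold Th. rewrite Cmod_R, pow2_abs. ring. }
      apply (ex_RInt_gen_sphere _ (Cy * Cy)).
      * intros x Hx. apply (continuous_ext_R (fun x => sin x * (y x * y x))); [intros t; now rewrite Hm|].
        eapply continuous_of_derive. apply is_derive_Rmult; [apply is_derive_sin|].
        apply is_derive_Rmult; apply Dy1, Hx.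
      * intros x Hx. rewrite Hm. assert (Hs := sin_bounds x Hx).
        assert (Hyy : Rabs (y x) <= Cy).
        { apply Rle_trans with (1 := Hy x Hx).
          assert (Hp : Rpower (sin x) mu <= 1) by (apply Rpower_le_1; lra).
          assert (Hp0 := Rpower_pos (sin x) mu). specialize (Hy x Hx).
          assert (A := Rabs_pos (y x)). nra. }
        assert (Hyy2 : y x * y x <= Cy * Cy).
        { rewrite <- (Rabs_pos_eq (y x * y x)) by apply Rle_0_sqr. rewrite Rabs_mult.
          apply Rmult_le_compat; auto using Rabs_pos. }
        assert (Hyy0 : 0 <= y x * y x) by apply Rle_0_sqr. nra.
    + exact Hreg.
    + exact Hnorm.
  - intros r x Hr Hx.
    (* Both poles are covered at once by smallness of [sin t], since the polar factor is at most
       [Cy * sin^mu]. *)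
    assert (G : forall eps, 0 < eps -> exists d, 0 < d /\ forall t, on_sphere t -> sin t < d ->
      Rabs (a r * y t * f x - 0) < eps).
    { intros eps Heps'.
      destruct (Rpower_small (Rabs (a r) * Rabs (f x) * Cy) mu eps ltac:(lra) Heps') as [d [Hd Hs]].
      exists d. split; [assumption|]. intros t Ht Hsin. assert (Hs0 := sin_bounds t Ht).
      apply Rle_lt_trans with (2 := Hs (sin t) ltac:(lra)).
      rewrite Rminus_0_r, !Rabs_mult.
      replace (Rabs (a r) * Rabs (y t) * Rabs (f x)) with (Rabs (a r) * Rabs (f x) * Rabs (y t)) by ring.
      rewrite Rmult_assoc with (r2 := Cy).
      apply Rmult_le_compat_l; [apply Rmult_le_pos; apply Rabs_pos | now apply Hy]. }
    assert (HP2 := PI2_3_2).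
    split; apply (filterlim_ext (fun t => RtoC (a r * y t * f x)));
      try (intros z; now rewrite Hsep).
    + apply (filterlim_RtoC (at_right 0) (fun t => a r * y t * f x) 0).
      intros eps Heps'. destruct (G eps Heps') as [d0 [Hd0 Hs]].
      destruct (common_bound d0 1 Hd0 Rlt_0_1) as [d [Hd [A1 A2]]].
      exists (mkposreal d Hd). intros t Ht Ht0. change (Rabs (t - 0) < d) in Ht.
      apply Rabs_lt_between in Ht. apply Hs; [unfold on_sphere; lra|].
      assert (Hlt := sin_lt_x t ltac:(lra)). lra.
    + apply (filterlim_RtoC (at_left PI) (fun t => a r * y t * f x) 0).
      intros eps Heps'. destruct (G eps Heps') as [d0 [Hd0 Hs]].
      destruct (common_bound d0 1 Hd0 Rlt_0_1) as [d [Hd [A1 A2]]].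
      exists (mkposreal d Hd). intros t Ht Ht0. change (Rabs (t - PI) < d) in Ht.
      apply Rabs_lt_between in Ht. apply Hs; [unfold on_sphere; lra|].
      rewrite <- Rtrigo_facts.sin_pi_minus. assert (Hlt := sin_lt_x (PI - t) ltac:(lra)). lra.
  - unfold has_quantum_numbers. fold mu nu.
    split; [split; [|split] | split; [|split; [|split; [|split]]]].
    + intros x Hx. rewrite (F2 x Hx). unfold F. now rewrite RtoC_mult.
    + apply Ff.
    + apply Ff.
    + intros t Ht. rewrite (LT t Ht). unfold Th. rewrite <- !RtoC_mult, <- RtoC_plus. f_equal.
      assert (Hs := sin_bounds t Ht). field. lra.
    + exact HReq.
    + exact Hnodes.
    + unfold E. do 3 f_equal. unfold principal_number. fold nu. ring.
    + unfold E. do 3 f_equal. rewrite Hnu. unfold mu, effective_azimuthal_number. ring.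
Qed.

Theorem mainTheorem6 (me e eps0 hbar Phi : R)
    (hme : 0 < me) (he : 0 < e) (heps0 : 0 < eps0) (hhbar : 0 < hbar)
    (hPhi : 0 < Phi < 2 * PI) :
  (forall (E : R) (Rad Th F : R -> C),
     separated_bound_state me e eps0 hbar Phi E Rad Th F ->
     (PI < Phi -> vanishes_on_edge Phi (separated Rad Th F)) ->
     exists nphi k nr : nat,
       (1 <= nphi)%nat /\
       has_quantum_numbers me e eps0 hbar Phi E Rad Th F nphi k nr)
  /\
  (forall nphi k nr : nat, (1 <= nphi)%nat ->
     exists (E : R) (Rad Th F : R -> C),
       separated_bound_state me e eps0 hbar Phi E Rad Th F /\
       vanishes_on_edge Phi (separated Rad Th F) /\
       has_quantum_numbers me e eps0 hbar Phi E Rad Th F nphi k nr).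
Proof.
  split.
  - intros E Rad Th F. now apply bound_state_quantum_numbers.
  - intros nphi k nr. now apply quantum_numbers_realised.
Qed.
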